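(* Let $L$ be a finite-dimensional Lie algebra over an algebraically closed field of characteristic zero, with nilradical $N$ (the largest nilpotent ideal of $L$). Then $L\in\mathcal{MU}$ if and only if $L$ is nilpotent or $L/N\cong A_1$.
   Context: For a subalgebra $M$ of $L$, a subalgebra $U$ of $L$ is a supplement to $M$ in $L$ if $L=M+U$. A maximal subalgebra is a proper subalgebra that is maximal under inclusion among proper subalgebras. $\mathcal{MU}$ is the class of Lie algebras $L$ such that every maximal subalgebra of $L$ has a supplement $U$ every element of which acts nilpotently on $L$ (i.e. $\mathrm{ad}_L\,u$ is nilpotent for every $u\in U$). $A_1$ denotes the three-dimensional simple Lie algebra $\mathfrak{sl}_2$ over the base field. *)

(* Defs.v *)
From HB Require Import structures.
From mathcomp Require Import all_boot all_order all_algebra.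
From mathcomp Require Import ring.

Set Implicit Arguments.
Unset Strict Implicit.
Unset Printing Implicit Defensive.

Import GRing.Theory.
Local Open Scope ring_scope.
Local Open Scope quotient_scope.

HB.mixin Record Lmodule_isLie (K : fieldType) L of GRing.Lmodule K L := {
  lie : L -> L -> L;
  lieDl : forall x y z : L, lie (x + y) z = lie x z + lie y z;
  lieDr : forall x y z : L, lie x (y + z) = lie x y + lie x z;
  lieZl : forall (a : K) (x y : L), lie (a *: x) y = a *: lie x y;
  lieZr : forall (a : K) (x y : L), lie x (a *: y) = a *: lie x y;
  liexx : forall x : L, lie x x = 0;
  lie_jacobi : forall x y z : L,
    lie x (lie y z) + lie y (lie z x) + lie z (lie x y) = 0
}.

#[short(type="lieType")]
HB.structure Definition Lie (K : fieldType) :=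
  {L of GRing.Lmodule K L & Lmodule_isLie K L}.

#[short(type="finLieType")]
HB.structure Definition FinLie (K : fieldType) :=
  {L of Lie K L & Vector K L}.

Definition lie_isomorphic (K : fieldType) (L1 L2 : lieType K) : Prop :=
  exists f : {linear L1 -> L2},
    bijective f /\ forall x y : L1, f (lie x y) = lie (f x) (f y).

Section LieAlgebraTheory.
Variables (K : fieldType) (L : finLieType K).
Implicit Types U V W M : {vspace L}.

Lemma lie0r (x : L) : lie x 0 = 0.
Proof. by rewrite -(scale0r (0 : L)) lieZr !scale0r. Qed.

Lemma lie0l (x : L) : lie 0 x = 0.
Proof. by rewrite -(scale0r (0 : L)) lieZl !scale0r. Qed.

Lemma lieNr (x y : L) : lie x (- y) = - lie x y.
Proof. by rewrite -!scaleN1r lieZr. Qed.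

Lemma lieNl (x y : L) : lie (- x) y = - lie x y.
Proof. by rewrite -!scaleN1r lieZl. Qed.

Definition is_subalgebra U : Prop :=
  forall x y : L, x \in U -> y \in U -> lie x y \in U.

(* One-sided closure is enough, the bracket being alternating. *)
Definition is_ideal U : Prop :=
  forall x y : L, y \in U -> lie x y \in U.

(* As for [prodv], brackets of basis vectors suffice; see [lieprodvP]. *)
Definition lieprodv U V : {vspace L} :=
  <<[seq lie u v | u <- vbasis U, v <- vbasis V]>>%VS.

Lemma lieprodvP U V W :
  reflect (forall u v, u \in U -> v \in V -> lie u v \in W)
          (lieprodv U V <= W)%VS.
Proof.
apply: (iffP idP) => [sUVW u v | sUVW]; last first.
  apply/span_subvP => _ /allpairsP[[u v] /= [Uu Vv ->]].
  by apply: sUVW; apply: vbasis_mem.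
move=> /coord_vbasis -> /coord_vbasis ->; apply: (subvP sUVW).
set s := \sum_(i < \dim V) _.
elim/big_ind: _ => [|x y Hx Hy|i _]; first by rewrite lie0l mem0v.
  by rewrite lieDl memvD.
rewrite lieZl memvZ // /s.
elim/big_ind: _ => [|x y Hx Hy|j _]; first by rewrite lie0r mem0v.
  by rewrite lieDr memvD.
rewrite lieZr memvZ //; apply/memv_span/allpairs_f; exact: memt_nth.
Qed.

Definition lower_central U (n : nat) : {vspace L} := iter n (lieprodv U) U.

(* For a subalgebra [U], nilpotency as a Lie algebra in its own right. *)
Definition is_nilpotent U : Prop := exists n, lower_central U n = 0%VS.

Definition ad_nilpotent (u : L) : Prop :=
  exists n, forall x : L, iter n (lie u) x = 0.

Definition is_maximal_subalgebra M : Prop :=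
  [/\ is_subalgebra M, M <> fullv &
      forall U, is_subalgebra U -> U <> fullv -> (M <= U)%VS -> U = M].

Definition is_supplement U M : Prop :=
  is_subalgebra U /\ (M + U)%VS = fullv.

Record lieIdeal := LieIdeal {
  ideal_space :> {vspace L};
  ideal_closed : is_ideal ideal_space
}.

Definition is_nilradical (N : lieIdeal) : Prop :=
  is_nilpotent N /\
  forall I : lieIdeal, is_nilpotent I -> (I <= N)%VS.

End LieAlgebraTheory.

Definition in_MU (K : fieldType) (L : finLieType K) : Prop :=
  forall M : {vspace L}, is_maximal_subalgebra M ->
    exists U : {vspace L},
      is_supplement U M /\ forall u, u \in U -> ad_nilpotent u.

(* Cosets of [N]: [x] and [y] are identified when [x - y \in N]. *)
Definition lie_quotient (K : fieldType) (L : finLieType K) (N : lieIdeal L) :=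
  Quotient.quot (ideal_space N).

Section LieQuotient.
Variables (K : fieldType) (L : finLieType K) (N : lieIdeal L).
Local Notation Q := (lie_quotient N).

HB.instance Definition _ := GRing.Zmodule.on Q.
HB.instance Definition _ := EqQuotient.on Q.

Let qeq (x y : L) : reflect (\pi_Q x = \pi_Q y) (x - y \in ideal_space N).
Proof. by rewrite [_ \in _]Quotient.idealrBE; apply: eqP. Qed.

Let piD (x y : L) : \pi_Q (x + y) = \pi_Q x + \pi_Q y.
Proof. exact: Quotient.pi_add. Qed.

Definition qscale (a : K) (x : Q) : Q := \pi_Q (a *: repr x).

Lemma pi_scale (a : K) (x : L) : qscale a (\pi_Q x) = \pi_Q (a *: x).
Proof.
apply/qeq; rewrite -scalerBr memvZ //.
by apply/qeq; rewrite reprK.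
Qed.

Let qscaleA a b (x : Q) : qscale a (qscale b x) = qscale (a * b) x.
Proof. by elim/quotW: x => x; rewrite (pi_scale b) !pi_scale scalerA. Qed.
Let qscale1 : left_id 1 qscale.
Proof. by elim/quotW=> x; rewrite pi_scale scale1r. Qed.
Let qscaleDr : right_distributive qscale +%R.
Proof.
move=> a; elim/quotW=> x; elim/quotW=> y.
by rewrite -piD !pi_scale -piD scalerDr.
Qed.
Let qscaleDl x : {morph qscale^~ x : a b / a + b}.
Proof. by elim/quotW: x => x a b /=; rewrite !pi_scale -piD scalerDl. Qed.

HB.instance Definition _ :=
  GRing.Zmodule_isLmodule.Build K Q qscaleA qscale1 qscaleDr qscaleDl.

Definition qlie (x y : Q) : Q := \pi_Q (lie (repr x) (repr y)).

Let lie_ideall (x y : L) :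
  x \in ideal_space N -> lie x y \in ideal_space N.
Proof.
move=> Nx; have /eqP := liexx (x + y).
rewrite lieDl !lieDr !liexx add0r addr0 addr_eq0 => /eqP->.
by rewrite memvN; apply: ideal_closed.
Qed.

Lemma pi_lie (x y : L) : qlie (\pi_Q x) (\pi_Q y) = \pi_Q (lie x y).
Proof.
apply/qeq; set x' := repr _; set y' := repr _.
have Nx : x' - x \in ideal_space N by apply/qeq; rewrite reprK.
have Ny : y' - y \in ideal_space N by apply/qeq; rewrite reprK.
have -> : lie x' y' - lie x y = lie (x' - x) y' + lie x (y' - y).
  by rewrite lieDl lieDr lieNl lieNr addrA subrK.
by apply: memvD; [apply: lie_ideall | apply: ideal_closed].
Qed.

Let qlieDl (x y z : Q) : qlie (x + y) z = qlie x z + qlie y z.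
Proof.
elim/quotW: x => x; elim/quotW: y => y; elim/quotW: z => z.
by rewrite -piD !pi_lie -piD lieDl.
Qed.
Let qlieDr (x y z : Q) : qlie x (y + z) = qlie x y + qlie x z.
Proof.
elim/quotW: x => x; elim/quotW: y => y; elim/quotW: z => z.
by rewrite -piD !pi_lie -piD lieDr.
Qed.
Let qlieZl (a : K) (x y : Q) : qlie (a *: x) y = a *: qlie x y.
Proof.
elim/quotW: x => x; elim/quotW: y => y.
by rewrite [a *: \pi_Q x]pi_scale !pi_lie [RHS]pi_scale lieZl.
Qed.
Let qlieZr (a : K) (x y : Q) : qlie x (a *: y) = a *: qlie x y.
Proof.
elim/quotW: x => x; elim/quotW: y => y.
by rewrite [a *: \pi_Q y]pi_scale !pi_lie [RHS]pi_scale lieZr.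
Qed.
Let pi0 : \pi_Q 0 = 0.
Proof. by apply: (addrI (\pi_Q 0)); rewrite -piD !addr0. Qed.
Let qliexx (x : Q) : qlie x x = 0.
Proof. by elim/quotW: x => x; rewrite pi_lie liexx pi0. Qed.
Let qlie_jacobi (x y z : Q) :
  qlie x (qlie y z) + qlie y (qlie z x) + qlie z (qlie x y) = 0.
Proof.
elim/quotW: x => x; elim/quotW: y => y; elim/quotW: z => z.
rewrite (pi_lie y z) (pi_lie z x) (pi_lie x y) !pi_lie -!piD.
by rewrite lie_jacobi pi0.
Qed.

HB.instance Definition _ :=
  Lmodule_isLie.Build K Q qlieDl qlieDr qlieZl qlieZr qliexx qlie_jacobi.

End LieQuotient.

Section SpecialLinear.
Variables (K : fieldType) (n : nat).

Definition traceless : {pred 'M[K]_n} := fun A => \tr A == 0.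

Lemma traceless_submod_closed : submod_closed traceless.
Proof.
split=> [|a A B /eqP trA /eqP trB]; first exact/eqP/mxtrace0.
by apply/eqP; rewrite mxtraceD mxtraceZ trA trB mulr0 addr0.
Qed.

HB.instance Definition _ :=
  GRing.isSubmodClosed.Build K 'M[K]_n traceless traceless_submod_closed.

Record sl := Sl { sl_mx :> 'M[K]_n; _ : sl_mx \in traceless }.

HB.instance Definition _ := [isSub of sl for sl_mx].
HB.instance Definition _ := [Choice of sl by <:].
HB.instance Definition _ := [SubChoice_isSubZmodule of sl by <:].
HB.instance Definition _ := [SubZmodule_isSubLmodule of sl by <:].

Lemma commutator_traceless (A B : 'M[K]_n) :
  A *m B - B *m A \in traceless.
Proof. by apply/eqP; rewrite raddfB /= mxtrace_mulC subrr. Qed.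

Definition sl_lie (A B : sl) : sl := Sl (commutator_traceless A B).

Let sl_lieDl (A B C : sl) : sl_lie (A + B) C = sl_lie A C + sl_lie B C.
Proof.
by apply/val_inj; rewrite /= mulmxDl mulmxDr opprD addrACA.
Qed.
Let sl_lieDr (A B C : sl) : sl_lie A (B + C) = sl_lie A B + sl_lie A C.
Proof.
by apply/val_inj; rewrite /= mulmxDl mulmxDr opprD addrACA.
Qed.
Let sl_lieZl (a : K) (A B : sl) : sl_lie (a *: A) B = a *: sl_lie A B.
Proof. by apply/val_inj; rewrite /= -scalemxAl -scalemxAr scalerBr. Qed.
Let sl_lieZr (a : K) (A B : sl) : sl_lie A (a *: B) = a *: sl_lie A B.
Proof. by apply/val_inj; rewrite /= -scalemxAl -scalemxAr scalerBr. Qed.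
Let sl_liexx (A : sl) : sl_lie A A = 0.
Proof. by apply/val_inj; rewrite /= subrr. Qed.
Let sl_lie_jacobi (A B C : sl) :
  sl_lie A (sl_lie B C) + sl_lie B (sl_lie C A) + sl_lie C (sl_lie A B) = 0.
Proof.
apply/val_inj; rewrite /= !mulmxBr !mulmxBl !mulmxA.
move: (_ *m sl_mx C) (_ *m sl_mx B) (_ *m sl_mx C) (_ *m sl_mx A)
  (_ *m sl_mx B) (_ *m sl_mx A) => P1 P2 P3 P4 P5 P6.
by apply/matrixP => i j; rewrite !mxE; ring.
Qed.

HB.instance Definition _ := Lmodule_isLie.Build K sl
  sl_lieDl sl_lieDr sl_lieZl sl_lieZr sl_liexx sl_lie_jacobi.

End SpecialLinear.

(* Main.v *)
(* Suppose L is in MU.  If A is an ideal with [A, A] <= N and a in A is not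
   ad-nilpotent, then x |-> tr (ad x (ad a)^k), for a suitable k, is a functional
   killing [L, L] and all ad-nilpotent elements, so its kernel is a maximal
   subalgebra without the required supplement.  Hence L / N is semisimple.
   A semisimple L in MU is generated by a principal sl2-triple (e, h, f): let M
   be a maximal subalgebra containing the triple and U an ad-nilpotent supplement
   of M.  By Engel's theorem for U and the Casimir operator, an invariant of M in
   a representation on which U acts nilpotently is an invariant of L.  Since the
   centralizer of h is a torus, M has no abelian ideals, so M and its Killing
   orthogonal are complementary; the orthogonal projection onto M is an invariant
   of M in End L, hence of L.  Thus M is an ideal, its orthogonal centralizes e
   and h, so vanishes, and M = L, which is absurd.
   Conversely, N supplements every maximal subalgebra not containing it.  When
   L / N is sl2, the remaining maximal subalgebras have codimension 1 and are
   supplemented by the line of e, f or e - h - f, which act nilpotently because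
   [h, e] = 2 e modulo N forces tr (ad e)^k = 0. *)
Require Import Defs.
From HB Require Import structures.
From mathcomp Require Import all_boot all_order all_algebra.
From mathcomp Require Import ring zify.
From Stdlib Require Import Classical.
Set Implicit Arguments.
Unset Strict Implicit.
Unset Printing Implicit Defensive.
Import GRing.Theory.
Local Open Scope ring_scope.
Local Open Scope quotient_scope.

(** * Traces and spectral projections *)

(** Nilpotency is tested by traces: over an algebraically closed field of characteristic zero, [f]
    is nilpotent as soon as every [f^k] with [k > 0] has trace 0. Elements whose brackets lie in [N]
    need not commute, so the traces are computed up to operators pushing the flag [L], [[N, L]],
    [[N, [N, L]]], ... one step down; such operators have trace 0. The triple has to be principal
    because its [ad h] weights are then all even: every nonzero subspace stable under the triple
    contains a vector of weight 0, hence one centralizing [h]. This is how an abelian ideal of [M]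
    is made to meet the torus. The field [K] carries no order. Positivity comes from integer-valued
    functions respecting the integer relations among finitely many scalars or weights; they serve
    both in Cartan's criterion, applied to eigenvalues, and in the choice of positive roots. *)

Section Subspaces.
Variables (K : fieldType) (V : vectType K).

Lemma max_dim_vspace (P : {vspace V} -> Prop) (U0 : {vspace V}) : P U0 ->
  exists U, P U /\ forall W, P W -> (\dim W <= \dim U)%N.
Proof.
have [k] := ubnP (\dim {:V} - \dim U0)%N; elim: k U0 => // k IHk U0 ltk PU0.
case: (classic (exists W, P W /\ (\dim U0 < \dim W)%N)) => [[W [PW ltW]]|noW].
  apply: (IHk W) => //; have := dimvS (subvf W); lia.
exists U0; split=> // W PW; rewrite leqNgt; apply/negP => ltW.
by apply: noW; exists W.
Qed.

Lemma min_dim_vspace (P : {vspace V} -> Prop) (U0 : {vspace V}) : P U0 ->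
  exists U, P U /\ forall W, P W -> (\dim U <= \dim W)%N.
Proof.
have [k] := ubnP (\dim U0); elim: k U0 => // k IHk U0 ltk PU0.
case: (classic (exists W, P W /\ (\dim W < \dim U0)%N)) => [[W [PW ltW]]|noW].
  by apply: (IHk W) => //; lia.
exists U0; split=> // W PW; rewrite leqNgt; apply/negP => ltW.
by apply: noW; exists W.
Qed.

(** Serves to form the submodule generated by a vector, whose natural spanning set is infinite. A
    [U] of least dimension works, since [U :&: W] is another candidate. *)
Lemma span_pred (P : V -> Prop) : exists U : {vspace V},
  (forall v, P v -> v \in U) /\
  forall W : {vspace V}, (forall v, P v -> v \in W) -> (U <= W)%VS.
Proof.
have [U [PU minU]] := @min_dim_vspace
  (fun U => forall v, P v -> v \in U) fullv (fun v _ => memvf v).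
exists U; split=> // W PW.
have sUW : (U :&: W <= U)%VS by apply: capvSl.
have /minU leU : forall v, P v -> v \in (U :&: W)%VS.
  by move=> v Pv; rewrite memv_cap PU ?PW.
have /eqP <- : (U :&: W == U)%VS by rewrite eqEdim sUW.
exact: capvSr.
Qed.

End Subspaces.

Section Trace.
Import VectorInternalTheory.
Variables (K : fieldType) (V : vectType K).
Implicit Types f g : 'End(V).

Definition ltrace f : K := \tr (f2mx f).

Definition lnilp f : Prop := exists k, forall v, iter k f v = 0.

Lemma v2r_lfun f v : v2r (f v) = v2r v *m f2mx f.
Proof. by rewrite /fun_of_lfun unlock /fun_of_lfun_def /= r2vK. Qed.

Lemma f2mx_eq f (A : 'M[K]_(dim V)) :
  (forall v, v2r (f v) = v2r v *m A) -> f2mx f = A.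
Proof.
move=> fA; apply/row_matrixP => i; rewrite !rowE -(r2vK (delta_mx 0 i)).
by rewrite -fA v2r_lfun.
Qed.

Lemma f2mx_comp f g : f2mx (f \o g)%VF = f2mx g *m f2mx f.
Proof. by apply: f2mx_eq => v; rewrite comp_lfunE !v2r_lfun mulmxA. Qed.

Lemma ltrace_comm f g : ltrace (f \o g)%VF = ltrace (g \o f)%VF.
Proof. by rewrite /ltrace !f2mx_comp mxtrace_mulC. Qed.

Lemma ltrace_is_scalar : scalar ltrace.
Proof.
move=> a f g; rewrite /ltrace -mxtraceZ -mxtraceD; congr (\tr _).
apply: f2mx_eq => v; rewrite add_lfunE scale_lfunE linearD linearZ /=.
by rewrite !v2r_lfun mulmxDr scalemxAr.
Qed.
HB.instance Definition _ := GRing.isLinear.Build K 'End(V) K *%R ltrace ltrace_is_scalar.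

(** A nilpotent [A] of positive size is singular, so it factors as [C R] through a smaller size. The
    matrix [R C] has the same trace and is nilpotent too, because [(R C)^(k+1) = R A^k C]; hence
    induction on the size. *)
Lemma mxtrace_nilp n (A : 'M[K]_n) k : A ^+ k = 0 -> \tr A = 0.
Proof.
have [m] := ubnP n; elim: m n A k => // m IHm n A k ltnm Ak0.
have [ltrn|] := ltnP (\rank A) n; last first.
  move=> rA; have uA : row_full A by rewrite /row_full eqn_leq rank_leq_col.
  have {}uA : A \in unitmx by rewrite -row_full_unit.
  have : (A ^+ k) \in unitmx.
    by elim: (k) => [|i IHi]; rewrite ?expr0 ?unitmx1 // exprS unitmx_mul uA.
  rewrite Ak0; case: (n) A {rA uA Ak0 ltnm} => [|n'] A.
    by move=> _; rewrite /mxtrace big_ord0.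
  by rewrite unitmxE det0 unitr0.
move: (\rank A) (row_base A) (col_base A) (mulmx_base A) ltrn => r R C defA ltrn.
rewrite -defA mxtrace_mulC.
apply: (IHm _ _ k.+1); first by apply: leq_trans ltrn _.
suff -> : (R *m C) ^+ k.+1 = R *m (A ^+ k) *m C by rewrite Ak0 mulmx0 mul0mx.
elim: k {Ak0} => [|k IHk]; first by rewrite expr0 expr1 mulmx1.
rewrite exprSr IHk exprSr; move: (A ^+ k) => B.
by rewrite -!mulmxE -[in RHS]defA !mulmxA.
Qed.

Lemma v2r_iter f k v : v2r (iter k f v) = v2r v *m (f2mx f) ^+ k.
Proof.
elim: k v => [|k IHk] v; first by rewrite expr0 mulmx1.
by rewrite iterSr IHk v2r_lfun exprS -mulmxE mulmxA.
Qed.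

Lemma ltrace_nilp f : lnilp f -> ltrace f = 0.
Proof.
case=> k fk; apply: (@mxtrace_nilp _ _ k); apply/row_matrixP => i.
by rewrite rowE -(r2vK (delta_mx 0 i)) -v2r_iter fk linear0 row0.
Qed.

(** In a full-rank factorization [A = C R], both factors can be cancelled in [C R C R = C R]. So
    [R C = 1], an identity matrix of size [\rank A]. *)
Lemma mxtrace_idem n (A : 'M[K]_n) : A *m A = A -> \tr A = (\rank A)%:R.
Proof.
move=> AA; have fc : row_free (col_base A)^T.
  by rewrite /row_free mxrank_tr; apply: col_base_full.
move: (\rank A) (row_base A) (col_base A) (row_base_free A) (mulmx_base A) fc.
move=> r R C fR defA fC; rewrite -{1}defA mxtrace_mulC.
suff -> : R *m C = 1%:M by rewrite mxtrace1.
apply: (row_free_inj fR); apply: trmx_inj; apply: (row_free_inj fC).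
apply: trmx_inj; rewrite !trmx_mul !trmxK mul1mx.
by rewrite -(mulmxA R C R) defA mulmxA defA.
Qed.

Lemma ltrace_idem f : (forall v, f (f v) = f v) -> ltrace f = (\rank (f2mx f))%:R.
Proof.
move=> ff; apply: mxtrace_idem; rewrite -f2mx_comp; congr f2mx.
by apply/lfunP => v; rewrite comp_lfunE ff.
Qed.

Lemma rank_f2mx_gt0 f : f <> 0 -> (0 < \rank (f2mx f))%N.
Proof.
move=> nzf; rewrite lt0n mxrank_eq0; apply/eqP => f0; apply: nzf; apply/lfunP => v.
by apply: v2r_inj; rewrite v2r_lfun f0 mulmx0 zero_lfunE linear0.
Qed.

End Trace.

Section PolyEval.
Import VectorInternalTheory.
Variables (K : fieldType) (V : vectType K).
Implicit Types (f g : 'End(V)) (p q : {poly K}).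

Definition lpow f k : 'End(V) := iter k (comp_lfun f) \1%VF.

Lemma lpowS f k : lpow f k.+1 = (f \o lpow f k)%VF. Proof. by []. Qed.

Lemma lpowE f k v : lpow f k v = iter k f v.
Proof. by elim: k => [|k IHk]; rewrite ?id_lfunE //= comp_lfunE IHk. Qed.

Lemma iter_lfun0 f k : iter k f 0 = 0.
Proof. by rewrite -lpowE linear0. Qed.

Definition peval f p : 'End(V) := \sum_(i < size p) p`_i *: lpow f i.

Lemma peval_wide N f p : (size p <= N)%N ->
  peval f p = \sum_(i < N) p`_i *: lpow f i.
Proof.
move=> leN; rewrite /peval (big_ord_widen N (fun i => p`_i *: lpow f i) leN).
rewrite [LHS]big_mkcond; apply: eq_bigr => i _; case: ifP => // /negbT.
by rewrite -leqNgt => ?; rewrite nth_default // scale0r.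
Qed.

Lemma pevalD f p q : peval f (p + q) = peval f p + peval f q.
Proof.
have leN := size_polyD p q.
rewrite (peval_wide f leN) (peval_wide f (leq_maxl (size p) (size q))).
rewrite (peval_wide f (leq_maxr (size p) (size q))) -big_split /=.
by apply: eq_bigr => i _; rewrite coefD scalerDl.
Qed.

Lemma pevalZ f a p : peval f (a *: p) = a *: peval f p.
Proof.
rewrite (peval_wide f (size_scale_leq a p)) scaler_sumr.
by apply: eq_bigr => i _; rewrite coefZ scalerA.
Qed.

Lemma peval_is_linear f : linear (peval f).
Proof. by move=> a p q; rewrite pevalD pevalZ. Qed.
HB.instance Definition _ f :=
  GRing.isLinear.Build K {poly K} 'End(V) *:%R (peval f) (peval_is_linear f).

Lemma pevalC f c : peval f c%:P = c *: \1%VF.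
Proof.
rewrite (peval_wide f (size_polyC_leq1 c)) big_ord1 coefC eqxx.
by congr (_ *: _); apply/lfunP => v; rewrite lpowE.
Qed.

Lemma peval1 f : peval f 1 = \1%VF.
Proof. by rewrite pevalC scale1r. Qed.

Lemma pevalMX f p : peval f (p * 'X) = (f \o peval f p)%VF.
Proof.
rewrite (@peval_wide (size p).+1); last first.
  by rewrite (leq_trans (size_polyMleq _ _)) // size_polyX addn2.
rewrite big_ord_recl coefMX scale0r add0r; apply/lfunP => v.
rewrite comp_lfunE !sum_lfunE linear_sum; apply: eq_bigr => i _.
by rewrite coefMX /= !scale_lfunE linearZ /= comp_lfunE.
Qed.

Lemma pevalX f : peval f 'X = f.
Proof. by rewrite -['X]mul1r pevalMX peval1 comp_lfun1r. Qed.

Lemma peval_comm f p : (f \o peval f p = peval f p \o f)%VF.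
Proof.
apply/lfunP => v; rewrite !comp_lfunE !sum_lfunE linear_sum.
by apply: eq_bigr => i _; rewrite !scale_lfunE linearZ /= !lpowE -iterS iterSr.
Qed.

Lemma pevalM f p q : peval f (p * q) = (peval f p \o peval f q)%VF.
Proof.
elim/poly_ind: p q => [|p c IHp] q; first by rewrite mul0r linear0 comp_lfun0l.
rewrite mulrDl -mulrA ['X * q]mulrC !pevalD IHp !pevalMX mul_polyC pevalZ pevalC.
rewrite comp_lfunDl; congr (_ + _); first by rewrite comp_lfunA -peval_comm.
by apply/lfunP => v; rewrite comp_lfunE !scale_lfunE id_lfunE.
Qed.

Lemma peval_dvdp f p q : p %| q -> peval f p = 0 -> peval f q = 0.
Proof. by case/dvdpP => r -> p0; rewrite pevalM p0 comp_lfun0r. Qed.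

Lemma peval_XsubC_exp f a m :
  peval f (('X - a%:P) ^+ m) = lpow (f - a *: \1%VF) m.
Proof.
elim: m => [|m IHm]; first by rewrite expr0 peval1.
by rewrite exprS pevalM IHm -polyCN pevalD pevalX pevalC scaleNr.
Qed.

Lemma peval_stable f p (U : {vspace V}) :
  {in U, forall v, f v \in U} -> {in U, forall v, peval f p v \in U}.
Proof.
move=> fU v Uv; rewrite sum_lfunE memv_suml // => i _; rewrite scale_lfunE memvZ //.
by rewrite lpowE; elim: (nat_of_ord i) => //= k; apply: fU.
Qed.

Lemma annihilating_poly f : exists2 p, p != 0 & peval f p = 0.
Proof.
have [p nzp pA] : exists2 p : {poly K}, p != 0 &
    \sum_(i < size p) p`_i *: (f2mx f) ^+ i = 0.
  move: (f2mx f); case: (dim V) => [|n] A.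
    by exists 1; [apply: oner_neq0 | apply: flatmx0].
  exists (char_poly A); first exact: monic_neq0 (char_poly_monic A).
  rewrite -[RHS](Cayley_Hamilton A) /horner_mx /horner_morph horner_coef.
  rewrite size_map_poly; apply: eq_bigr => i _.
  by rewrite coef_map -mul_scalar_mx.
exists p => //; apply/lfunP => v; rewrite sum_lfunE zero_lfunE.
apply: v2r_inj; rewrite [RHS]linear0 -(mulmx0 _ (v2r v)) -pA.
rewrite raddf_sum mulmx_sumr; apply: eq_bigr => i _.
by rewrite scale_lfunE [LHS]linearZ /= lpowE v2r_iter scalemxAr.
Qed.

End PolyEval.

(** Orthogonal idempotents of the Chinese remainder theorem modulo [P]; evaluated at an operator
    killed by [P] they project onto its generalized eigenspaces. When a root [c] is added, a Bezout
    relation [u P + v Q = 1] gives [u P] as the new idempotent, and the old ones are multiplied by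
    [v Q]. *)
Lemma crt_polys (K : fieldType) (X : seq K) (m : nat) : uniq X ->
  exists e : K -> {poly K}, let P := \prod_(a <- X) ('X - a%:P) ^+ m in
  [/\ P %| 1 - \sum_(a <- X) e a,
      {in X, forall a, P %| ('X - a%:P) ^+ m * e a} &
      {in X &, forall a b, a != b -> P %| e a * e b}].
Proof.
elim: X => [|c X IHX] /=.
  by exists (fun=> 0); rewrite !big_nil dvd1p; split=> // a b; rewrite in_nil.
case/andP => cX /IHX[e [e1 em ee]] {IHX}.
set P := \prod_(a <- X) _ in e1 em ee *; set Q := ('X - c%:P) ^+ m.
have : coprimep P Q.
  rewrite coprimep_sym /P; elim: (X) cX => [|a Y IHY]; rewrite ?big_nil ?coprimep1 //.
  rewrite inE negb_or big_cons coprimepMr => /andP[ca /IHY->]; rewrite andbT.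
  by rewrite coprimep_expl // coprimep_expr // coprimep_XsubC root_XsubC eq_sym.
case/Bezout_eq1_coprimepP => -[u v] /= uv1.
exists (fun a => if a == c then u * P else e a * v * Q).
have nc a : a \in X -> (a == c) = false.
  by move=> Xa; apply: contraNF cX => /eqP <-.
have Pe a : a \in X -> P * Q %| Q * (u * P) /\ P * Q %| ('X - a%:P) ^+ m * (e a * v * Q).
  move=> Xa; split; first by rewrite mulrCA [Q * P]mulrC dvdp_mull.
  by rewrite !mulrA dvdp_mul // -mulrA mulrCA mulrC mulrAC dvdp_mulr // em.
have sumE : \sum_(a <- X) (if a == c then u * P else e a * v * Q) =
            (\sum_(a <- X) e a) * (v * Q).
  by rewrite mulr_suml; apply: eq_big_seq => a Xa /=; rewrite nc // mulrA.
rewrite /= !big_cons eqxx sumE -/P -/Q; split.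
- rewrite -{1}uv1 opprD addrACA subrr add0r -{1}[v * Q]mul1r -mulrBl.
  by rewrite [Q * P]mulrC mulrA dvdp_mul // dvdp_mulr.
- move=> a; rewrite inE => /predU1P[->|Xa]; rewrite ?eqxx ?nc //.
    by rewrite mulrCA -/Q [Q * P]mulrC dvdp_mull.
  by rewrite -/Q [Q * P]mulrC; case: (Pe a Xa).
move=> a b; rewrite !inE => /predU1P[->|Xa] /predU1P[->|Xb]; rewrite ?eqxx ?nc // => neq.
- by rewrite [Q * P]mulrC mulrACA dvdp_mull.
- by rewrite mulrACA dvdp_mull.
have -> : e a * v * Q * (e b * v * Q) = Q * (e a * e b * (v * v * Q)) by ring.
by rewrite dvdp_mul // dvdp_mulr // ee.
Qed.

Section Spectral.
Variables (K : closedFieldType) (V : vectType K).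
Implicit Types (f : 'End(V)) (a b : K).

Definition gen_eigen f a v := exists k, lpow (f - a *: \1%VF) k v = 0.

(** [X] may contain scalars that are not eigenvalues, where [E] vanishes; this lets two operators
    share one list. That each [E a] is a polynomial in [f] makes it preserve [f]-stable subspaces
    and commute with whatever commutes with [f]. *)
Definition spectral_proj f (X : seq K) (E : K -> 'End(V)) : Prop :=
  [/\ uniq X,
      forall v, v = \sum_(a <- X) E a v,
      forall a b v, E a (E b v) = if a == b then E b v else 0,
      forall a, exists p, E a = peval f p &
      (exists m, forall a v, lpow (f - a *: \1%VF) m (E a v) = 0) /\ (forall a, a \notin X -> E a = 0)].

Lemma spectral_projP f : exists X E, spectral_proj f X E.
Proof.
have [p nzp pf] := annihilating_poly f.
have [r def_p] := closed_field_poly_normal p.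
(* The number of roots bounds every multiplicity, so a single exponent [m] serves all of them. *)
set X := undup r; set m := size r.
have uX : uniq X by apply: undup_uniq.
have [e /= ] := crt_polys m uX; set P := \prod_(a <- X) _ => -[e1 em ee].
have Pf : peval f P = 0.
  apply: peval_dvdp pf; rewrite def_p dvdpZl ?lead_coef_eq0 // /P /m /X.
  rewrite -(big_undup_iterop_count _ r) /=.
  elim: (undup r) => [|c s IHs]; first by rewrite !big_nil.
  rewrite !big_cons dvdp_mul //.
  exact/dvdp_exp2l/count_size.
exists X, (fun a => if a \in X then peval f (e a) else 0); split=> //.
- move=> v; have /(peval_dvdp e1) := Pf; rewrite linearB /= peval1 => /eqP.
  rewrite subr_eq0 linear_sum => /eqP/lfunP/(_ v); rewrite id_lfunE => {1}->.
  by rewrite sum_lfunE; apply: eq_big_seq => a -> .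
- move=> a b v; case: (boolP (a \in X)) => Xa; case: (boolP (b \in X)) => Xb.
  + case: eqP => [<-{b Xb}|/eqP neq]; last first.
      by rewrite -comp_lfunE -pevalM (peval_dvdp _ Pf) ?zero_lfunE // ee.
    have Eab b w : b \in X -> b != a -> peval f (e b) (peval f (e a) w) = 0.
      by move=> Xb neq; rewrite -comp_lfunE -pevalM (peval_dvdp _ Pf) ?zero_lfunE // ee.
    have /(peval_dvdp e1) := Pf; rewrite linearB /= peval1 => /eqP.
    rewrite subr_eq0 linear_sum => /eqP/lfunP/(_ (peval f (e a) v)).
    rewrite id_lfunE => {2}->; rewrite [RHS]sum_lfunE (bigD1_seq a) //= big_seq_cond.
    by rewrite big1 ?addr0 // => b /andP[Xb neq]; apply: Eab.
  + by rewrite zero_lfunE linear0; case: eqP.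
  + by rewrite zero_lfunE; case: eqP Xa => // ->; rewrite Xb.
  + by rewrite !zero_lfunE; case: eqP.
- by move=> a; case: ifP => _; [exists (e a) | exists 0; rewrite linear0].
split=> [|a /negPf-> //]; exists m => a v; case: ifPn => Xa; last first.
  by rewrite zero_lfunE linear0.
by rewrite -peval_XsubC_exp -comp_lfunE -pevalM (peval_dvdp (em _ Xa) Pf) zero_lfunE.
Qed.
End Spectral.

Lemma natr_neq0 (K : fieldType) (char0 : [pchar K] =i pred0) n :
  (0 < n)%N -> n%:R != 0 :> K.
Proof. by move/pcharf0P: char0 => ->; rewrite lt0n. Qed.

Section GenEigen.
Variables (K : closedFieldType) (V : vectType K).
Hypothesis char0 : [pchar K] =i pred0.
Implicit Types (f : 'End(V)) (a b : K).

Lemma gen_eigen_coprime f p a v : ~~ root p a -> peval f p v = 0 ->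
  gen_eigen f a v -> v = 0.
Proof.
move=> pa pv [k]; rewrite -peval_XsubC_exp => fv.
have /Bezout_eq1_coprimepP[[u w] /= uw] : coprimep p (('X - a%:P) ^+ k).
  by rewrite coprimep_expr // coprimep_XsubC.
rewrite -[v]id_lfunE -(peval1 f) -uw linearD /= !pevalM add_lfunE !comp_lfunE.
by rewrite pv fv !linear0 addr0.
Qed.

Lemma gen_eigen_disj f a b v : a != b -> gen_eigen f a v -> gen_eigen f b v ->
  v = 0.
Proof.
move=> neq [k]; rewrite -peval_XsubC_exp; apply: gen_eigen_coprime.
by rewrite rootE horner_exp hornerXsubC expf_neq0 // subr_eq0 eq_sym.
Qed.

Lemma spectral_proj_id f X E a v : spectral_proj f X E -> gen_eigen f a v ->
  E a v = v.
Proof.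
case=> uX sumE EE pE [[m gE] E0] fv.
have Eb b : b != a -> E b v = 0.
  move=> neq; apply: (gen_eigen_disj neq (ex_intro _ m (gE _ _))).
  have [p ->] := pE b; case: fv => k fk; exists k; move: fk.
  rewrite -peval_XsubC_exp => fk.
  by rewrite -comp_lfunE -pevalM mulrC pevalM comp_lfunE fk linear0.
case: (boolP (a \in X)) => Xa; rewrite [RHS]sumE.
  rewrite (bigD1_seq a) //= big_seq_cond big1 ?addr0 // => b /andP[_]; exact: Eb.
rewrite E0 // zero_lfunE big_seq big1 // => b Xb; apply: Eb.
by apply: contraNneq Xa => <-.
Qed.

Lemma spectral_nilp f X E a : spectral_proj f X E ->
  lnilp ((f - a *: \1) \o E a)%VF.
Proof.
case=> uX sumE EE pE [[m gE] E0]; exists m.+1 => v.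
have [p def_p] := pE a; rewrite -lpowE.
have -> : ((f - a *: \1) \o E a)%VF = peval f (('X - a%:P) * p).
  by rewrite pevalM linearB /= pevalX pevalC def_p.
have -> q k : lpow (peval f q) k = peval f (q ^+ k).
  by elim: k => [|k IHk]; rewrite ?expr0 ?peval1 // exprS pevalM -IHk.
have -> : (('X - a%:P) * p) ^+ m.+1 = p ^+ m * ('X - a%:P) * (('X - a%:P) ^+ m * p).
  by rewrite exprMn !exprS; ring.
by rewrite !pevalM !comp_lfunE peval_XsubC_exp -def_p gE !linear0.
Qed.

Lemma spectral_widen f X E Z : spectral_proj f X E -> uniq Z -> {subset X <= Z} ->
  spectral_proj f Z E.
Proof.
case=> uX sumE EE pE [mE EX0] uZ sXZ; split=> //; last first.
  by split=> // a Za; apply: EX0; apply: contra Za; apply: sXZ.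
move=> v; rewrite [LHS]sumE [RHS](bigID (mem X)) /= [X in _ = _ + X]big1 ?addr0; last first.
  by move=> a Xa; rewrite EX0 // zero_lfunE.
rewrite -[RHS]big_filter; apply: perm_big; apply: uniq_perm; rewrite ?filter_uniq // => a.
by rewrite mem_filter /=; case: (boolP (a \in X)) => // /sXZ ->.
Qed.

Lemma ltrace_spectral f X E a : spectral_proj f X E ->
  ltrace (f \o E a)%VF = a * ltrace (E a).
Proof.
move=> fE; have := ltrace_nilp (spectral_nilp a fE).
rewrite comp_lfunDl comp_lfunNl -comp_lfunZl comp_lfun1l linearB linearZ /=.
by move/eqP; rewrite subr_eq0 => /eqP.
Qed.

(** For [a != 0], ['X] is invertible modulo [('X - a)^m], so [E a] is a polynomial in [f] without
    constant term and has trace 0. Its trace is also its rank, which in characteristic zero forces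
    [E a = 0]; only the eigenvalue 0 is left. *)
Lemma nilp_ltrace f : (forall k, ltrace (lpow f k.+1) = 0) -> lnilp f.
Proof.
move=> trf; have [X [E fE]] := spectral_projP f.
have E0 a : a != 0 -> E a = 0.
  move=> nza; apply: NNPP => nzE; case: (fE) => uX sumE EE pE [[m gE] E0].
  have trE : ltrace (E a) = (\rank (VectorInternalTheory.f2mx (E a)))%:R.
    by apply: ltrace_idem => v; rewrite EE eqxx.
  have [p def_p] := pE a.
  have /Bezout_eq1_coprimepP[[u w] /= uw] : coprimep 'X (('X - a%:P) ^+ m).
    by rewrite coprimep_expr // coprimep_XsubC rootX.
  have mp : peval f (('X - a%:P) ^+ m * p) = 0.
    apply/lfunP => v; rewrite zero_lfunE -(gE a v) def_p -peval_XsubC_exp.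
    by rewrite pevalM comp_lfunE.
  have trX q : ltrace (peval f (q * 'X)) = 0.
    rewrite linear_sum big1 // => -[[|i] ltiq] _; rewrite linearZ /= ?trf ?mulr0 //.
    by rewrite coefMX mul0r.
  have := natr_neq0 char0 (rank_f2mx_gt0 nzE); rewrite -trE def_p -[p]mul1r -uw.
  have -> : (u * 'X + w * ('X - a%:P) ^+ m) * p =
    (u * p) * 'X + w * (('X - a%:P) ^+ m * p) by ring.
  by rewrite linearD /= [peval f (w * _)]pevalM mp comp_lfun0r addr0 trX eqxx.
case: (fE) => uX sumE EE pE [[m gE] EX0]; exists m => v.
have -> : v = E 0 v.
  rewrite [LHS]sumE; case: (boolP (0 \in X)) => X0.
    by rewrite (bigD1_seq 0) //= big1 ?addr0 // => b nzb; rewrite E0 // zero_lfunE.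
  rewrite (EX0 0) // big_seq big1 ?zero_lfunE // => a Xa.
  by rewrite E0 ?zero_lfunE //; apply: contraNneq X0 => <-.
by have := gE 0 v; rewrite scale0r subr0 lpowE.
Qed.

End GenEigen.

Section BilinearForms.
Variables (K : fieldType) (V : vectType K) (B : V -> V -> K).
Hypothesis Bl : forall a u v w, B (a *: u + v) w = a * B u w + B v w.
Hypothesis Br : forall a u v w, B w (a *: u + v) = a * B w u + B w v.
Hypothesis nondeg : forall u, (forall v, B u v = 0) -> u = 0.

Lemma form_represent (phi : V -> K) : scalar phi ->
  exists z, forall v, phi v = B z v.
Proof.
move=> phi_lin.
pose Bz z : 'Hom(V, K^o) := linfun (B z : V -> K^o).
have BzE z v : Bz z v = B z v.
  have lin : linear (B z : V -> K^o) by move=> a u w; rewrite Br.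
  pose F : {linear V -> K^o} := HB.pack (B z : V -> K^o) (GRing.isLinear.Build K V K^o *:%R _ lin).
  exact: (lfunE F).
have linBz : linear Bz.
  move=> a u v; apply/lfunP => w; rewrite add_lfunE scale_lfunE !BzE.
  exact: Bl.
pose G : {linear V -> 'Hom(V, K^o)} := HB.pack Bz (GRing.isLinear.Build K V 'Hom(V, K^o) *:%R _ linBz).
have G0 : lker (linfun G) == 0%VS.
  apply/lker0P => u v; rewrite !lfunE /= => eqG; apply/eqP; rewrite -subr_eq0.
  apply/eqP/nondeg => w; rewrite -(addrC (- v)) -scaleN1r Bl mulN1r.
  by have /lfunP/(_ w) := eqG; rewrite !BzE => ->; rewrite addNr.
have Gf : limg (linfun G) = fullv.
  apply/eqP; rewrite eqEdim subvf limg_dim_eq ?(eqP G0) ?capv0 //.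
  have -> : \dim {:'Hom(V, K^o)} = (dim V * 1)%N by rewrite dimvf.
  by rewrite muln1 dimvf /=.
pose F : {linear V -> K^o} := HB.pack (phi : V -> K^o) (GRing.isLinear.Build K V K^o *:%R _ phi_lin).
have /memv_imgP[z _ def_phi] : linfun F \in limg (linfun G) by rewrite Gf memvf.
exists z => v; rewrite -BzE; have /lfunP/(_ v) := def_phi.
by rewrite !lfunE.
Qed.

End BilinearForms.

Section Separation.
Import VectorInternalTheory.

Lemma separating_form (K : fieldType) (V : vectType K) (U : {vspace V}) v :
  v \notin U -> exists phi : V -> K,
    [/\ scalar phi, {in U, forall u, phi u = 0} & phi v != 0].
Proof.
move=> Uv; set w := v - projv U v.
have nzw : v2r w != 0.
  apply: contraNneq Uv => w0; have /eqP : w = 0 by apply: v2r_inj; rewrite w0 linear0.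
  by rewrite subr_eq0 => /eqP ->; apply: memv_proj.
have [i nzi] : exists i, v2r w 0 i != 0.
  apply: NNPP => noi; case/eqP: nzw; apply/rowP => i; rewrite mxE; apply/eqP.
  by apply: contra_notT noi => ?; exists i.
exists (fun x => v2r (x - projv U x) 0 i); split=> //.
  move=> a x y; rewrite !linearB !linearD !linearZ /= !mxE; ring.
by move=> u Uu /=; rewrite projv_id // subrr linear0 mxE.
Qed.

End Separation.

Section IntegerFunctional.
Variables (K : fieldType) (V : lmodType K).
Hypothesis char0 : [pchar K] =i pred0.
Implicit Types (X : seq V) (a : V) (f : V -> int).

Lemma mulrz_torsion_free a (m : int) : a *~ m = 0 -> a != 0 -> m = 0.
Proof.
have nat_case n : a *+ n = 0 -> a != 0 -> n = 0%N.
  move=> an0 nza; apply/eqP; case: posnP => // n_gt0.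
  have := natr_neq0 char0 n_gt0; move/eqP: an0.
  by rewrite -scaler_nat scaler_eq0 (negPf nza) orbF => ->.
case: m => n; first by rewrite -pmulrn => /nat_case h /h ->.
by rewrite NegzE mulrNz -pmulrn => /eqP; rewrite oppr_eq0 => /eqP/nat_case h /h.
Qed.

(* An integer-valued stand-in for a Q-linear form on the Q-span of [X]. *)
Definition respects_int_relations X f : Prop :=
  forall c : V -> int, \sum_(a <- X) a *~ c a = 0 -> \sum_(a <- X) f a * c a = 0.

(** Induction on [X]. If a nonzero multiple [b *~ m] of the new element is an integer combination of
    the others, this dictates [f b], and the old values are multiplied by [m] to stay integral.
    Otherwise every relation has coefficient 0 at [b], and [f b = 0] is allowed. *)
Lemma int_functional1 X a0 : uniq (a0 :: X) -> a0 != 0 ->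
  exists f, respects_int_relations (a0 :: X) f /\ f a0 != 0.
Proof.
move=> + nz0; elim: X => [|b X IHX] /=.
  exists (fun=> 1); split=> // c; rewrite !big_seq1 mul1r => /mulrz_torsion_free; exact.
rewrite inE negb_or -andbA => /and4P[neq0b X0 Xb uX].
have [|f [resp_f f0]] := IHX; first by rewrite /= X0.
have neqX a : a \in X -> (a == b) = false by move=> Xa; apply: contraNF Xb => /eqP <-.
have bigX (F G : V -> int) : \sum_(a <- X) (if a == b then F a else G a) = \sum_(a <- X) G a.
  by apply: eq_big_seq => a Xa; rewrite neqX.
case: (classic (exists (c : V -> int) (m : int), m != 0 /\
         b *~ m = \sum_(a <- a0 :: X) a *~ c a)) => [[c [m [nzm def_b]]]|indep].
  exists (fun a => if a == b then \sum_(a <- a0 :: X) f a * c a else m * f a).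
  split; last by rewrite (negPf neq0b) mulf_neq0.
  move=> d rel; have := resp_f (fun a => m * d a + d b * c a).
  rewrite !big_cons /= eqxx (negPf neq0b) in def_b rel *.
  have -> : \sum_(j <- X) (if j == b then f a0 * c a0 + \sum_(j <- X) f j * c j else m * f j) * d j
     = \sum_(j <- X) (m * f j) * d j.
    by apply: eq_big_seq => a Xa; rewrite neqX.
  move=> resp; rewrite -[RHS]resp; last first.
    have -> : a0 *~ (m * d a0 + d b * c a0) + \sum_(j <- X) j *~ (m * d j + d b * c j) =
       (a0 *~ d a0 + (b *~ d b + \sum_(j <- X) j *~ d j)) *~ m.
      rewrite 2![in RHS]mulrzDl addrCA [b *~ _ *~ m]mulrzAC def_b mulrzDl !mulrz_suml.
      rewrite mulrzDr addrACA; congr (_ + _); first by rewrite -!mulrzA [c a0 * _]mulrC [d a0 * _]mulrC addrC.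
      rewrite -big_split /=; apply: eq_bigr => a _.
      by rewrite mulrzDr -!mulrzA [c a * _]mulrC [d a * _]mulrC addrC.
    by rewrite rel mul0rz.
  rewrite mulrDl mulr_suml addrCA !mulrDr addrACA; congr (_ + _); first by ring.
  by rewrite -big_split /=; apply: eq_bigr => a _; ring.
exists (fun a => if a == b then 0 else f a).
split; last by rewrite (negPf neq0b).
move=> c rel; have cb : c b = 0.
  apply/eqP; apply: contra_notT indep => nzc; exists (fun a => - c a), (c b); split=> //.
  move: rel; rewrite !big_cons addrCA => /eqP; rewrite addr_eq0 => /eqP ->.
  rewrite opprD mulrNz; congr (_ + _); rewrite -sumrN; apply: eq_bigr => a _.
  by rewrite mulrNz.
have := resp_f c; rewrite !big_cons /= eqxx (negPf neq0b) mul0r add0r in rel *.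
move=> h; rewrite -[RHS]h; last by move: rel; rewrite cb mulr0z add0r.
by congr (_ + _); apply: eq_big_seq => a Xa; rewrite neqX.
Qed.

Lemma int_functional X : uniq X -> exists f,
  respects_int_relations X f /\ {in X, forall a, a != 0 -> f a != 0}.
Proof.
move=> uX; suff : forall Y : seq V, {subset Y <= X} -> exists f,
    respects_int_relations X f /\ {in Y, forall a, a != 0 -> f a != 0}.
  by apply.
elim=> [|b Y IHY] sYX.
  by exists (fun=> 0); split=> // c _; rewrite big1 // => a _; rewrite mul0r.
have [a Ya|g [resp_g g0]] := IHY; first by apply: sYX; rewrite inE Ya orbT.
case: (eqVneq b 0) => [-> |nzb].
  by exists g; split=> // a; rewrite inE => /predU1P[->|/g0//]; rewrite eqxx.
have Xb : b \in X by apply: sYX; rewrite mem_head.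
have pX := perm_to_rem Xb.
have [|f [resp_f fb]] := @int_functional1 (rem b X) b _ nzb.
  by rewrite -(perm_uniq pX).
(* [N * f + g] can vanish on [X] only where both [f] and [g] do. *)
pose N : int := 1 + \sum_(a <- X) `|g a|.
have ltN a : a \in X -> (`|g a| < N)%R.
  move=> Xa; rewrite /N (big_rem a) //= ltz1D Num.Theory.lerDl.
  by rewrite Num.Theory.sumr_ge0.
exists (fun a => N * f a + g a); split.
  move=> c rel; under eq_bigr => a _ do rewrite mulrDl -mulrA.
  rewrite big_split /= -mulr_sumr resp_g // addr0.
  by rewrite (perm_big _ pX) resp_f ?mulr0 // -(perm_big _ pX).
move=> a bYa nza; have Xa := sYX a bYa.
case: (eqVneq (f a) 0) => [fa0|nzf].
  rewrite fa0 mulr0 add0r g0 //; move: bYa; rewrite inE => /predU1P[eab|//].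
  by move: fb; rewrite -eab fa0 eqxx.
have := ltN a Xa; set G := g a; set F := f a in nzf *.
move=> ltG; nia.
Qed.

Lemma int_functional_additive X f a b : uniq X -> respects_int_relations X f ->
  a \in X -> b \in X -> a + b \in X -> f (a + b) = f a + f b.
Proof.
move=> uX resp Xa Xb Xab.
have sum1 (W : zmodType) (F : V -> W) x : x \in X ->
    \sum_(y <- X) F y *~ (y == x) = F x.
  move=> Xx; rewrite (bigD1_seq x) //= eqxx mulr1z big1 ?addr0 // => y /negPf ->.
  by rewrite mulr0z.
(* Indicators are added rather than chosen by cases, so the relation stays right when some of [a],
   [b], [a + b] coincide. *)
have := resp (fun y => (y == a)%:Z + (y == b)%:Z - (y == a + b)%:Z).
under eq_bigr => y _ do rewrite mulrzBr mulrzDr.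
rewrite sumrB big_split /= !(sum1 _ id) // subrr => /(_ erefl).
under eq_bigr => y _ do rewrite mulrBr mulrDr -!mulrzz.
by rewrite sumrB big_split /= !(sum1 _ f) // => /eqP; rewrite subr_eq0 => /eqP.
Qed.

End IntegerFunctional.

(** * Engel's theorem *)

Section AdjointRepresentation.
Variables (K : fieldType) (L : finLieType K).
Implicit Types (x z : L) (U W M : {vspace L}).

Lemma lie_is_linear x : linear (lie x).
Proof. by move=> a y z; rewrite lieDr lieZr. Qed.
HB.instance Definition _ x := GRing.isLinear.Build K L L *:%R (lie x) (lie_is_linear x).

Lemma lieC x y : lie x y = - lie y x.
Proof.
by apply/eqP; rewrite -addr_eq0; have := liexx (x + y);
   rewrite lieDl !lieDr !liexx add0r addr0 => ->.
Qed.

Lemma lie_lie x y z : lie (lie x y) z = lie x (lie y z) - lie y (lie x z).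
Proof.
apply/eqP; rewrite lieC eq_sym -subr_eq0 opprK [lie x z]lieC lieNr opprK.
by rewrite lie_jacobi.
Qed.

Lemma lie_lier x y z : lie x (lie y z) = lie (lie x y) z + lie y (lie x z).
Proof. by rewrite lie_lie subrK. Qed.

Definition ad x : 'End(L) := linfun (lie x).

Lemma adE x y : ad x y = lie x y.
Proof. by rewrite lfunE. Qed.

Definition is_rep (V : vectType K) (rho : L -> 'End(V)) : Prop :=
  (forall a x y, rho (a *: x + y) = a *: rho x + rho y) /\
  (forall x y v, rho (lie x y) v = rho x (rho y v) - rho y (rho x v)).

Lemma ad_rep : is_rep ad.
Proof.
split=> [a x y|x y v]; last by rewrite !adE lie_lie.
by apply/lfunP => v; rewrite add_lfunE scale_lfunE !adE lieDl lieZl.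
Qed.

Lemma iter_ad k x y : iter k (ad x) y = iter k (lie x) y.
Proof. by elim: k => //= k ->; rewrite adE. Qed.

Lemma ad_nilpotentP x : ad_nilpotent x <-> lnilp (ad x).
Proof.
by split=> -[k nk]; exists k => v; [rewrite iter_ad | rewrite -iter_ad].
Qed.

Section Action.
Variables (V : vectType K) (rho : L -> 'End(V)).
Hypothesis rho_rep : is_rep rho.
Implicit Types (Y : {vspace V}).

Lemma rep0 : rho 0 = 0.
Proof.
case: rho_rep => lin _; have := lin (-1) 0 0.
by rewrite scaler0 addr0 scaleN1r addNr.
Qed.

Lemma repD x y : rho (x + y) = rho x + rho y.
Proof. by case: rho_rep => lin _; have := lin 1 x y; rewrite !scale1r. Qed.

Lemma repZ a x : rho (a *: x) = a *: rho x.
Proof. by case: rho_rep => lin _; have := lin a x 0; rewrite rep0 !addr0. Qed.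

Lemma repB x y : rho (x - y) = rho x - rho y.
Proof. by rewrite repD -scaleN1r repZ scaleN1r. Qed.

Lemma rep_lie x y v : rho (lie x y) v = rho x (rho y v) - rho y (rho x v).
Proof. by case: rho_rep. Qed.

Definition actv U Y : {vspace V} :=
  <<[seq rho u y | u <- vbasis U, y <- vbasis Y]>>%VS.

Lemma actvP U Y (W : {vspace V}) :
  (forall u (y : V), u \in U -> y \in Y -> rho u y \in W) <-> (actv U Y <= W)%VS.
Proof.
split=> [sUVW | sUVW u v].
  apply/span_subvP => _ /allpairsP[[u v] /= [Uu Vv ->]].
  by apply: sUVW; apply: vbasis_mem.
move=> /coord_vbasis -> /coord_vbasis ->; apply: (subvP sUVW).
rewrite linear_sum memv_suml // => j _; rewrite linearZ memvZ //=.
elim/big_rec: _ => [|i u' _ IH]; first by rewrite rep0 zero_lfunE mem0v.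
rewrite repD repZ add_lfunE scale_lfunE memvD ?memvZ //.
by apply/memv_span/allpairs_f; apply: memt_nth.
Qed.

Lemma mem_actv U Y u (y : V) : u \in U -> y \in Y -> rho u y \in actv U Y.
Proof. by have /actvP := subvv (actv U Y); apply. Qed.

End Action.

Lemma lieprodv_actv U W : lieprodv U W = actv ad U W.
Proof.
apply/eqP; rewrite eqEsubv; apply/andP; split.
  apply/lieprodvP => u w Uu Ww; rewrite -adE; apply: mem_actv => //; exact: ad_rep.
apply/actvP; first exact: ad_rep.
move=> u w Uu Ww; rewrite adE; move: u w Uu Ww; apply/lieprodvP; exact: subvv.
Qed.

Lemma subalgebra_addline U z : is_subalgebra U ->
  (forall u, u \in U -> lie u z \in U) -> is_subalgebra (U + <[z]>)%VS.
Proof.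
move=> algU Uz _ _ /memv_addP[u Uu [_ /vlineP[a ->] ->]] /memv_addP[w Uw [_ /vlineP[b ->] ->]].
rewrite lieDl !lieDr !lieZr !lieZl liexx !scaler0 addr0 [lie z w]lieC.
by rewrite (subvP (addvSl _ _)) // !memvD ?algU // memvZ ?memvN ?Uz.
Qed.

Definition stable_under (V : vectType K) (rho : L -> 'End(V)) U (Y : {vspace V}) : Prop :=
  forall u (y : V), u \in U -> y \in Y -> rho u y \in Y.

(** Engel's theorem as the properness of [U.Y] in [Y], by induction on [\dim U]. A maximal proper
    subalgebra [M] of [U] is normalized by some [z] outside it, so [U = M + <[z]>]; the induction
    hypothesis is used for [M] acting on [U], to find [z], and then for [M] acting on [Y]. *)
Lemma engel U : is_subalgebra U ->
  (forall u, u \in U -> exists k, forall v, v \in U -> iter k (lie u) v = 0) ->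
  forall (V : vectType K) (rho : L -> 'End(V)), is_rep rho ->
  forall Y, stable_under rho U Y ->
  (forall u, u \in U -> exists k, forall y : V, y \in Y -> iter k (rho u) y = 0) ->
  Y <> 0%VS -> actv rho U Y <> Y.
Proof.
have [n] := ubnP (\dim U); elim: n U => // n IHn U ltUn algU nilU V rho rep Y UY nilY nzY.
case: (eqVneq U 0%VS) => [-> eqY|nzU].
  case: nzY; apply/eqP; rewrite -subv0 -eqY; apply/(actvP rep) => u y.
  by rewrite memv0 => /eqP -> _; rewrite (rep0 rep) zero_lfunE mem0v.
have P0 : [/\ is_subalgebra (0%VS : {vspace L}), (0 <= U)%VS & 0%VS != U].
  split; [|exact: sub0v|by rewrite eq_sym].
  by move=> u w; rewrite !memv0 => /eqP-> _; rewrite lie0l.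
have [M [[algM sMU neqMU] maxM]] := @max_dim_vspace _ _
  (fun W => [/\ is_subalgebra W, (W <= U)%VS & W != U]) 0%VS P0.
have ltMU : (\dim M < \dim U)%N.
  by rewrite ltn_neqAle (dimv_leqif_eq sMU) neqMU dimvS.
have IHM := IHn M (leq_trans ltMU ltUn) algM.
have nilM u : u \in M -> exists k, forall v, v \in M -> iter k (lie u) v = 0.
  by move/(subvP sMU)/nilU=> [k nk]; exists k => v /(subvP sMU); apply: nk.
(* A minimal [M]-stable subspace of [U] not inside [M] replaces a minimal submodule of [U / M]. *)
have PU : [/\ (U <= U)%VS, ~~ (U <= M)%VS & stable_under ad M U].
  split; [exact: subvv|by apply: contra neqMU => sUM; rewrite eqEsubv sMU|].
  by move=> u w Mu Uw; rewrite adE algU // (subvP sMU).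
have [W [[sWU nsWM MW] minW]] := @min_dim_vspace _ _
  (fun W => [/\ (W <= U)%VS, ~~ (W <= M)%VS & stable_under ad M W]) U PU.
have nW : actv ad M W <> W.
  apply: (IHM nilM _ _ ad_rep _ MW) => [u /(subvP sMU)/nilU[k nk]|W0].
    by exists k => y Wy; rewrite iter_ad nk // (subvP sWU).
  by rewrite W0 sub0v in nsWM.
have sW'W : (actv ad M W <= W)%VS by apply/(actvP ad_rep).
have sW'M : (actv ad M W <= M)%VS.
  apply: contraT => nsW'M; case: nW; apply/eqP; rewrite eqEdim sW'W minW //.
  split=> //; first exact: subv_trans sW'W sWU.
  move=> u y Mu W'y; apply: (mem_actv ad_rep) => //; exact: (subvP sW'W).
have [z Wz nMz] := subvPn nsWM.
have Mz u : u \in M -> lie u z \in M.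
  by move=> Mu; rewrite -adE (subvP sW'M) // (mem_actv ad_rep).
have Uz : z \in U by apply: (subvP sWU).
have defU : U = (M + <[z]>)%VS.
  apply/eqP; apply: contraT => neq.
  have /maxM : [/\ is_subalgebra (M + <[z]>)%VS, (M + <[z]> <= U)%VS & (M + <[z]>)%VS != U].
    by split; [apply: subalgebra_addline | rewrite subv_add sMU -memvE | rewrite eq_sym].
  rewrite leqNgt => /negP[]; rewrite ltn_neqAle (dimv_leqif_eq (addvSl _ _)) dimvS ?addvSl //.
  rewrite andbT; apply: contraNneq nMz => ->.
  by rewrite (subvP (addvSr _ _)) // memv_line.
set Y1 := actv rho M Y.
have sY1Y : (Y1 <= Y)%VS.
  by apply/(actvP rep) => u y Mu Yy; apply: UY => //; apply: (subvP sMU).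
have nY1 : Y1 <> Y.
  apply: (IHM nilM _ _ rep) nzY => [u y Mu Yy|u Mu].
    by apply: UY => //; apply: (subvP sMU).
  by apply: nilY; apply: (subvP sMU).
have zY1 (y : V) : y \in Y1 -> rho z y \in Y1.
  rewrite !memv_preim; apply/subvP; apply/(actvP rep) => m y' Mm Yy.
  rewrite -memv_preim; have -> : rho z (rho m y') = rho m (rho z y') - rho (lie m z) y'.
    by rewrite (rep_lie rep) opprB addrC subrK.
  by rewrite memvB // (mem_actv rep) ?Mz // UY.
move=> eqY; have [k nk] := nilY z Uz.
(* If [U.Y = Y], then [Y = Y1 + z.Y]. As [Y1] is [z]-stable, this iterates to [Y = Y1 + z^j.Y], and
   nilpotency of [z] gives [Y = Y1]. *)
have step j (y : V) : y \in Y -> exists y1 y' : V, [/\ y1 \in Y1, y' \in Y & y = y1 + iter j (rho z) y'].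
  move=> Yy; elim: j => [|j [y1 [y' [Y1y1 Yy' ->]]]].
    by exists 0, y; rewrite mem0v add0r.
  have sY : (Y <= Y1 + (rho z @: Y))%VS.
    rewrite -{1}eqY; apply/(actvP rep) => u w; rewrite defU => /memv_addP[m Mm [_ /vlineP[a ->] ->]] Yw.
    rewrite (repD rep) (repZ rep) add_lfunE scale_lfunE memv_add //.
      exact: (mem_actv rep).
    by rewrite memvZ // memv_img.
  have /memv_addP[y2 Y1y2 [_ /memv_imgP[w Yw ->] ->]] := subvP sY _ Yy'.
  have jY1 : iter j (rho z) y2 \in Y1 by elim: (j) => //= i; apply: zY1.
  exists (y1 + iter j (rho z) y2), w; split=> //; first exact: memvD.
  by rewrite iterSr -!lpowE linearD addrA.
case: nY1; apply/eqP; rewrite eqEsubv sY1Y; apply/subvP => y Yy.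
by have [y1 [y' [Y1y1 Yy' ->]]] := step k y Yy; rewrite nk // addr0.
Qed.

Lemma engel_chain U (V : vectType K) (rho : L -> 'End(V)) Y : is_subalgebra U ->
  is_rep rho -> stable_under rho U Y ->
  (forall u, u \in U -> exists k, forall v, v \in U -> iter k (lie u) v = 0) ->
  (forall u, u \in U -> exists k, forall y : V, y \in Y -> iter k (rho u) y = 0) ->
  exists n, iter n (actv rho U) Y = 0%VS.
Proof.
move=> algU rep UY nilU nilY; set C := fun n => iter n (actv rho U) Y.
have CY n : (C n <= Y)%VS /\ stable_under rho U (C n).
  elim: n => [|n [sCY UC]]; first by split=> //; apply: subvv.
  have sC : (C n.+1 <= C n)%VS by apply/(actvP rep).
  split; first exact: subv_trans sC sCY.
  by move=> u y Uu Cy; apply: (mem_actv rep) => //; apply: (subvP sC).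
have dimC n : C n <> 0%VS -> (\dim (C n) + n <= \dim Y)%N.
  elim: n => [|n IHn] nzC; first by rewrite addn0.
  have [sCY UC] := CY n; have nzCn : C n <> 0%VS.
    move=> C0; case: nzC; have -> : C n.+1 = actv rho U (C n) by [].
    rewrite C0; apply/eqP; rewrite -subv0; apply/(actvP rep) => u y _.
    by rewrite memv0 => /eqP ->; rewrite linear0 mem0v.
  apply: leq_trans (IHn nzCn); rewrite -addSnnS leq_add2r.
  have sC : (C n.+1 <= C n)%VS by apply/(actvP rep).
  rewrite ltn_neqAle (dimv_leqif_eq sC) dimvS // andbT; apply/eqP.
  apply: (engel algU nilU rep UC) nzCn => u /nilY[k nk].
  by exists k => y /(subvP sCY); apply: nk.
exists (\dim Y).+1; apply: NNPP => /dimC; lia.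
Qed.

Lemma ad_nilpotent_ideal U : is_ideal U -> (forall u, u \in U -> ad_nilpotent u) ->
  is_nilpotent U.
Proof.
move=> idU nilU.
have [n Cn] : exists n, iter n (actv ad U) U = 0%VS.
  apply: engel_chain ad_rep _ _ _; [by move=> x y _; apply: idU | | |].
  - by move=> u y _ Uy; rewrite adE idU.
  - by move=> u /nilU[k nk]; exists k.
  by move=> u /nilU[k nk]; exists k => y _; rewrite iter_ad.
exists n; rewrite -Cn /lower_central; elim: (n) => //= k ->.
exact: lieprodv_actv.
Qed.

End AdjointRepresentation.

(** * Ideals modulo the nilradical *)

Lemma kernel_space (K : fieldType) (V : vectType K) (phi : V -> K) : scalar phi ->
  exists W : {vspace V}, forall v, (v \in W) = (phi v == 0).
Proof.
move=> phi_lin.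
pose F : {linear V -> K^o} := HB.pack (phi : V -> K^o) (GRing.isLinear.Build K V K^o *:%R _ phi_lin).
by exists (lker (linfun F)) => v; rewrite memv_ker lfunE.
Qed.

Definition lcomm (K : fieldType) (V : vectType K) (f g : 'End(V)) : 'End(V) :=
  (f \o g)%VF - (g \o f)%VF.

Lemma lcommE (K : fieldType) (V : vectType K) (f g : 'End(V)) v :
  lcomm f g v = f (g v) - g (f v).
Proof. by rewrite add_lfunE opp_lfunE !comp_lfunE. Qed.

Lemma ltrace_lcomm (K : fieldType) (V : vectType K) (f g h : 'End(V)) :
  ltrace (lcomm f g \o h)%VF = ltrace (f \o lcomm g h)%VF.
Proof.
rewrite comp_lfunDl comp_lfunNl comp_lfunDr comp_lfunNr !linearB /= !comp_lfunA.
by congr (_ - _); rewrite -comp_lfunA ltrace_comm.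
Qed.

Section TraceModuloFlag.
Variables (K : fieldType) (V : vectType K) (F : nat -> {vspace V}) (k0 : nat).
Hypothesis F0 : F 0 = fullv.
Hypothesis Fk0 : F k0 = 0%VS.
Implicit Types f g : 'End(V).

Definition flag_stable f := forall i v, v \in F i -> f v \in F i.
(** Shifts are to stable maps what strictly block triangular matrices are to block triangular ones:
    a two-sided ideal of nilpotent maps. *)
Definition flag_shift f := forall i v, v \in F i -> f v \in F i.+1.

Lemma flag_shift_nilp f : flag_shift f -> lnilp f.
Proof.
move=> sf; exists k0 => v; apply/eqP; rewrite -memv0 -Fk0.
have : v \in F 0 by rewrite F0 memvf.
by elim: k0 => //= n IHn /IHn; apply: sf.
Qed.

Lemma flag_shiftD f g : flag_shift f -> flag_shift g -> flag_shift (f + g).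
Proof. by move=> sf sg i v Fv; rewrite add_lfunE memvD ?sf ?sg. Qed.

Lemma flag_shift_compr f g : flag_stable f -> flag_shift g -> flag_shift (f \o g)%VF.
Proof. by move=> sf sg i v Fv; rewrite comp_lfunE sf ?sg. Qed.

Lemma flag_shift_compl f g : flag_shift f -> flag_stable g -> flag_shift (f \o g)%VF.
Proof. by move=> sf sg i v Fv; rewrite comp_lfunE sf ?sg. Qed.

Lemma flag_stable_comp f g : flag_stable f -> flag_stable g -> flag_stable (f \o g)%VF.
Proof. by move=> sf sg i v Fv; rewrite comp_lfunE sf ?sg. Qed.

Lemma flag_stable_lpow f k : flag_stable f -> flag_stable (lpow f k).
Proof. by move=> sf i v Fv; rewrite lpowE; elim: k => //= k; apply: sf. Qed.

Lemma flag_shift_comm_pow f g k : flag_stable f -> flag_stable g ->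
  flag_shift (lcomm f g) -> flag_shift (lcomm f (lpow g k)).
Proof.
move=> sf sg sfg; elim: k => [|k IHk] i v Fv.
  by rewrite lcommE !lpowE subrr mem0v.
have -> : lcomm f (lpow g k.+1) =
    (lcomm f g \o lpow g k)%VF + (g \o lcomm f (lpow g k))%VF.
  apply/lfunP => w; rewrite add_lfunE !(lcommE, comp_lfunE) linearB /=.
  by rewrite addrA subrK.
apply: flag_shiftD Fv; first by apply: flag_shift_compl => //; apply: flag_stable_lpow.
exact: flag_shift_compr.
Qed.

(* [f] and [g] commute up to flag shifts, so [(f \o g)^m] agrees with [f^m \o g^m] up to a flag shift. *)
Lemma ltrace_comm_nilp f g : flag_stable f -> flag_stable g ->
  flag_shift (lcomm f g) -> lnilp f -> ltrace (f \o g)%VF = 0.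
Proof.
move=> sf sg sfg [m fm]; apply: ltrace_nilp.
have sfgm j : flag_shift (lpow (f \o g)%VF j - (lpow f j \o lpow g j)%VF).
  elim: j => [|j IHj] i v Fv.
    by rewrite add_lfunE opp_lfunE comp_lfunE !lpowE subrr mem0v.
  have -> : lpow (f \o g)%VF j.+1 - (lpow f j.+1 \o lpow g j.+1)%VF =
    ((f \o g) \o (lpow (f \o g)%VF j - (lpow f j \o lpow g j)))%VF
      - (f \o (lcomm (lpow f j) g \o lpow g j))%VF.
    rewrite !lpowS; move: (lpow _ j) (lpow f j) (lpow g j) => A B C.
    apply/lfunP => w; rewrite !(add_lfunE, opp_lfunE, comp_lfunE, lcommE).
    by rewrite !linearB /= opprK addrACA addNr addr0.
  have sgf : flag_shift (lcomm g f).
    by move=> i1 v1 /sfg; rewrite !lcommE -opprB memvN.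
  rewrite add_lfunE opp_lfunE memvB //.
    by apply: (flag_shift_compr _ IHj) => //; apply: flag_stable_comp.
  apply: (flag_shift_compr sf) => //.
  apply: flag_shift_compl; last exact: flag_stable_lpow.
  move=> i1 v1 /(flag_shift_comm_pow j sg sf sgf).
  by rewrite !lcommE -opprB memvN.
have /flag_shift_nilp[k nk] : flag_shift (lpow (f \o g)%VF m).
  move=> i v /(sfgm m); rewrite add_lfunE opp_lfunE comp_lfunE [lpow f m _]lpowE.
  by rewrite fm subr0.
exists (k * m)%N => v; rewrite -(nk v); elim: (k) => //= j IHj.
by rewrite mulSn iterD IHj lpowE.
Qed.

End TraceModuloFlag.

Section NilpotentIdeals.
Variables (K : closedFieldType) (L : finLieType K).
Hypothesis char0 : [pchar K] =i pred0.
Variable N : lieIdeal L.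
Hypothesis nilN : is_nilpotent N.

(** All of [ad L] stabilizes this flag and [ad n] shifts it for [n] in [N]; so a bracket lying in
    [N] is a commutation up to flag shifts. *)
Let F i : {vspace L} := iter i (actv (@ad K L) N) fullv.

Let FS i : F i.+1 = actv (@ad K L) N (F i). Proof. by []. Qed.

Let memF i n y : n \in ideal_space N -> y \in F i -> lie n y \in F i.+1.
Proof. by move=> Nn Fy; rewrite -adE; apply: (mem_actv (ad_rep L)). Qed.

Let F_ideal i : is_ideal (F i).
Proof.
elim: i => [|i IHi] x y; first by move=> _; apply: memvf.
rewrite -adE memv_preim; move: y; apply/subvP; apply/(actvP (ad_rep L)) => n y Nn Fy.
rewrite -memv_preim !adE lie_lier memvD ?memF ?IHi //.
exact: ideal_closed.
Qed.

Let F_end : exists k, F k = 0%VS.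
Proof.
(* The extra step is for [[N, L] <= N]: [F i.+1] lies in the [i]-th term of the lower central series
   of [N]. *)
have [n Cn] := nilN; exists n.+1; apply/eqP; rewrite -subv0 -Cn.
elim: n {Cn} => [|n IHn].
  apply/(actvP (ad_rep L)) => u y Nu _; rewrite adE lieC memvN; exact: ideal_closed.
rewrite FS; apply/(actvP (ad_rep L)) => u y Nu /(subvP IHn) Cy.
rewrite /lower_central iterS lieprodv_actv; exact: (mem_actv (ad_rep L)).
Qed.

Let ad_stable x : flag_stable F (ad x).
Proof. by move=> i v Fv; rewrite adE; apply: F_ideal. Qed.

Let ad_shift n : n \in ideal_space N -> flag_shift F (ad n).
Proof. by move=> Nn i v Fv; apply: (mem_actv (ad_rep L)). Qed.

Let adlieE (x y : L) : ad (lie x y) = lcomm (ad x) (ad y).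
Proof. by apply/lfunP => v; rewrite lcommE !adE lie_lie. Qed.

Lemma ad_nilpotent_ideal_mem n : n \in ideal_space N -> ad_nilpotent n.
Proof.
have [k Fk] := F_end.
by move=> Nn; apply/ad_nilpotentP; apply: (@flag_shift_nilp _ _ F k) => //; apply: ad_shift.
Qed.

Let shift_trace f : flag_shift F f -> ltrace f = 0.
Proof. by have [k Fk] := F_end; move=> sf; apply/ltrace_nilp/(@flag_shift_nilp _ _ F k). Qed.

(** Twice [(ad e)^(k+1)] is [[ad h, ad e] (ad e)^k] minus a flag shift. The first term has the trace
    of [ad h [ad e, (ad e)^k] = 0]. *)
Lemma ad_nilpotent_mod_nilpotent_ideal h e : lie h e - e *+ 2 \in ideal_space N ->
  ad_nilpotent e.
Proof.
set n := _ - _ => Nn; apply/ad_nilpotentP; apply: (nilp_ltrace char0) => k.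
apply/eqP; rewrite -(mulrI_eq0 _ (mulfI (natr_neq0 char0 (isT : (0 < 2)%N)))).
rewrite -linearZ /=.
have -> : 2%:R *: lpow (ad e) k.+1 =
   (lcomm (ad h) (ad e) \o lpow (ad e) k)%VF - (ad n \o lpow (ad e) k)%VF.
  rewrite -adlieE -comp_lfunNl -comp_lfunDl; apply/lfunP => v.
  rewrite scale_lfunE !comp_lfunE add_lfunE opp_lfunE !adE /n lieDl lieNl opprB addrC subrK.
  by rewrite scaler_nat !mulr2n lieDl.
rewrite linearB /= ltrace_lcomm [X in _ - X]shift_trace ?subr0; last first.
  by apply: flag_shift_compl (ad_shift Nn) _; apply: flag_stable_lpow.
suff -> : lcomm (ad e) (lpow (ad e) k) = 0 by rewrite comp_lfun0r linear0.
by apply/lfunP => v; rewrite lcommE zero_lfunE !lpowE -iterS iterSr subrr.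
Qed.

Hypothesis maxN : forall I : lieIdeal L, is_nilpotent I -> (I <= N)%VS.
Hypothesis MU : in_MU L.

Lemma MU_ideal_abelian_mod_nilradical (A : {vspace L}) : is_ideal A ->
  (forall a b, a \in A -> b \in A -> lie a b \in ideal_space N) -> (A <= N)%VS.
Proof.
move=> idA abA.
have nilpN (I : {vspace L}) : is_ideal I -> (forall u, u \in I -> ad_nilpotent u) -> (I <= N)%VS.
  by move=> idI nilI; apply: (maxN (I := LieIdeal idI)); apply: ad_nilpotent_ideal.
have tr_scalar (g : 'End(L)) : scalar (fun x => ltrace (ad x \o g)%VF).
  move=> c x y; have [-> _] := ad_rep L.
  by rewrite comp_lfunDl -comp_lfunZl linearD linearZ.
(* A preliminary stage: [[A, A] <= N] alone makes the elements of [[L, A]] ad-nilpotent. Once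
   [[L, A] <= N], every [ad x] commutes with [ad a] up to a shift, which is what the functional on
   all of [L] requires. *)
have LA_N : (lieprodv fullv A <= N)%VS.
  have idLA : is_ideal (lieprodv fullv A).
    move=> x y; rewrite -adE memv_preim; move: y; apply/subvP/lieprodvP => u v _ Av.
    have mem u' v' : v' \in A -> lie u' v' \in lieprodv fullv A.
      by move=> Av'; have /lieprodvP := subvv (lieprodv fullv A); apply => //; apply: memvf.
    by rewrite -memv_preim adE lie_lier memvD ?mem // idA.
  apply: nilpN => // b LAb; apply/ad_nilpotentP; apply: (nilp_ltrace char0) => k.
  have Ab : b \in A.
    by move: b LAb; apply/subvP/lieprodvP => u v _; apply: idA.
  have [W memW] := kernel_space (tr_scalar (lpow (ad b) k)).
  suff /subvP/(_ b LAb) : (lieprodv fullv A <= W)%VS by rewrite memW => /eqP.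
  apply/lieprodvP => x a _ Aa; rewrite memW adlieE ltrace_lcomm shift_trace //.
  apply: flag_shift_compr => //; apply: flag_shift_comm_pow => //.
  by rewrite -adlieE; apply: ad_shift; apply: abA.
have comm_N a x : a \in A -> lie x a \in ideal_space N.
  move=> Aa; apply: (subvP LA_N); move: x a (memvf x) Aa.
  by apply/lieprodvP; apply: subvv.
apply: nilpN => // a Aa; apply/ad_nilpotentP; apply: (nilp_ltrace char0) => k.
apply/eqP; apply: contraT => nzk.
(* [W] contains [L, L] and all ad-nilpotent elements. *)
have [W memW] := kernel_space (tr_scalar (lpow (ad a) k)).
have shift_a x : flag_shift F (lcomm (ad x) (lpow (ad a) k)).
  apply: flag_shift_comm_pow => //; rewrite -adlieE; apply: ad_shift; exact: comm_N.
have nWa : a \notin W by rewrite memW.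
have algW : is_subalgebra W.
  move=> x y _ _; rewrite memW adlieE ltrace_lcomm shift_trace //.
  exact: flag_shift_compr.
have [|S [[algS WS] nilS]] := MU (M := W).
  split=> // [Wf|U algU Uf sWU]; first by rewrite Wf memvf in nWa.
  apply/eqP; rewrite eqEsubv sWU andbT; apply/subvP => u Uu; apply: contraT => nWu.
  case: Uf; apply/eqP; rewrite eqEsubv subvf; apply/subvP => x _.
  set c := ltrace (ad x \o lpow (ad a) k)%VF / ltrace (ad u \o lpow (ad a) k)%VF.
  rewrite -[x](subrK (c *: u)) memvD ?memvZ // (subvP sWU) // memW -scaleNr addrC.
  by rewrite (tr_scalar (lpow (ad a) k)) mulNr divfK ?addNr // -memW.
have sSW : (S <= W)%VS.
  apply/subvP => u /nilS/ad_nilpotentP nil_u; rewrite memW; apply/eqP.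
  have [k' Fk] := F_end; apply: (@ltrace_comm_nilp _ _ F k') => //.
  exact: flag_stable_lpow.
by move: nWa; rewrite (subvP _ _ (memvf a)) // -WS subv_add subvv.
Qed.

End NilpotentIdeals.

(** * Cartan's criterion and the Killing form *)

Section CartanCriterion.
Variables (K : closedFieldType) (L : finLieType K).
Hypothesis char0 : [pchar K] =i pred0.
Variables (V : vectType K) (rho : L -> 'End(V)).
Hypothesis rep : is_rep rho.

(** [rho x - (a + b)] acts on [rho v w] by the Leibniz rule, as [ad x - a] on [v] plus [rho x - b]
    on [w]; hence induction on the sum of the two exponents. *)
Lemma gen_eigen_rep x a b v (w : V) : gen_eigen (ad x) a v ->
  gen_eigen (rho x) b w -> gen_eigen (rho x) (a + b) (rho v w).
Proof.
move=> [m vm] [n wn]; exists (m + n)%N; move: vm wn; rewrite !lpowE.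
have [k] := ubnP (m + n)%N.
elim: k m n v w => // k IHk [|m] n v w; first by move=> _ /= -> _; rewrite (rep0 rep) zero_lfunE iter_lfun0.
case: n => [|n]; first by move=> _ _ w0; rewrite [w]w0 linear0 iter_lfun0.
move=> ltk vm wn; rewrite addSn iterSr.
have -> : (rho x - (a + b) *: \1%VF) (rho v w) =
   rho ((ad x - a *: \1%VF) v) w + rho v ((rho x - b *: \1%VF) w).
  rewrite !(add_lfunE, opp_lfunE, scale_lfunE, id_lfunE) adE (repB rep) (repZ rep).
  rewrite linearB linearZ /= add_lfunE opp_lfunE scale_lfunE (rep_lie rep).
  by rewrite [rho v (b *: w)]linearZ /= scalerN scalerDl opprD [RHS]addrACA subrK.
have h1 := IHk m n.+1 ((ad x - a *: \1%VF) v) w.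
have h2 := IHk m.+1 n v ((rho x - b *: \1%VF) w).
rewrite -lpowE linearD /= !lpowE h1 ?add0r //; last by rewrite -iterSr.
by rewrite -addSnnS h2 // -?iterSr //; lia.
Qed.

Lemma rep_lcomm x y : rho (lie x y) = lcomm (rho x) (rho y).
Proof. by apply/lfunP => v; rewrite lcommE (rep_lie rep). Qed.

(** The operator [Y] replaces each eigenvalue [b] of [rho x] by the integer [f b]. Additivity of [f]
    puts [[Y, rho v]] back into [rho D], so [tr (rho [u, v] Y) = tr (rho u [rho v, Y])] vanishes for
    [u], [v] in [D]; as [x] lies in [[D, D]], also [tr (rho x Y) = 0]. *)
Lemma cartan_criterion (D : {vspace L}) : is_subalgebra D -> lieprodv D D = D ->
  (forall x y, x \in D -> y \in D -> ltrace (rho x \o rho y)%VF = 0) ->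
  forall x, x \in D -> lnilp (rho x).
Proof.
move=> algD perfD trD x Dx.
have [X0 [E spE0]] := spectral_projP (rho x).
have [X1 [E' spE'0]] := spectral_projP (ad x).
pose X := undup (X0 ++ X1); have uX : uniq X by apply: undup_uniq.
have spE : spectral_proj (rho x) X E.
  by apply: spectral_widen spE0 uX _ => a Xa; rewrite mem_undup mem_cat Xa.
have spE' : spectral_proj (ad x) X E'.
  by apply: spectral_widen spE'0 uX _ => a Xa; rewrite mem_undup mem_cat Xa orbT.
have [f [resp_f nzf]] := @int_functional K K^o char0 X uX.
case: (spE) (spE') => _ sumE EE pE [[m mE] EX] [_ sumE' _ pE' [[m' mE'] _]].
(* [rho x \o Y] has trace [\sum_b dim (E b) * b * f b]; applying [f] to its vanishing gives
   [\sum_b dim (E b) * f b ^ 2 = 0]. *)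
pose Y := \sum_(b <- X) (f b)%:~R *: E b.
have actY c u : gen_eigen (rho x) c u -> Y u = (f c)%:~R *: u.
  move=> cu; rewrite sum_lfunE; case: (boolP (c \in X)) => [Xc|nXc].
    rewrite (bigD1_seq c) //= scale_lfunE (spectral_proj_id spE cu) big1 ?addr0 // => b neq.
    by rewrite scale_lfunE -(spectral_proj_id spE cu) EE (negPf neq) scaler0.
  have u0 : u = 0 by rewrite -(spectral_proj_id spE cu) EX // zero_lfunE.
  by rewrite u0 scaler0 big1 // => b _; rewrite linear0.
have commY v : v \in D -> exists2 v', v' \in D & lcomm Y (rho v) = rho v'.
  (* [[Y, _]] multiplies the [a]-component of [v] under [ad x] by [f (a + b) - f b = f a]; that
     component stays in [D], being a polynomial in [ad x] applied to [v]. *)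
  move=> Dv; exists (\sum_(a <- X) (f a)%:~R *: E' a v).
    rewrite memv_suml // => a _; rewrite memvZ //; have [p ->] := pE' a.
    by apply: peval_stable Dv => u Du; rewrite adE algD.
  have ext (g h : 'End(V)) : (forall b w, g (E b w) = h (E b w)) -> g = h.
    move=> gh; apply/lfunP => w; rewrite (sumE w) !linear_sum.
    by apply: eq_bigr => b _; apply: gh.
  have repsum (F : K -> L) : rho (\sum_(a <- X) F a) = \sum_(a <- X) rho (F a).
    elim: (X) => [|a s IHs]; rewrite ?big_nil ?(rep0 rep) //.
    by rewrite !big_cons (repD rep) IHs.
  have lcomm_sum (G : 'End(V)) (F : K -> 'End(V)) :
      lcomm G (\sum_(a <- X) F a) = \sum_(a <- X) lcomm G (F a).
    apply/lfunP => w; rewrite lcommE !sum_lfunE linear_sum -sumrB.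
    by apply: eq_bigr => a _; rewrite lcommE.
  rewrite {1}(sumE' v) !repsum lcomm_sum; apply: eq_bigr => a _.
  apply: ext => b w; rewrite lcommE.
  have wb : gen_eigen (rho x) b (E b w) by exists m.
  have va : gen_eigen (ad x) a (E' a v) by exists m'.
  have vw := gen_eigen_rep va wb.
  rewrite (actY _ _ vw) (actY _ _ wb) linearZ /= (repZ rep) scale_lfunE -scalerBl.
  case: (eqVneq (rho (E' a v) (E b w)) 0) => [->|nz]; first by rewrite !scaler0.
  congr (_ *: _); rewrite -intrB; congr (_%:~R).
  (* [f] is additive only inside [X]; a nonzero [rho (E' a v) (E b w)] forces [a], [b] and [a + b]
     to belong to it. *)
  have Xab : a + b \in X.
    apply: contraNT nz => nX; rewrite -(spectral_proj_id spE vw) EX ?zero_lfunE //.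
  have Xb : b \in X.
    by apply: contraNT nz => nX; rewrite EX // zero_lfunE linear0.
  have Xa : a \in X.
    case: spE' => _ _ _ _ [_ E'X]; apply: contraNT nz => nX.
    by rewrite E'X // zero_lfunE (rep0 rep) zero_lfunE.
  have := @int_functional_additive K K^o X f a b uX resp_f Xa Xb Xab.
  by move=> ->; rewrite addrK.
have trY : ltrace (rho x \o Y)%VF = 0.
  have sc : scalar (fun y => ltrace (rho y \o Y)%VF).
    move=> c y z; rewrite (repD rep) (repZ rep).
    by rewrite comp_lfunDl -comp_lfunZl linearD linearZ.
  have [W memW] := kernel_space sc; apply/eqP; rewrite -memW.
  move: x Dx {spE0 spE'0 spE spE' sumE EE pE mE EX sumE' pE' mE' actY}; apply/subvP.
  rewrite -perfD; apply/lieprodvP => u v Du Dv; rewrite memW rep_lcomm ltrace_lcomm.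
  have [v' Dv' def_v'] := commY v Dv.
  have -> : lcomm (rho v) Y = - rho v'.
    by rewrite -def_v' /lcomm opprB.
  by rewrite comp_lfunNr linearN /= trD ?oppr0.
pose d b := \rank (VectorInternalTheory.f2mx (E b)).
have trE b : ltrace (E b) = (d b)%:R.
  by apply: ltrace_idem => v; rewrite EE eqxx.
have rel : \sum_(b <- X) (b : K^o) *~ (f b * (d b)%:Z) = 0.
  rewrite -[RHS]trY /Y.
  have -> : (rho x \o (\sum_(b <- X) (f b)%:~R *: E b))%VF = \sum_(b <- X) (f b)%:~R *: (rho x \o E b)%VF.
    elim: (X) => [|b s IHs]; rewrite ?big_nil ?comp_lfun0r // !big_cons.
    by rewrite comp_lfunDr IHs comp_lfunZr.
  rewrite linear_sum; apply: eq_bigr => b _; rewrite linearZ /= (ltrace_spectral _ spE) trE.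
  rewrite -scaler_int intrM -pmulrn /= /GRing.scale /= -mulrA; congr (_ * _).
  exact: mulrC.
have {rel} /eqP := resp_f _ rel.
rewrite Num.Theory.psumr_eq0 => [/allP f0|b _]; last by rewrite mulrA Num.Theory.mulr_ge0 // -expr2 Num.Theory.sqr_ge0.
have E0 b : b != 0 -> E b = 0.
  move=> nzb; apply: NNPP => nzE; have d_gt0 := rank_f2mx_gt0 nzE.
  have Xb : b \in X by apply: contraT => /EX.
  by have /= := f0 b Xb; rewrite !mulf_eq0 (negPf (nzf b Xb nzb)) /= eqz_nat eqn0Ngt d_gt0.
exists m => v; suff -> : v = E 0 v by have := mE 0 v; rewrite scale0r subr0 lpowE.
rewrite [LHS]sumE; case: (boolP (0 \in X)) => X00.
  by rewrite (bigD1_seq 0) //= big1 ?addr0 // => b nzb; rewrite E0 // zero_lfunE.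
rewrite (EX 0) // big_seq big1 ?zero_lfunE // => a Xa.
by rewrite E0 ?zero_lfunE //; apply: contraNneq X00 => <-.
Qed.

End CartanCriterion.

Lemma vspace_of_pred (K : fieldType) (V : vectType K) (P : V -> Prop) : P 0 ->
  (forall a u v, P u -> P v -> P (a *: u + v)) ->
  exists W : {vspace V}, forall v, v \in W <-> P v.
Proof.
move=> P0 Plin; have [W [PW maxW]] := @max_dim_vspace _ _
  (fun W : {vspace V} => forall v, v \in W -> P v) 0%VS (fun v v0 =>
    eq_ind_r P P0 (eqP (etrans (esym (memv0 v)) v0))).
exists W => v; split=> [|Pv]; first exact: PW.
have /maxW : forall u, u \in (W + <[v]>)%VS -> P u.
  move=> _ /memv_addP[w /PW Pw [_ /vlineP[a ->] ->]]; rewrite addrC; exact: Plin.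
move=> le; have /eqP -> : W == (W + <[v]>)%VS by rewrite eqEdim addvSl.
by rewrite (subvP (addvSr _ _)) // memv_line.
Qed.

Section Diagonalizable.
Variables (K : fieldType) (V : vectType K).
Import VectorInternalTheory.

Definition ldiag (f : 'End(V)) := diagonalizable (f2mx f).

Definition eigenbasis (b : 'I_(dim V) -> V) (f : 'End(V)) (w : 'I_(dim V) -> K) :=
  forall i, f (b i) = w i *: b i.

Definition is_basis (b : 'I_(dim V) -> V) : Prop :=
  exists c : 'I_(dim V) -> V -> K,
  [/\ forall i, scalar (c i), forall v, v = \sum_i c i v *: b i
    & forall i j, c i (b j) = (i == j)%:R].

Lemma unitmx_is_basis (P : 'M[K]_(dim V)) : P \in unitmx ->
  is_basis (fun i => r2v (row i P)).
Proof.
move=> uP; exists (fun i v => (v2r v *m invmx P) 0 i); split=> [i a u v|v|i j].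
- by rewrite linearP mulmxDl -scalemxAl !mxE.
- apply: v2r_inj; rewrite linear_sum /=.
  rewrite -{1}(mulmxKV uP (v2r v)) mulmx_sum_row; apply: eq_bigr => i _.
  by rewrite linearZ /= r2vK.
by rewrite r2vK -row_mul mulmxV // !mxE eq_sym.
Qed.

Lemma ldiag_eigenbasis (fs : seq 'End(V)) :
  (forall f g, f \in fs -> g \in fs -> (f \o g)%VF = (g \o f)%VF) ->
  (forall f, f \in fs -> ldiag f) ->
  exists b, is_basis b /\ forall f, f \in fs -> exists w, eigenbasis b f w.
Proof.
move=> comm diag.
have [|P uP /allP diagP] := (codiagonalizableP [seq f2mx f | f <- fs]).1.
  split=> [_ _ /mapP[f fsf ->] /mapP[g fsg ->]|_ /mapP[f fsf ->]]; last exact: diag.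
  by rewrite /comm_mx -!f2mx_comp comm.
exists (fun i => r2v (row i P)); split; first exact: unitmx_is_basis.
move=> f fsf; have /diagP/diagonalizable_forPex[D /(simmxP uP) PA] := map_f (@f2mx _ _ _) fsf.
exists (D 0) => i; apply: v2r_inj; rewrite v2r_lfun linearZ /= !r2vK.
by rewrite -row_mul PA row_mul row_diag_mx -scalemxAl -rowE.
Qed.

Lemma eigenbasis_ldiag b f w : is_basis b -> eigenbasis b f w -> ldiag f.
Proof.
move=> [c [c_lin sumc cb]] fw; pose P : 'M[K]_(dim V) := \matrix_i v2r (b i).
have uP : P \in unitmx.
  rewrite -row_full_unit -sub1mx; apply/row_subP => i; rewrite -(r2vK (row i 1%:M)).
  rewrite (sumc (r2v _)) linear_sum summx_sub // => j _; rewrite linearZ scalemx_sub //=.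
  by rewrite -(rowK (fun j => v2r (b j)) j) row_sub.
exists P => //; apply/diagonalizable_forPex; exists (\row_i w i).
apply/simmxP => //; apply/row_matrixP => i.
by rewrite !row_mul row_diag_mx -scalemxAl -rowE mxE rowK -v2r_lfun fw linearZ.
Qed.

Lemma ldiag_decomp (f : 'End(V)) (X : seq K) (g : K -> V -> V) : uniq X ->
  (forall v, v = \sum_(a <- X) g a v) -> (forall a v, f (g a v) = a *: g a v) ->
  ldiag f.
Proof.
move=> uX sumg fg; apply/diagonalizablePeigen; exists X => //; apply/eqmxP.
rewrite submx1 sub1mx -sub1mx; apply/row_subP => i; rewrite -(r2vK (row i 1%:M)) (sumg (r2v _)).
rewrite linear_sum; elim: (X) => [|a s IHs]; rewrite ?big_nil ?sub0mx // !big_cons.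
apply: addmx_sub_adds IHs; apply/eigenspaceP.
by rewrite -v2r_lfun fg linearZ.
Qed.

End Diagonalizable.

Section Killing.
Variables (K : closedFieldType) (L : finLieType K).
Hypothesis char0 : [pchar K] =i pred0.
Implicit Types (x z : L) (M J A : {vspace L}).

Definition killing x z : K := ltrace (ad x \o ad z)%VF.

Lemma killingC x z : killing x z = killing z x.
Proof. exact: ltrace_comm. Qed.

Lemma killing_linear_l a u v x : killing (a *: u + v) x = a * killing u x + killing v x.
Proof.
by rewrite /killing (repD (ad_rep L)) (repZ (ad_rep L)) comp_lfunDl -comp_lfunZl linearD linearZ.
Qed.

Lemma killing_linear_r a u v x : killing x (a *: u + v) = a * killing x u + killing x v.
Proof. by rewrite !(killingC x) killing_linear_l. Qed.

Lemma killing_scalar x : scalar (killing x).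
Proof. by move=> a u v; rewrite killing_linear_r. Qed.
HB.instance Definition _ x := GRing.isLinear.Build K L K *%R (killing x) (killing_scalar x).

Lemma killingZr a x y : killing x (a *: y) = a * killing x y.
Proof. by rewrite linearZ. Qed.

Lemma killingZl a x y : killing (a *: x) y = a * killing x y.
Proof. by rewrite !(killingC _ y) killingZr. Qed.

Lemma ad_lie x y : ad (lie x y) = lcomm (ad x) (ad y).
Proof. exact: (rep_lcomm (ad_rep L)). Qed.

Lemma killing_inv x y z : killing (lie x y) z = killing x (lie y z).
Proof. by rewrite /killing !ad_lie ltrace_lcomm. Qed.

Lemma killing_comm_nilp x z : lie x z = 0 -> lnilp (ad x) -> killing x z = 0.
Proof.
move=> xz [k nk]; apply: ltrace_nilp; exists k => v.
have cxz w : ad x (ad z w) = ad z (ad x w).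
  by apply/eqP; rewrite -subr_eq0 -lcommE -ad_lie xz (rep0 (ad_rep L)) zero_lfunE.
have cxzk j w : iter j (ad x) (ad z w) = ad z (iter j (ad x) w).
  by elim: j => //= j ->; rewrite cxz.
suff -> : iter k (ad x \o ad z)%VF v = iter k (ad x) (iter k (ad z) v) by rewrite nk.
elim: k {nk} => //= k ->; rewrite comp_lfunE cxz -[in RHS]iterS cxzk; congr (_ _).
Qed.

(** Each commutator puts one more factor [f] to the left or to the right of [g]; among [n + n]
    factors at least [n] are on one side. *)
Lemma lcomm_nilp (V : vectType K) (f : 'End(V)) : lnilp f ->
  exists k, forall g, iter k (lcomm f) g = 0.
Proof.
case=> n fn; exists (n + n)%N => g; apply/lfunP => v.
have f0 m w : (n <= m)%N -> iter m f w = 0.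
  by move=> /subnK <-; rewrite addnC iterD fn.
suff key k i j : (n + n <= i + j + k)%N ->
    iter i f (iter k (lcomm f) g (iter j f v)) = 0.
  by have := key (n + n)%N 0%N 0%N (leqnn _); rewrite zero_lfunE.
elim: k i j => [|k IHk] i j lek.
  have [lei|lej] : (n <= i)%N \/ (n <= j)%N by lia.
    exact: f0.
  by rewrite (f0 j) // linear0 iter_lfun0.
rewrite iterS lcommE -lpowE linearB /= !lpowE -iterSr -[f (iter j f v)]iterS.
by rewrite !IHk ?subrr //; lia.
Qed.

Lemma rep_nilp_ad (V : vectType K) (rho : L -> 'End(V)) (J : {vspace L}) u :
  is_rep rho -> {in J, forall x, rho x = 0 -> x = 0} ->
  (forall x, x \in J -> lie u x \in J) -> lnilp (rho u) ->
  exists k, forall v, v \in J -> iter k (lie u) v = 0.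
Proof.
move=> rep faith uJ /lcomm_nilp[k nk]; exists k => v Jv.
suff [Jk rhok] : iter k (lie u) v \in J /\ rho (iter k (lie u) v) = iter k (lcomm (rho u)) (rho v).
  by apply: faith => //; rewrite rhok nk.
elim: (k) => //= j [Jj rhoj]; split; first exact: uJ.
by rewrite (rep_lcomm rep) rhoj.
Qed.

(** If [[J, J] = J], Cartan's criterion makes [J] act nilpotently and Engel's theorem contradicts
    perfection unless [J = 0]. Otherwise [[J, J]] inherits the hypotheses and is 0 by induction, so
    [J] is an abelian ideal of [M]. The ambient [M] is kept general because both [L] and a maximal
    subalgebra are needed. *)
Lemma trace_null_ideal (V : vectType K) (rho : L -> 'End(V)) M J : is_rep rho ->
  is_subalgebra M ->
  (forall A, (A <= M)%VS -> (forall x y, x \in M -> y \in A -> lie x y \in A) ->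
     (forall x y, x \in A -> y \in A -> lie x y = 0) -> A = 0%VS) ->
  (J <= M)%VS -> (forall x y, x \in M -> y \in J -> lie x y \in J) ->
  {in J, forall x, rho x = 0 -> x = 0} ->
  (forall x y, x \in J -> y \in J -> ltrace (rho x \o rho y)%VF = 0) -> J = 0%VS.
Proof.
move=> rep algM noab; have [n] := ubnP (\dim J); elim: n J => // n IHn J ltJ sJM idJ faithJ nullJ.
have algJ : is_subalgebra J by move=> x y Jx Jy; apply: idJ => //; apply: (subvP sJM).
have sJ'J : (lieprodv J J <= J)%VS by apply/lieprodvP => u v; apply: algJ.
case: (eqVneq (lieprodv J J) J) => [perfJ|neq].
  have nilJ u : u \in J -> exists k, forall v, v \in J -> iter k (lie u) v = 0.
    move=> Ju; apply: (rep_nilp_ad rep faithJ); first by move=> x; apply: algJ.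
    exact: (cartan_criterion char0 rep algJ perfJ nullJ).
  apply: NNPP => nzJ; apply: (engel algJ nilJ (ad_rep L) _ _ nzJ).
  - by move=> u y Ju Jy; rewrite adE algJ.
  - by move=> u /nilJ[k nk]; exists k => y Jy; rewrite iter_ad nk.
  by rewrite -lieprodv_actv.
have J'0 : lieprodv J J = 0%VS.
  apply: IHn.
  - apply: leq_trans (_ : \dim J <= n)%N; last by [].
    by rewrite ltn_neqAle (dimv_leqif_eq sJ'J) neq dimvS.
  - exact: subv_trans sJ'J sJM.
  - move=> x y Mx; rewrite -adE memv_preim; move: y; apply/subvP/lieprodvP => u v Ju Jv.
    have mem u' v' : u' \in J -> v' \in J -> lie u' v' \in lieprodv J J.
      by move=> Ju' Jv'; have /lieprodvP := subvv (lieprodv J J); apply.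
    by rewrite -memv_preim adE lie_lier memvD ?mem // idJ.
  - by move=> x /(subvP sJ'J); apply: faithJ.
  by move=> x y /(subvP sJ'J) Jx /(subvP sJ'J); apply: nullJ.
apply: noab => // x y Jx Jy; apply/eqP; rewrite -memv0 -J'0.
by have /lieprodvP := subvv (lieprodv J J); apply.
Qed.

Definition no_abelian_ideals : Prop :=
  forall A, is_ideal A -> (forall x y, x \in A -> y \in A -> lie x y = 0) -> A = 0%VS.

Hypothesis Lss : no_abelian_ideals.

Lemma center_trivial x : (forall y, lie x y = 0) -> x = 0.
Proof.
move=> cx; have : <[x]>%VS = 0%VS.
  apply: Lss => [y _ /vlineP[a ->]|_ _ /vlineP[a ->] /vlineP[b ->]].
    by rewrite lieZr lieC cx oppr0 scaler0 mem0v.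
  by rewrite lieZl cx scaler0.
by move=> x0; apply/eqP; rewrite -memv0 -x0 memv_line.
Qed.

Lemma ad_faithful x : ad x = 0 -> x = 0.
Proof. by move=> x0; apply: center_trivial => y; rewrite -adE x0 zero_lfunE. Qed.

Lemma killing_nondeg x : (forall y, killing x y = 0) -> x = 0.
Proof.
have [S memS] : exists S : {vspace L}, forall v, v \in S <-> forall y, killing v y = 0.
  apply: vspace_of_pred => [y|a u v u0 v0 y]; first by rewrite killingC linear0.
  by rewrite killing_linear_l u0 v0 mulr0 addr0.
move=> /memS Sx; suff S0 : S = 0%VS by apply/eqP; rewrite -memv0 -S0.
apply: (trace_null_ideal (ad_rep L) (M := fullv)).
- by move=> u v _ _; apply: memvf.
- by move=> A _ idA abA; apply: Lss => // u v; apply: idA; apply: memvf.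
- exact: subvf.
- by move=> u v _ /memS Sv; apply/memS => y; rewrite killingC -killing_inv killingC Sv.
- by move=> u _; apply: ad_faithful.
by move=> u v /memS Su _; apply: Su.
Qed.

Lemma killing_represent (phi : L -> K) : scalar phi ->
  exists z, forall v, phi v = killing z v.
Proof.
apply: form_represent; [exact: killing_linear_l | | exact: killing_nondeg].
by move=> a u v w; apply: killing_linear_r.
Qed.

(** The functional [tr (d ad y)] is [killing z y] for some [z]. Then [e = d - ad z] is
    trace-orthogonal to [ad L], and [killing (e x) y = tr (e [ad x, ad y])] vanishes; nondegeneracy
    gives [e = 0]. *)
Lemma derivation_inner (d : 'End(L)) :
  (forall x y, d (lie x y) = lie (d x) y + lie x (d y)) -> exists z, d = ad z.
Proof.
move=> der; have [z trz] : exists z, forall y, ltrace (d \o ad y)%VF = killing z y.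
  apply: killing_represent => a u v.
  by rewrite (repD (ad_rep L)) (repZ (ad_rep L)) comp_lfunDr -comp_lfunZr linearD linearZ.
exists z; apply/eqP; rewrite -subr_eq0; apply/eqP; set e := d - ad z.
have e_ad x : ad (e x) = lcomm e (ad x).
  apply/lfunP => v; rewrite lcommE !(add_lfunE, opp_lfunE) !adE der lie_lier lieDl lieNl.
  by rewrite lieDr lieNr opprD [in RHS]addrACA addrK.
have tre y : ltrace (e \o ad y)%VF = 0.
  by rewrite comp_lfunDl comp_lfunNl linearB /= trz subrr.
apply/lfunP => x; rewrite zero_lfunE; apply: killing_nondeg => y.
by rewrite /killing e_ad ltrace_lcomm -ad_lie tre.
Qed.

(** The diagonalizable part [S] of [ad x] is a derivation, because brackets add generalized
    eigenvalues, and so [S] is inner. It kills the generalized eigenspace for 0, in particular the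
    centralizer of [x]. *)
Lemma jordan_decomposition x : exists s n,
  [/\ x = s + n, ldiag (ad s), lnilp (ad n) &
      forall y, lie x y = 0 -> lie s y = 0].
Proof.
have [X [E spE]] := spectral_projP (ad x).
case: (spE) => uX sumE EE pE [[m mE] EX].
pose S := \sum_(a <- X) a *: E a.
have actS c u : gen_eigen (ad x) c u -> S u = c *: u.
  move=> cu; rewrite sum_lfunE; case: (boolP (c \in X)) => [Xc|nXc].
    rewrite (bigD1_seq c) //= scale_lfunE (spectral_proj_id spE cu) big1 ?addr0 // => b neq.
    by rewrite scale_lfunE -(spectral_proj_id spE cu) EE (negPf neq) scaler0.
  have u0 : u = 0 by rewrite -(spectral_proj_id spE cu) EX // zero_lfunE.
  by rewrite u0 scaler0 big1 // => b _; rewrite linear0.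
have ext (g h : 'End(L)) : (forall b w, g (E b w) = h (E b w)) -> g = h.
  move=> gh; apply/lfunP => w; rewrite (sumE w) !linear_sum.
  by apply: eq_bigr => b _; apply: gh.
have Egen b w : gen_eigen (ad x) b (E b w) by exists m.
have der1 b u v : S (lie (E b u) v) = lie (S (E b u)) v + lie (E b u) (S v).
  suff /lfunP/(_ v) : (S \o ad (E b u))%VF = ad (S (E b u)) + (ad (E b u) \o S)%VF.
    by rewrite add_lfunE !comp_lfunE !adE.
  apply: ext => a {}v; rewrite add_lfunE !comp_lfunE !adE -[lie _ (E a v)]adE.
  rewrite (actS _ _ (Egen b u)) (actS _ _ (Egen a v)) lieZl lieZr -scalerDl -!adE.
  exact: actS (gen_eigen_rep (ad_rep L) (Egen b u) (Egen a v)).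
have der2 v : (S \o ad v)%VF = ad (S v) + (ad v \o S)%VF.
  apply: ext => b u; rewrite add_lfunE !comp_lfunE !adE lieC linearN /= der1.
  by rewrite opprD -!(lieC _ (E b u)) -(lieC v) addrC.
have [s def_S] : exists s, S = ad s.
  apply: derivation_inner => u v; have /lfunP/(_ v) := der2 u.
  by rewrite add_lfunE !comp_lfunE !adE.
exists s, (x - s); split.
- by rewrite addrC subrK.
- apply: (@ldiag_decomp _ _ _ X (fun a v => E a v)) => // a v.
  by rewrite -def_S; apply: actS (Egen a v).
- exists m => v; rewrite (repB (ad_rep L)) -def_S (sumE v) -lpowE linear_sum big1 // => a _ /=.
  rewrite lpowE -[RHS](mE a v) lpowE; set f := ad x - a *: \1%VF.
  elim: (m) => //= j ->; rewrite [in RHS]add_lfunE !(add_lfunE, opp_lfunE) scale_lfunE id_lfunE.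
  congr (_ - _); apply: actS; exists m; rewrite lpowE -iterD addnC iterD -[iter m _ _]lpowE mE.
  exact: iter_lfun0.
move=> y xy; rewrite -adE -def_S (actS 0) ?scale0r //.
by exists 1%N; rewrite scale0r subr0 lpowE /= adE.
Qed.

End Killing.

(** * Principal sl2-triples *)

Section MaximalTorus.
Variables (K : closedFieldType) (L : finLieType K).
Hypothesis char0 : [pchar K] =i pred0.
Hypothesis Lss : no_abelian_ideals L.
Implicit Types (x z : L) (H : {vspace L}).

Definition toral H : Prop :=
  (forall x, x \in H -> ldiag (ad x)) /\
  (forall x y, x \in H -> y \in H -> lie x y = 0).

Lemma ad_comm x z : lie x z = 0 -> (ad x \o ad z)%VF = (ad z \o ad x)%VF.
Proof.
move=> xz; have /esym/eqP := ad_lie x z.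
by rewrite xz (rep0 (ad_rep L)) /lcomm subr_eq0 => /eqP.
Qed.

Lemma toral_addline H s : toral H -> ldiag (ad s) ->
  (forall h, h \in H -> lie s h = 0) -> toral (H + <[s]>)%VS.
Proof.
move=> [diagH abH] diags cs; split.
  move=> _ /memv_addP[h Hh [_ /vlineP[a ->] ->]].
  have [f g|f|b [b_basis eb]] := @ldiag_eigenbasis _ _ [:: ad h; ad s].
  - have hs := ad_comm (cs h Hh).
    by rewrite !inE => /orP[] /eqP -> /orP[] /eqP ->.
  - by rewrite !inE => /orP[] /eqP -> //; apply: diagH.
  have [w1 e1] := eb (ad h) (mem_head _ _).
  have [w2 e2] : exists w, eigenbasis b (ad s) w by apply: eb; rewrite !inE eqxx orbT.
  apply: (eigenbasis_ldiag (w := fun i => w1 i + a * w2 i) b_basis) => i.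
  rewrite (repD (ad_rep L)) (repZ (ad_rep L)) add_lfunE scale_lfunE e1 e2 scalerA.
  by rewrite scalerDl.
move=> _ _ /memv_addP[h Hh [_ /vlineP[a ->] ->]] /memv_addP[h' Hh' [_ /vlineP[a' ->] ->]].
by rewrite lieDl !lieDr !lieZl !lieZr abH // liexx [lie h s]lieC !cs // oppr0 !scaler0 !addr0.
Qed.

(** The Killing form is nondegenerate on the centralizer [C], since basis vectors of nonzero weight
    are orthogonal to [C]. Maximality puts semisimple parts of elements of [C] into [H], so [C] acts
    nilpotently on itself and Engel's theorem leads to [[C, C] = 0]. A nilpotent part then commutes
    with [C], is orthogonal to it, and vanishes. *)
Lemma toral_self_centralizing H (b : 'I_(dim L) -> L) (v : 'I_(dim L) -> L -> K) x :
  toral H -> (forall H', toral H' -> (\dim H' <= \dim H)%N) ->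
  is_basis b -> (forall x k, x \in H -> lie x (b k) = v k x *: b k) ->
  (forall h, h \in H -> lie h x = 0) -> x \in H.
Proof.
move=> torH maxH [c [c_lin sumc cb]] bv; case: (torH) => diagH abH.
have [C memC] : exists C : {vspace L}, forall y, y \in C <-> forall h, h \in H -> lie h y = 0.
  apply: vspace_of_pred => [h _|a y z y0 z0 h Hh]; first by rewrite lie0r.
  by rewrite lieDr lieZr y0 ?z0 // scaler0 addr0.
have algC : is_subalgebra C.
  move=> y z /memC Cy /memC Cz; apply/memC => h Hh.
  by rewrite lie_lier (Cy h Hh) (Cz h Hh) lie0l lie0r addr0.
have nondegC y : y \in C -> (forall z, z \in C -> killing y z = 0) -> y = 0.
  move=> /memC Cy y0; apply: (killing_nondeg char0 Lss) => z.
  rewrite (sumc z) linear_sum big1 // => k _; rewrite linearZ /=.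
  case: (classic (forall h, h \in H -> v k h = 0)) => [v0|].
    rewrite y0 ?mulr0 //; apply/memC => h Hh; by rewrite bv // v0 // scale0r.
  move=> /not_all_ex_not[h nh]; have [Hh nzv] := imply_to_and _ _ nh.
  apply/eqP; rewrite mulf_eq0; apply/orP; right; move/eqP: nzv => /negPf nzv.
  have := killing_inv y h (b k); rewrite lieC Cy // oppr0 bv // linearZ /=.
  rewrite killingC linear0 => /esym/eqP; by rewrite mulf_eq0 nzv.
have jordanC y : y \in C -> exists s n, [/\ y = s + n, s \in H, n \in C & lnilp (ad n)].
  move=> Cy; have [s [n [def_y diags niln cs]]] := jordan_decomposition char0 Lss y.
  have Hs : s \in H.
    have csH h : h \in H -> lie s h = 0.
      by move=> Hh; apply: cs; rewrite lieC (memC y).1 // oppr0.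
    have tor := toral_addline torH diags csH.
    have /eqP -> : H == (H + <[s]>)%VS by rewrite eqEdim addvSl maxH.
    by rewrite (subvP (addvSr _ _)) // memv_line.
  exists s, n; split=> //; have -> : n = y - s by rewrite def_y addrC addKr.
  by rewrite memvB //; apply/memC => h Hh; apply: abH.
have CH h y : h \in H -> y \in C -> lie h y = 0 by move=> Hh /memC; apply.
have abC : lieprodv C C = 0%VS.
  have sC'C : (lieprodv C C <= C)%VS by apply/lieprodvP => y z; apply: algC.
  have stabC : stable_under (@ad K L) C (lieprodv C C).
    move=> y z Cy C'z; rewrite adE; have /lieprodvP := subvv (lieprodv C C).
    by apply => //; apply: (subvP sC'C).
  have nilC y : y \in C -> exists k, forall z, z \in C -> iter k (lie y) z = 0.
    move=> /jordanC[s [n [-> Hs Cn /ad_nilpotentP[k nk]]]]; exists k => z Cz.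
    rewrite -(nk z); suff [] : iter k (lie (s + n)) z = iter k (lie n) z /\ iter k (lie n) z \in C by [].
    elim: (k) => //= j [-> Cj]; split; last exact: algC.
    by rewrite lieDl CH // add0r.
  have [|m Cm] := engel_chain algC (ad_rep L) stabC nilC.
    move=> y /nilC[k nk]; exists k => z /(subvP sC'C) Cz; by rewrite iter_ad nk.
  have {Cm} exm : exists m, iter m (actv (@ad K L) C) (lieprodv C C) == 0%VS by exists m; apply/eqP.
  case: (ex_minnP exm) => -[|{}m] Cm minm; first exact/eqP.
  (* The last nonzero term: it is central in [C], hence orthogonal to nilpotent parts, and lies in
     [[C, C]], hence is orthogonal to [H]. By the Jordan decomposition it is orthogonal to all of
     [C]. *)
  set Y := iter m (actv (@ad K L) C) (lieprodv C C).
  have sY : (Y <= lieprodv C C)%VS.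
    rewrite /Y; elim: (m) => [|j IHj]; first exact: subvv.
    apply: subv_trans IHj; rewrite iterS; apply/(actvP (ad_rep L)).
    have : stable_under (@ad K L) C (iter j (actv (@ad K L) C) (lieprodv C C)).
      elim: j => [|j IHj]; first exact: stabC.
      move=> y z Cy Cz; rewrite iterS; apply: (mem_actv (ad_rep L)) => //.
      by move: z Cz; rewrite iterS; apply/subvP/(actvP (ad_rep L)).
    by [].
  have : Y == 0%VS.
    rewrite -subv0; apply/subvP => z Yz; rewrite memv0.
    have C'z := subvP sY z Yz; have Cz := subvP sC'C z C'z.
    have cz y : y \in C -> lie y z = 0.
      move=> Cy; apply/eqP; rewrite -memv0 -(eqP Cm) iterS -adE.
      exact: (mem_actv (ad_rep L)).
    apply/eqP; apply: nondegC => // y /jordanC[s [n [-> Hs Cn niln]]].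
    rewrite linearD /= [killing z n]killingC (killing_comm_nilp _ niln) ?cz // addr0.
    have [W memW] := kernel_space (killing_scalar s).
    suff /subvP/(_ z C'z) : (lieprodv C C <= W)%VS by rewrite memW killingC => /eqP.
    apply/lieprodvP => u t Cu Ct; rewrite memW -killing_inv CH // killingC linear0.
    exact: eqxx.
  by move=> /minm; rewrite ltnn.
move=> /memC Cx; have [s [n [-> Hs Cn niln]]] := jordanC x Cx.
suff -> : n = 0 by rewrite addr0.
apply: nondegC => // z Cz; apply: killing_comm_nilp niln.
apply/eqP; rewrite -memv0 -abC.
by have /lieprodvP := subvv (lieprodv C C); apply.
Qed.

(** A weight is encoded by the row of its values on a basis of [H], and [chi] evaluates it on [H];
    weights thus become elements of a vector space, to which [int_functional] applies. *)
Lemma root_decomposition : exists (H : {vspace L}) (r : nat)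
    (chi : 'rV[K]_r -> L -> K) (b : 'I_(dim L) -> L) (w : 'I_(dim L) -> 'rV[K]_r),
  [/\ is_basis b,
      forall x k, x \in H -> lie x (b k) = chi (w k) x *: b k,
      forall u v x, chi (u + v) x = chi u x + chi v x,
      (forall u, (forall x, x \in H -> chi u x = 0) -> u = 0) &
      (forall x, x \in H <-> forall h, h \in H -> lie h x = 0)].
Proof.
have tor0 : toral 0%VS.
  split=> [x|x y]; last by rewrite !memv0 => /eqP -> _; rewrite lie0l.
  rewrite memv0 => /eqP ->.
  rewrite (rep0 (ad_rep L)); apply: (@ldiag_decomp _ _ _ [:: 0] (fun a v => if a == 0 then v else 0)) => // [v|a v].
    by rewrite big_seq1 eqxx.
  by rewrite zero_lfunE; case: eqP => [->|_]; rewrite ?scale0r ?scaler0.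
have [H [[diagH abH] maxH]] := max_dim_vspace tor0.
pose X := vbasis H.
have [f g /mapP[x Xx ->] /mapP[y Xy ->]|f /mapP[x Xx ->]|b [b_basis eb]] :=
    @ldiag_eigenbasis _ _ [seq ad x | x <- X].
- by apply/ad_comm/abH; apply: vbasis_mem.
- by apply/diagH/vbasis_mem.
have /fin_all_exists[v bv] : forall j : 'I_(\dim H), exists v, eigenbasis b (ad X`_j) v.
  by move=> j; apply/eb/map_f/mem_nth; rewrite size_tuple.
pose chi (u : 'rV[K]_(\dim H)) x := \sum_j coord X j x * u 0 j.
exists H, (\dim H), chi, b, (fun k => \row_j v j k).
have bH x k : x \in H -> lie x (b k) = chi (\row_j v j k) x *: b k.
  move=> Hx; rewrite -adE {1}(coord_vbasis Hx) /chi scaler_suml.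
  rewrite -/X; elim/big_rec2: _ => [|j y z _ IH]; first by rewrite (rep0 (ad_rep L)) zero_lfunE.
  rewrite (repD (ad_rep L)) (repZ (ad_rep L)) add_lfunE scale_lfunE IH bv.
  by rewrite scalerA mxE.
split=> //.
- move=> u u' x; rewrite -big_split; apply: eq_bigr => j _; by rewrite mxE mulrDr.
- move=> u u0; apply/rowP => j; rewrite mxE.
  have Xj : X`_j \in H by apply/vbasis_mem/mem_nth; rewrite size_tuple.
  rewrite -(u0 _ Xj) /chi (bigD1 j) //= big1 ?addr0 => [|i neq].
    by rewrite coord_free ?eqxx ?mul1r // (basis_free (vbasisP H)).
  by rewrite coord_free ?(basis_free (vbasisP H)) // eq_sym (negPf neq) mul0r.
move=> x; split=> [Hx h Hh|Cx]; first exact: abH.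
exact: (toral_self_centralizing _ maxH b_basis bH).
Qed.

End MaximalTorus.

Section ScalarMaps.
Variables (K : fieldType) (V : lmodType K) (phi : V -> K).
Hypothesis phi_lin : scalar phi.
Let F : {linear V -> K^o} := HB.pack (phi : V -> K^o) (GRing.isLinear.Build K V K^o *:%R _ phi_lin).

Lemma scalar_map0 : phi 0 = 0. Proof. exact: (linear0 F). Qed.
Lemma scalar_mapD u v : phi (u + v) = phi u + phi v. Proof. exact: (linearD F). Qed.
Lemma scalar_mapZ a u : phi (a *: u) = a * phi u. Proof. exact: (linearZZ F a u). Qed.
Lemma scalar_map_sum I r (P : pred I) (G : I -> V) :
  phi (\sum_(i <- r | P i) G i) = \sum_(i <- r | P i) phi (G i).
Proof. exact: (linear_sum F). Qed.
End ScalarMaps.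

Section PrincipalTriple.
Variables (K : closedFieldType) (L : finLieType K).
Hypothesis char0 : [pchar K] =i pred0.
Hypothesis Lss : no_abelian_ideals L.
Variables (H : {vspace L}) (r : nat) (chi : 'rV[K]_r -> L -> K).
Variables (b : 'I_(dim L) -> L) (w : 'I_(dim L) -> 'rV[K]_r).
Variable c : 'I_(dim L) -> L -> K.
Hypothesis c_lin : forall i, scalar (c i).
Hypothesis sumc : forall x, x = \sum_i c i x *: b i.
Hypothesis cb : forall i j, c i (b j) = (i == j)%:R.
Hypothesis bH : forall x k, x \in H -> lie x (b k) = chi (w k) x *: b k.
Hypothesis chiD : forall u v x, chi (u + v) x = chi u x + chi v x.
Hypothesis chi_inj : forall u, (forall x, x \in H -> chi u x = 0) -> u = 0.
Hypothesis memH : forall x, x \in H <-> forall h, h \in H -> lie h x = 0.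
Variable f : 'rV[K]_r -> int.
Hypothesis f0 : f 0 = 0.
Hypothesis fD : forall i j k, w i + w j = w k -> f (w k) = f (w i) + f (w j).
Hypothesis fN : forall i k, w i = - w k -> f (w i) = - f (w k).
Hypothesis f_nz : forall k, w k != 0 -> f (w k) != 0.

Let ceq x y : (forall l, c l x = c l y) -> x = y.
Proof. by move=> cxy; rewrite (sumc x) (sumc y); apply: eq_bigr => i _; rewrite cxy. Qed.

Let chi0 x : chi 0 x = 0.
Proof. by apply: (addrI (chi 0 x)); rewrite -chiD !addr0. Qed.

Let chiN u x : chi (- u) x = - chi u x.
Proof. by apply: (addrI (chi u x)); rewrite -chiD !subrr chi0. Qed.

Let wt u y := forall x, x \in H -> lie x y = chi u x *: y.

Let wt_coord u y k : wt u y -> c k y != 0 -> w k = u.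
Proof.
move=> uy nz; apply/eqP; rewrite -subr_eq0; apply/eqP/chi_inj => x Hx.
have /(congr1 (c k)) := uy x Hx; rewrite (scalar_mapZ (c_lin k)).
rewrite {1}(sumc y) linear_sum (scalar_map_sum (c_lin k)) (bigD1 k) //= big1 ?addr0 => [|i neq].
  rewrite linearZ /= bH // !(scalar_mapZ (c_lin k)) cb eqxx mulr1 mulrC => /(mulIf nz) eqchi.
  by rewrite chiD chiN eqchi subrr.
by rewrite linearZ /= bH // !(scalar_mapZ (c_lin k)) cb eq_sym (negPf neq) !mulr0.
Qed.

Let wt_lie u v y z : wt u y -> wt v z -> wt (u + v) (lie y z).
Proof.
move=> uy vz x Hx; rewrite lie_lier (uy x Hx) (vz x Hx) lieZl lieZr -scalerDl.
by rewrite chiD.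
Qed.

Let wt_b k : wt (w k) (b k). Proof. by move=> x Hx; apply: bH. Qed.

Let wt_killing u v y z : wt u y -> wt v z -> killing y z != 0 -> u + v = 0.
Proof.
move=> uy vz nz; apply: chi_inj => x Hx.
have := killing_inv y x z; rewrite [lie y x]lieC (uy x Hx) (vz x Hx) -scaleNr.
by rewrite killingZl killingZr => /(mulIf nz) e; rewrite chiD -e subrr.
Qed.

Let wtH y : y \in H <-> wt 0 y.
Proof.
split=> [/memH Hy x Hx|y0]; first by rewrite Hy // chi0 scale0r.
by apply/memH => x Hx; rewrite y0 // chi0 scale0r.
Qed.

(** Otherwise [b k] would be Killing-orthogonal to every basis vector. *)
Let w_opp k : exists k', w k' = - w k.
Proof.
apply: NNPP => nok; have : b k = 0.
  apply: (killing_nondeg char0 Lss) => y; rewrite (sumc y) linear_sum big1 // => j _.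
  rewrite linearZ /=; apply/eqP; rewrite mulf_eq0; apply/orP; right; apply: contraT => nz.
  case: nok; exists j; apply/eqP; rewrite -subr_eq0 opprK addrC.
  by apply/eqP; apply: wt_killing nz; apply: wt_b.
move/(congr1 (c k)); rewrite cb eqxx (scalar_map0 (c_lin k)) => /eqP.
by rewrite oner_eq0.
Qed.

(** [f] acts as a linear form on the rational span of the roots that vanishes at no root; its sign
    splits them into positive and negative ones. *)
Let pos k := (0 < f (w k))%R.

Let w_trichotomy k : [\/ pos k, w k = 0 | exists2 k', w k = - w k' & pos k'].
Proof.
case: (eqVneq (w k) 0) => [->|nz]; first by constructor 2.
have nf := f_nz nz.
have [lt|lt] : (0 < f (w k))%R \/ (f (w k) < 0)%R by lia.
  by constructor 1.
have [k' def_k'] := w_opp k; constructor 3; exists k'; first by rewrite def_k' opprK.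
by rewrite /pos (fN def_k'); lia.
Qed.

Let simple i := pos i && [forall j, forall k, pos j && pos k ==> (w i != w j + w k)].

Let simpleP i j k : simple i -> pos j -> pos k -> w i <> w j + w k.
Proof.
by move=> /andP[_ /forallP/(_ j)/forallP/(_ k)/implyP h] pj pk; apply/eqP/h/andP.
Qed.

Let pos_ind (P : 'rV[K]_r -> Prop) : (forall i, simple i -> P (w i)) ->
  (forall u v, P u -> P v -> P (u + v)) -> forall i, pos i -> P (w i).
Proof.
move=> Ps PD i; have [n] := ubnP `|f (w i)|%N; elim: n i => // n IHn i ltn pi.
case: (boolP (simple i)) => [/Ps //|]; rewrite negb_and pi /= negb_forall.
case/existsP=> j; rewrite negb_forall => /existsP[k]; rewrite negb_imply negbK.
case/andP=> /andP[pj pk] /eqP def_i; have def_f := fD (esym def_i).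
rewrite def_i; apply: PD; apply: IHn => //; rewrite /pos in pi pj pk; lia.
Qed.

(** The principal nilpotent. An element of [H] commuting with it is killed by all simple roots,
    hence by all roots, hence is central; this is [centralizer_e]. *)
Let e := \sum_(i | simple i) b i.

Let centralizer_e x : x \in H -> lie x e = 0 -> x = 0.
Proof.
move=> Hx xe; have chis i : simple i -> chi (w i) x = 0.
  move=> si; have /(congr1 (c i)) := xe; rewrite (scalar_map0 (c_lin i)) => <-.
  rewrite linear_sum (scalar_map_sum (c_lin i)) (bigD1 i) //= big1 ?addr0 => [|j /andP[_ neq]].
    by rewrite bH // (scalar_mapZ (c_lin i)) cb eqxx mulr1.
  by rewrite bH // (scalar_mapZ (c_lin i)) cb eq_sym (negPf neq) mulr0.
have chip i : pos i -> chi (w i) x = 0.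
  apply: (pos_ind (P := fun u => chi u x = 0)); first exact: chis.
  by move=> u v u0 v0; rewrite chiD u0 v0 addr0.
apply: (center_trivial Lss) => y; rewrite (sumc y) linear_sum big1 // => k _.
rewrite linearZ /= bH //; suff -> : chi (w k) x = 0 by rewrite scale0r scaler0.
case: (w_trichotomy k) => [/chip //|->|[k' -> /chip k0]]; first by rewrite chi0.
by rewrite chiN k0 oppr0.
Qed.

Let coord_lie_e l k : c l (lie e (b k)) != 0 -> exists2 s, simple s & w s + w k = w l.
Proof.
rewrite /e -adE; have -> : ad (\sum_(i | simple i) b i) = \sum_(i | simple i) ad (b i).
  apply: (big_morph (@ad K L)); [exact: (repD (ad_rep L)) | exact: (rep0 (ad_rep L))].
rewrite sum_lfunE (scalar_map_sum (c_lin l)) => nz.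
apply: NNPP => nos; case/eqP: nz; apply: big1 => s ss; rewrite adE.
apply/eqP; apply: contraT => nz; case: nos; exists s => //.
by rewrite (wt_coord (wt_lie (wt_b s) (wt_b k)) nz).
Qed.

Let coord_lie_e_sum l y : c l (lie e y) = \sum_k c k y * c l (lie e (b k)).
Proof.
rewrite {1}(sumc y) linear_sum (scalar_map_sum (c_lin l)); apply: eq_bigr => k _.
by rewrite linearZ /= (scalar_mapZ (c_lin l)).
Qed.

Let nilp_e : lnilp (ad e).
Proof.
have degree j k i : c i (iter j (lie e) (b k)) != 0 -> (f (w k) + j%:Z <= f (w i))%R.
  elim: j i => [|j IHj] i /=.
    rewrite cb; case: (eqVneq i k) => [->|_]; last by rewrite eqxx.
    by rewrite addr0.
  rewrite coord_lie_e_sum => nz.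
  have [l nzl] : exists l, c l (iter j (lie e) (b k)) * c i (lie e (b l)) != 0.
    apply: NNPP => nol; case/eqP: nz; apply: big1 => l _; apply/eqP.
    by apply: contra_notT nol => ?; exists l.
  move: nzl; rewrite mulf_eq0 negb_or => /andP[/IHj le1 /coord_lie_e[s /andP[ps _] sl]].
  have := fD sl; move: ps le1; rewrite /pos; lia.
(* [ad e] raises the degree [f] by at least 1, and all degrees lie between [- M] and [M]; so
   [2 M + 1] applications leave the range. *)
pose M := \sum_k `|f (w k)|%N.
have leM k : (`|f (w k)| <= M)%N by rewrite /M (bigD1 k) //= leq_addr.
have [N defN] : exists N, N = (M + M).+1 by exists (M + M).+1.
exists N => x; rewrite (sumc x) -lpowE linear_sum big1 // => k _.
rewrite linearZ /= lpowE iter_ad.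
suff -> : iter N (lie e) (b k) = 0 by rewrite scaler0.
apply: ceq => i; rewrite (scalar_map0 (c_lin i)); apply/eqP; apply: contraT => /degree.
have := leM k; have := leM i; rewrite defN; lia.
Qed.

(** It is enough that [e] lies in [[e, H]]. A functional separating them would be [killing z], and
    only the part [z'] of [z] in weights opposite to simple roots is seen by [e] and by [[H, e]]. *)
Let exists_h : exists2 h, h \in H & lie h e = 2%:R *: e.
Proof.
suff : e \in (ad e @: H)%VS.
  case/memv_imgP=> h Hh; rewrite adE => def_e; exists (- 2%:R *: h); first exact: memvZ.
  by rewrite lieZl scaleNr lieC scalerN opprK -def_e.
apply: contraT => /separating_form[phi [phi_lin phiH phie]].
have [z def_phi] := killing_represent char0 Lss phi_lin.
pose nsimple k := [exists i, simple i && (w i == - w k)].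
(* Simplicity forces [lie e z'] into [H], where it is Killing-orthogonal to [H]; so [z']
   commutes with [e] and cannot detect it. *)
pose z' := \sum_(k | nsimple k) c k z *: b k.
have kz' i : simple i -> killing z' (b i) = killing z (b i).
  move=> si; rewrite ![killing _ (b i)]killingC [in RHS](sumc z) /z' !linear_sum /=.
  rewrite [RHS](bigID nsimple) /= [X in _ = _ + X]big1 ?addr0 // => k nk.
  rewrite linearZ /=; apply/eqP; rewrite mulf_eq0; apply/orP; right; apply: contraT.
  move/(wt_killing (wt_b i) (wt_b k)) => /eqP; rewrite addr_eq0 => wik.
  by case/existsP: nk; exists i; rewrite si.
have kz'_e : killing z' e = killing z e.
  by rewrite /e !linear_sum; apply: eq_bigr => i si; apply: kz'.
have kz'_H x : x \in H -> killing z' (lie x e) = killing z (lie x e).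
  move=> Hx; rewrite /e !linear_sum; apply: eq_bigr => i si /=.
  by rewrite bH // !linearZ /= kz'.
have Hg : lie e z' \in H.
  apply/memH => x Hx; rewrite /z' !linear_sum big1 //= => k /existsP[i' /andP[si' /eqP wi']].
  rewrite !linearZ /=; suff -> : lie x (lie e (b k)) = 0 by rewrite scaler0.
  have -> : lie e (b k) = \sum_(i | simple i) lie (b i) (b k).
    rewrite lieC /e linear_sum -sumrN; apply: eq_bigr => i _; by rewrite [RHS]lieC.
  rewrite linear_sum big1 //= => i si.
  rewrite (wt_lie (wt_b i) (wt_b k) Hx).
  case: (eqVneq (w i + w k) 0) => [->|nz]; first by rewrite chi0 scale0r.
  suff -> : lie (b i) (b k) = 0 by rewrite scaler0.
  apply: ceq => l; rewrite (scalar_map0 (c_lin l)); apply/eqP; apply: contraT => nzl.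
  have wl := wt_coord (wt_lie (wt_b i) (wt_b k)) nzl.
  have pi : pos i by case/andP: si.
  have pi' : pos i' by case/andP: si'.
  have wi : w i = w l + w i' by rewrite wl wi' addrK.
  case: (w_trichotomy l) => [pl|l0|[l' def_l pl']].
  - by case: (simpleP si pl pi').
  - by rewrite -wl l0 eqxx in nz.
  by case: (simpleP si' pi pl'); rewrite wi def_l addrC addNKr.
have g0 : lie e z' = 0.
  apply: (killing_nondeg char0 Lss) => y; rewrite (sumc y) linear_sum big1 // => k _.
  rewrite linearZ /=; apply/eqP; rewrite mulf_eq0; apply/orP; right; apply: contraT => nz.
  have /wtH wg := Hg.
  have wk0 : w k = 0 by have := wt_killing wg (wt_b k) nz; rewrite add0r.
  have Hb : b k \in H by apply/wtH; rewrite -wk0; apply: wt_b.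
  case/eqP: nz; rewrite killingC -killing_inv killingC kz'_H // -def_phi.
  by apply: phiH; rewrite lieC memvN -adE memv_img.
case/eqP: phie; rewrite def_phi -kz'_e killingC.
exact: (killing_comm_nilp g0 nilp_e).
Qed.

(** Simple roots take the value 2 at [h], so every root takes an even value, positive on positive
    roots. Hence the centralizer of [h] is exactly [H], whose elements act diagonally and meet the
    centralizer of [e] in 0; these are the last two clauses. *)
Lemma principal_triple_of_roots : exists e h f (m : 'I_(dim L) -> int),
  [/\ lie h e = 2%:R *: e, lie h f = - 2%:R *: f & lie e f = h] /\
  [/\ forall k, lie h (b k) = (2 * m k)%:~R *: b k,
      forall x y, lie h x = 0 -> lie x (lie x y) = 0 -> lie x y = 0 &
      forall x, lie h x = 0 -> lie e x = 0 -> x = 0].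
Proof.
have [h Hh he] := exists_h.
have chis i : simple i -> chi (w i) h = 2%:R.
  move=> si; have /(congr1 (c i)) := he.
  rewrite /e linear_sum (scalar_mapZ (c_lin i)) !(scalar_map_sum (c_lin i)) /=.
  rewrite (bigD1 i) // [in RHS](bigD1 i) //= bH // (scalar_mapZ (c_lin i)) cb eqxx mulr1.
  rewrite !big1 ?addr0 ?mulr1 // => j /andP[_ neq].
    by rewrite cb eq_sym (negPf neq).
  by rewrite bH // (scalar_mapZ (c_lin i)) cb eq_sym (negPf neq) mulr0.
have chip i : pos i -> exists m : int, (0 < m)%R /\ chi (w i) h = (2 * m)%:~R.
  apply: (pos_ind (P := fun u => exists m : int, (0 < m)%R /\ chi u h = (2 * m)%:~R)).
    by move=> j sj; exists 1; rewrite chis.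
  move=> u v [m [m0 um]] [m' [m'0 vm]]; exists (m + m'); split; first by lia.
  by rewrite chiD um vm -intrD mulrDr.
have /fin_all_exists[m mP] k : exists m : int, chi (w k) h = (2 * m)%:~R /\ (m = 0 -> w k = 0).
  case: (w_trichotomy k) => [/chip[m [m0 ->]]|->|[k' -> /chip[m [m0 km]]]].
  - by exists m; split=> // m1; rewrite m1 in m0.
  - by exists 0; rewrite chi0.
  exists (- m); rewrite chiN km mulrN intrN; split=> // m1; lia.
have int_inj (i j : int) : i%:~R = j%:~R :> K -> i = j.
  move=> /eqP; rewrite -subr_eq0 -intrB => /eqP eq0; apply/eqP; rewrite -subr_eq0; apply/eqP.
  have := @mulrz_torsion_free K K^o char0 1 (i - j); apply; [exact: eq0 | exact: oner_neq0].
(* Projection onto the [ad h]-eigenspace for [2 j]; [ad e] has degree 1 for this grading. *)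
pose prj (j : int) x := \sum_(k | m k == j) c k x *: b k.
have c_prj l j x : c l (prj j x) = if m l == j then c l x else 0.
  rewrite (scalar_map_sum (c_lin l)); case: ifPn => [ml|nml].
    rewrite (bigD1 l) //= big1 ?addr0 => [|k /andP[_ neq]].
      by rewrite (scalar_mapZ (c_lin l)) cb eqxx mulr1.
    by rewrite (scalar_mapZ (c_lin l)) cb eq_sym (negPf neq) mulr0.
  apply: big1 => k mk; rewrite (scalar_mapZ (c_lin l)) cb.
  by case: (eqVneq l k) => [elk|_]; rewrite ?mulr0 // elk mk in nml *.
have m_lie_e l k : c l (lie e (b k)) != 0 -> m l = m k + 1.
  move/coord_lie_e=> [s ss wl]; have [ml _] := mP l; have [mk _] := mP k.
  have : (2 * m l)%:~R = (2 * (m k + 1))%:~R :> K.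
    by rewrite -ml -wl chiD chis // mk mulrDr intrD addrC.
  by move/int_inj; lia.
have prj_e j x : lie e (prj j x) = prj (j + 1) (lie e x).
  apply: ceq => l; rewrite c_prj !coord_lie_e_sum.
  transitivity (\sum_k if m l == j + 1 then c k x * c l (lie e (b k)) else 0); last first.
    by case: ifP => // _; rewrite big1.
  apply: eq_bigr => k _; rewrite c_prj.
  case: (eqVneq (c l (lie e (b k))) 0) => [->|/m_lie_e ->]; first by rewrite !mulr0 if_same.
  by rewrite (inj_eq (addIr 1)); case: ifP; rewrite ?mul0r.
have prjH x : prj 0 x \in H.
  rewrite memv_suml // => k /eqP/(mP k).2 wk; rewrite memvZ //; apply/wtH.
  by rewrite -wk; apply: wt_b.
have prj_id x : lie h x = 0 -> prj 0 x = x.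
  move=> hx; apply: ceq => l; rewrite c_prj; case: eqP => // nml.
  have /(congr1 (c l)) := hx; rewrite {1}(sumc x) linear_sum (scalar_map0 (c_lin l)).
  rewrite (scalar_map_sum (c_lin l)) (bigD1 l) //= big1 ?addr0 => [|k neq].
    rewrite linearZ /= bH // !(scalar_mapZ (c_lin l)) cb eqxx mulr1 (mP l).1 => /eqP.
    rewrite mulf_eq0 => /orP[/eqP -> //|/eqP]; rewrite -[0]/(0%:~R) => /int_inj; lia.
  by rewrite linearZ /= bH // !(scalar_mapZ (c_lin l)) cb eq_sym (negPf neq) !mulr0.
have CH x : lie h x = 0 -> x \in H by move=> /prj_id <-.
have [f1 def_h] : exists f1, lie e f1 = h.
  (* A functional killing [[e, L]] but not [h] would be [killing z] with [z] commuting with [e]. The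
     degree 0 part of [z] lies in [H] and commutes with [e], so it is 0; but [h] pairs only with
     degree 0. *)
  suff /memv_imgP[f1 _ ->] : h \in limg (ad e) by exists f1; rewrite adE.
  apply: contraT => /separating_form[phi [phi_lin phie phih]].
  have [z def_phi] := killing_represent char0 Lss phi_lin.
  have ze : lie e z = 0.
    apply: (killing_nondeg char0 Lss) => y; rewrite lieC -scaleN1r killingZl killing_inv.
    by rewrite -def_phi phie ?mulr0 // -adE memv_img // memvf.
  have z0 : prj 0 z = 0.
    apply: centralizer_e; rewrite // lieC prj_e ze.
    by rewrite /prj big1 ?oppr0 // => k _; rewrite (scalar_map0 (c_lin k)) scale0r.
  case/eqP: phih; rewrite def_phi killingC {1}(sumc z) linear_sum big1 // => k _.
  rewrite linearZ /=; case: (eqVneq (c k z) 0) => [->|nz]; first by rewrite mul0r.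
  apply/eqP; rewrite mulf_eq0; apply/orP; right; apply: contraT => nzk.
  have /wtH wh := Hh; have := wt_killing wh (wt_b k) nzk; rewrite add0r => wk.
  have mk : m k = 0.
    have := (mP k).1; rewrite wk chi0 -[0]/(0%:~R) => /int_inj; lia.
  by move: nz; have := c_prj k 0 z; rewrite z0 (scalar_map0 (c_lin k)) mk eqxx => <-; rewrite eqxx.
(* As [h] has degree 0, the component of [f1] of degree -1 already has bracket [h] with [e], and it
   has [ad h]-weight -2. *)
exists e, h, (prj (- 1) f1), m; split; split=> //.
- rewrite /prj linear_sum scaler_sumr; apply: eq_bigr => k /eqP mk.
  by rewrite linearZ /= bH // (mP k).1 mk mulrN1 intrN !scalerA mulrC.
- by rewrite prj_e addNr def_h prj_id // liexx.
- by move=> k; rewrite bH // (mP k).1.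
- move=> x y /CH Hx xxy; apply: ceq => l; have /(congr1 (c l)) := xxy.
  have cx t : c l (lie x t) = chi (w l) x * c l t.
    rewrite {1}(sumc t) linear_sum (scalar_map_sum (c_lin l)) (bigD1 l) //= big1 ?addr0 => [|k neq].
      by rewrite linearZ /= bH // !(scalar_mapZ (c_lin l)) cb eqxx mulr1 mulrC.
    by rewrite linearZ /= bH // !(scalar_mapZ (c_lin l)) cb eq_sym (negPf neq) !mulr0.
  rewrite !cx (scalar_map0 (c_lin l)) => /eqP; rewrite mulf_eq0 => /orP[/eqP->|/eqP//].
  by rewrite mul0r.
by move=> x /CH Hx ex; apply: centralizer_e; rewrite // lieC ex oppr0.
Qed.

End PrincipalTriple.

Lemma principal_triple (K : closedFieldType) (L : finLieType K) :
  [pchar K] =i pred0 -> no_abelian_ideals L ->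
  exists (e h f : L) (b : 'I_(dim L) -> L) (m : 'I_(dim L) -> int),
  is_basis b /\
  [/\ lie h e = 2%:R *: e, lie h f = - 2%:R *: f & lie e f = h] /\
  [/\ forall k, lie h (b k) = (2 * m k)%:~R *: b k,
      forall x y, lie h x = 0 -> lie x (lie x y) = 0 -> lie x y = 0 &
      forall x, lie h x = 0 -> lie e x = 0 -> x = 0].
Proof.
move=> char0 Lss; have [H [r [chi [b [w [b_basis bH chiD chi_inj memH]]]]]] := root_decomposition char0 Lss.
have [c [c_lin sumc cb]] := b_basis.
(* With 0 in the list, additivity of [f] also covers pairs of opposite roots. *)
pose X := undup (0 :: codom w); have uX : uniq X by apply: undup_uniq.
have X0 : 0 \in X by rewrite mem_undup mem_head.
have Xw k : w k \in X by rewrite mem_undup inE codom_f orbT.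
have [f [resp_f nzf]] := int_functional char0 uX.
have fadd u v : u \in X -> v \in X -> u + v \in X -> f (u + v) = f u + f v.
  exact: int_functional_additive.
have f0 : f 0 = 0.
  by apply: (addrI (f 0)); rewrite -fadd ?addr0.
have fD i j k : w i + w j = w k -> f (w k) = f (w i) + f (w j).
  by move=> def_k; rewrite -def_k fadd // def_k.
have fN i k : w i = - w k -> f (w i) = - f (w k).
  move=> def_i; apply/eqP; rewrite -addr_eq0 -fadd // def_i addNr ?f0 //.
have [e [h [f' [m P]]]] := principal_triple_of_roots char0 Lss c_lin sumc cb bH chiD chi_inj memH f0 fD fN
   (fun k => nzf (w k) (Xw k)).
by exists e, h, f', b, m.
Qed.

(** * Invariants of a supplemented subalgebra *)

Section SubspaceForms.
Variables (K : fieldType) (V : vectType K) (B : V -> V -> K) (W : {vspace V}).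
Hypothesis Bl : forall a u v w, B (a *: u + v) w = a * B u w + B v w.
Hypothesis Br : forall a u v w, B w (a *: u + v) = a * B w u + B w v.
Hypothesis nondegW : forall u, u \in W -> (forall v, v \in W -> B u v = 0) -> u = 0.

Lemma subspace_represent (phi : V -> K) : scalar phi ->
  exists2 z, z \in W & forall v, v \in W -> phi v = B z v.
Proof.
move=> phi_lin.
have [||||z zP] := @form_represent _ (subvs_of W) (fun u v => B (vsval u) (vsval v)) _ _ _ (fun u => phi (vsval u)).
- by move=> a u v w /=; rewrite Bl.
- by move=> a u v w /=; rewrite Br.
- move=> u u0; apply/val_inj/nondegW; first exact: subvsP.
  by move=> v Wv; rewrite -(vsprojK Wv).
- by move=> a u v /=; rewrite phi_lin.
by exists (vsval z); [apply: subvsP | move=> v Wv; rewrite -(vsprojK Wv)].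
Qed.

End SubspaceForms.

Section Casimir.
Variables (K : closedFieldType) (L : finLieType K).
Hypothesis char0 : [pchar K] =i pred0.
Hypothesis Lss : no_abelian_ideals L.

Lemma killing_orth_decomp (W : {vspace L}) :
  (forall u, u \in W -> (forall v, v \in W -> killing u v = 0) -> u = 0) ->
  forall x, exists2 u, u \in W & forall v, v \in W -> killing (x - u) v = 0.
Proof.
move=> ndW x.
have [u Wu uP] := subspace_represent (@killing_linear_l K L)
  (@killing_linear_r K L) ndW (killing_scalar x).
exists u => // v Wv; rewrite -scaleN1r addrC killing_linear_l mulN1r.
by rewrite -(uP v Wv) addNr.
Qed.

Variables (V : vectType K) (rho : L -> 'End(V)).
Hypothesis rep : is_rep rho.

Definition rep_stable (Y : {vspace V}) : Prop :=
  forall x y, y \in Y -> rho x y \in Y.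

Let tau x y := ltrace (rho x \o rho y)%VF.

Let tauC x y : tau x y = tau y x. Proof. exact: ltrace_comm. Qed.

Let tau_l a u v x : tau (a *: u + v) x = a * tau u x + tau v x.
Proof. by rewrite /tau (repD rep) (repZ rep) comp_lfunDl -comp_lfunZl linearD linearZ. Qed.

Let tau_r a u v x : tau x (a *: u + v) = a * tau x u + tau x v.
Proof. by rewrite !(tauC x) tau_l. Qed.

Let tau_inv x y z : tau (lie x y) z = tau x (lie y z).
Proof. by rewrite /tau !(rep_lcomm rep) ltrace_lcomm. Qed.

(** As [rho] need not be faithful, the Casimir operator is built on the Killing orthogonal [J] of
    its kernel, where the trace form of [rho] is nondegenerate by [trace_null_ideal]. Its trace is
    [\dim J], nonzero since [J = 0] would make [rho] vanish. *)
Lemma casimir : (exists x, rho x <> 0) -> exists Om : 'End(V),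
  [/\ forall x, (rho x \o Om)%VF = (Om \o rho x)%VF, ltrace Om <> 0 &
      forall Y, rep_stable Y -> {in Y, forall y, Om y \in actv rho fullv Y}].
Proof.
case=> x0 nzx0.
have [I memI] : exists I : {vspace L}, forall x, x \in I <-> rho x = 0.
  apply: vspace_of_pred => [|a u v u0 v0]; first exact: rep0.
  by rewrite (repD rep) (repZ rep) u0 v0 scaler0 addr0.
have [J memJ] : exists J : {vspace L}, forall x, x \in J <-> forall y, y \in I -> killing x y = 0.
  apply: vspace_of_pred => [y _|a u v u0 v0 y Iy]; first by rewrite killingC linear0.
  by rewrite killing_linear_l u0 ?v0 // mulr0 addr0.
have idI : is_ideal I.
  by move=> x y /memI Iy; apply/memI; rewrite (rep_lcomm rep) Iy /lcomm comp_lfun0r comp_lfun0l subrr.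
have idJ : is_ideal J.
  move=> x y /memJ Jy; apply/memJ => z Iz.
  by rewrite lieC -scaleN1r killingZl killing_inv Jy ?mulr0 ?idI.
have IJ0 x : x \in I -> x \in J -> x = 0.
  move=> Ix Jx; suff IJ : (I :&: J)%VS = 0%VS by apply/eqP; rewrite -memv0 -IJ memv_cap Ix.
  apply: Lss => [u v|u v]; rewrite !memv_cap => /andP[Iu Ju]; first by rewrite idI ?idJ.
  case/andP=> Iv Jv; apply: (killing_nondeg char0 Lss) => y.
  rewrite killing_inv; apply: (memJ u).1 => //.
  by rewrite lieC memvN idI.
have noabL (A : {vspace L}) : (A <= fullv)%VS -> (forall x y, x \in fullv -> y \in A -> lie x y \in A) ->
    (forall x y, x \in A -> y \in A -> lie x y = 0) -> A = 0%VS.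
  by move=> _ idA abA; apply: Lss => // u v; apply: idA; apply: memvf.
have ndJ u : u \in J -> (forall v, v \in J -> tau u v = 0) -> u = 0.
  have [T memT] : exists T : {vspace L}, forall x, x \in T <-> x \in J /\ forall y, y \in J -> tau x y = 0.
    apply: vspace_of_pred => [|a v w [Jv v0] [Jw w0]].
      by split; [apply: mem0v | move=> y _; rewrite /tau (rep0 rep) comp_lfun0l linear0].
    split; first by rewrite memvD ?memvZ.
    by move=> y Jy; rewrite tau_l v0 ?w0 // mulr0 addr0.
  move=> Ju u0; suff T0 : T = 0%VS by apply/eqP; rewrite -memv0 -T0; apply/memT.
  apply: (trace_null_ideal char0 rep (M := fullv)) => //.
  - by move=> x y _ _; apply: memvf.
  - exact: subvf.
  - move=> x y _ /memT[Jy y0]; apply/memT; split; first exact: idJ.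
    move=> z Jz; rewrite lieC -scaleN1r -[_ *: _]addr0 tau_l tau_inv y0 ?idJ // mulr0 add0r.
    by rewrite /tau (rep0 rep) comp_lfun0l linear0.
  - by move=> x /memT[Jx _] /memI Ix; apply: IJ0.
  by move=> x y /memT[_ x0'] /memT[Jy _]; apply: x0'.
pose d := \dim J; pose X := vbasis J.
have /fin_all_exists2[Y JY dualY] (i : 'I_d) : exists2 y, y \in J & forall v, v \in J -> coord X i v = tau y v.
  by apply: (subspace_represent tau_l tau_r ndJ) => a u v; rewrite linearP.
have JX (i : 'I_d) : X`_i \in J by apply/vbasis_mem/mem_nth; rewrite size_tuple.
have coordX (i j : 'I_d) : tau (Y i) X`_j = (i == j)%:R.
  by rewrite -dualY // coord_free ?(basis_free (vbasisP J)) // eq_sym.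
have expandX v : v \in J -> v = \sum_i tau (Y i) v *: X`_i.
  by move=> Jv; rewrite {1}(coord_vbasis Jv); apply: eq_bigr => i _; rewrite dualY.
have tau_sum F v : tau (\sum_(i < d) F i) v = \sum_(i < d) tau (F i) v.
  apply: (big_morph (tau^~ v)); last by rewrite /tau (rep0 rep) comp_lfun0l linear0.
  by move=> u u' /=; rewrite -[u]scale1r tau_l mul1r scale1r.
have tauZ a u v : tau (a *: u) v = a * tau u v.
  rewrite -[_ *: _]addr0 tau_l; suff -> : tau 0 v = 0 by rewrite addr0.
  by rewrite /tau (rep0 rep) comp_lfun0l linear0.
have expandY v : v \in J -> v = \sum_(i < d) tau v X`_i *: Y i.
  move=> Jv; apply/eqP; rewrite -subr_eq0; apply/eqP/ndJ.
    by rewrite memvB // memv_suml // => i _; rewrite memvZ.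
  move=> u Ju; rewrite -scaleN1r addrC tau_l tau_sum mulN1r.
  rewrite {2}(expandX u Ju) [tau v _]tauC tau_sum addrC -sumrB big1 // => i _.
  by rewrite !tauZ [tau _ v]tauC mulrC subrr.
have rho_sum F : rho (\sum_(i < d) F i) = \sum_(i < d) rho (F i).
  by apply: (big_morph rho); [exact: (repD rep) | exact: rep0].
exists (\sum_(i < d) (rho X`_i \o rho (Y i))%VF); split.
- move=> z; apply/lfunP => v; rewrite !comp_lfunE !sum_lfunE linear_sum /=.
  apply/eqP; rewrite -subr_eq0 -sumrB.
  (* [[z, X_i]] is expanded in the basis and [[z, Y_i]] in the dual basis. By invariance of [tau]
     the two coefficient matrices are opposite transposes, so the double sums cancel after
     exchanging the indices. *)
  rewrite (eq_bigr (fun i : 'I_d => \sum_(j < d) tau (Y j) (lie z X`_i) *: rho X`_j (rho (Y i) v) +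
      \sum_(j < d) tau (lie z (Y i)) X`_j *: rho X`_i (rho (Y j) v))) => [|i _]; last first.
    have -> : \sum_(j < d) tau (Y j) (lie z X`_i) *: rho X`_j (rho (Y i) v) = rho (lie z X`_i) (rho (Y i) v).
      rewrite [in RHS](expandX (lie z X`_i)) ?idJ // rho_sum sum_lfunE.
      by apply: eq_bigr => j _; rewrite (repZ rep) scale_lfunE.
    have -> : \sum_(j < d) tau (lie z (Y i)) X`_j *: rho X`_i (rho (Y j) v) = rho X`_i (rho (lie z (Y i)) v).
      rewrite [in RHS](expandY (lie z (Y i))) ?idJ // rho_sum sum_lfunE linear_sum.
      by apply: eq_bigr => j _; rewrite (repZ rep) scale_lfunE linearZ.
    by rewrite !comp_lfunE !(rep_lie rep) linearB /= addrA subrK.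
  rewrite big_split /= exchange_big /= -big_split big1 //= => j _.
  rewrite -big_split big1 //= => i _; rewrite -scalerDl.
  have -> : tau (lie z (Y j)) X`_i = - tau (Y j) (lie z X`_i).
    by rewrite lieC -scaleN1r tauZ tau_inv mulN1r.
  by rewrite subrr scale0r.
- rewrite linear_sum /= (eq_bigr (fun=> 1)) => [|i _]; last first.
    by rewrite -/(tau _ _) tauC coordX eqxx.
  rewrite sumr_const card_ord; apply/eqP/(natr_neq0 char0).
  rewrite lt0n dimv_eq0; apply: contraT; rewrite negbK => /eqP J0; case: nzx0.
  have [u Iu uP] : exists2 u, u \in I & forall v, v \in I -> killing (x0 - u) v = 0.
    apply: killing_orth_decomp => u Iu u0; apply: IJ0 => //; exact/memJ.
  have : x0 - u \in J by apply/memJ.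
  by rewrite J0 memv0 subr_eq0 => /eqP ->; apply/memI.
move=> Z stZ z Zz; rewrite sum_lfunE memv_suml // => i _; rewrite comp_lfunE.
by apply: (mem_actv rep); [apply: memvf | apply: stZ].
Qed.

End Casimir.

Section SupplementInvariants.
Variables (K : closedFieldType) (L : finLieType K).
Hypothesis char0 : [pchar K] =i pred0.
Variables (M U : {vspace L}).
Hypothesis algU : is_subalgebra U.
Hypothesis MU : (M + U)%VS = fullv.
Hypothesis nilU : forall u, u \in U -> ad_nilpotent u.

Section Words.
Variables (V : vectType K) (rho : L -> 'End(V)).
Hypothesis rep : is_rep rho.
Hypothesis nil_rho : forall u, u \in U -> lnilp (rho u).
Variable p : V.
Hypothesis Mp : forall m, m \in M -> rho m p = 0.

Let S k := iter k (actv rho fullv) <[p]>%VS.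

Let memS k x s : s \in S k -> rho x s \in S k.+1.
Proof. by move=> Ss; apply: (mem_actv rep) => //; apply: memvf. Qed.

Let M_S k m s : m \in M -> s \in S k -> rho m s \in S k.
Proof.
move=> Mm; elim: k s => [|k IHk] s.
  by move=> /vlineP[a ->]; rewrite linearZ /= Mp // scaler0 mem0v.
rewrite memv_preim; move: s; apply/subvP; apply/(actvP rep) => x s _ Ss.
rewrite -memv_preim; have -> : rho m (rho x s) = rho (lie m x) s + rho x (rho m s).
  by rewrite (rep_lie rep) subrK.
by rewrite memvD ?memS ?IHk.
Qed.

(** Let [Y] be the submodule generated by [p]. By Engel's theorem some functional [xi] kills [U.Y]
    but not [Y]. It kills every nonempty word applied to [p], hence [L.Y], hence [p] itself by
    hypothesis, and so all of [Y]. *)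
Lemma invariant_generated_eq0 :
  (forall Y, rep_stable rho Y -> p \in Y -> p \in actv rho fullv Y) -> p = 0.
Proof.
move=> pY; have [Y [SY minY]] := @span_pred _ V (fun v => exists k, v \in S k).
have stY : rep_stable rho Y.
  move=> x y; rewrite memv_preim; move: y; apply/subvP/minY => v [k Sv].
  by rewrite -memv_preim; apply: SY; exists k.+1; apply: memS.
have Yp : p \in Y by apply: SY; exists 0%N; apply: memv_line.
apply: NNPP => nzp.
have neq : actv rho U Y <> Y.
  apply: (engel algU _ rep).
  - by move=> u /nilU[k nk]; exists k.
  - by move=> u y _; apply: stY.
  - by move=> u /nil_rho[k nk]; exists k.
  by move=> Y0; case: nzp; apply/eqP; rewrite -memv0 -Y0.
have sUY : (actv rho U Y <= Y)%VS by apply/(actvP rep) => u y _; apply: stY.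
have /subvPn[y Yy nUy] : ~~ (Y <= actv rho U Y)%VS.
  by apply/negP => sY; apply: neq; apply/eqP; rewrite eqEsubv sUY.
have [xi [xi_lin xiU xiy]] := separating_form nUy.
have [W memW] := kernel_space xi_lin.
have step x s : s \in Y -> (forall m, m \in M -> rho m s \in W) -> rho x s \in W.
  move=> Ys Ms; have /memv_addP[m Mm [u Uu ->]] : x \in (M + U)%VS by rewrite MU memvf.
  rewrite (repD rep) add_lfunE memvD // ?(Ms m Mm) // memW; apply/eqP/xiU.
  exact: (mem_actv rep).
(* A letter from [M] moves right through the word until it kills [p]; one from [U] is killed by [xi]. *)
have SW k : (S k.+1 <= W)%VS.
  elim: k => [|k IHk]; apply/(actvP rep) => x s _ Ss.
    apply: step => [|m Mm]; first by apply: SY; exists 0%N.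
    by move/vlineP: Ss => [a ->]; rewrite linearZ /= Mp // scaler0 mem0v.
  apply: step => [|m Mm]; first by apply: SY; exists k.+1.
  by apply: (subvP IHk); apply: M_S.
have sYW : (actv rho fullv Y <= W)%VS.
  apply/(actvP rep) => x v _; rewrite memv_preim; move: v; apply/subvP/minY => s [k Ss].
  by rewrite -memv_preim (subvP (SW k)) // memS.
have Wp := subvP sYW p (pY Y stY Yp).
have /subvP/(_ y Yy) : (Y <= W)%VS.
  apply: minY => v [[|k] Sv]; last exact: (subvP (SW k)).
  by move/vlineP: Sv => [a ->]; rewrite memvZ.
by rewrite memW (negPf xiy).
Qed.

End Words.

Hypothesis Lss : no_abelian_ideals L.

(** If [rho] were nonzero, its Casimir operator, having nonzero trace, would have an eigenvalue
    [a != 0]. The component [E a p] is again an invariant of [M], and [invariant_generated_eq0]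
    kills it; so the submodule [lker (E a)] contains the generator [p], against [E a <> 0]. *)
Lemma invariant_cyclic (V : vectType K) (rho : L -> 'End(V)) (p : V) : is_rep rho ->
  (forall u, u \in U -> lnilp (rho u)) -> (forall m, m \in M -> rho m p = 0) ->
  (forall Y, rep_stable rho Y -> p \in Y -> Y = fullv) -> forall x, rho x = 0.
Proof.
move=> rep nil_rho Mp genp x; apply: NNPP => nzx.
have [Om [comOm trOm Om_actv]] := casimir char0 Lss rep (ex_intro _ x nzx).
have [X [E spE]] := spectral_projP Om; case: (spE) => uX sumE EE pE [[m mE] EX].
have [a [nza nzE]] : exists a, a != 0 /\ E a <> 0.
  apply: NNPP => noa; apply: trOm.
  have -> : Om = \sum_(a <- X) (Om \o E a)%VF.
    apply/lfunP => v; rewrite {1}(sumE v) sum_lfunE linear_sum.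
    by apply: eq_bigr => a _; rewrite comp_lfunE.
  rewrite linear_sum big1 // => a _ /=; rewrite (ltrace_spectral _ spE).
  case: (eqVneq a 0) => [->|nza]; first by rewrite mul0r.
  have -> : E a = 0 by apply: NNPP => nzE; apply: noa; exists a.
  by rewrite linear0 mulr0.
have comE y v : rho y (E a v) = E a (rho y v).
  have [q ->] := pE a; rewrite !sum_lfunE linear_sum; apply: eq_bigr => i _.
  rewrite !scale_lfunE linearZ /= !lpowE; congr (_ *: _).
  elim: (nat_of_ord i) => //= k <-; have /lfunP/(_ (iter k Om v)) := comOm y.
  by rewrite !comp_lfunE.
(* On the image of [E a] the Casimir operator is inverted by a polynomial in itself, so [E a p] lies
   in [Om Y], hence in [L.Y], for every submodule [Y] containing it. *)
have /Bezout_eq1_coprimepP[[u t] /= ut] : coprimep 'X (('X - a%:P) ^+ m).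
  by rewrite coprimep_expr // coprimep_XsubC rootX.
have OmE v : E a v = Om (peval Om u (E a v)).
  rewrite -[LHS]id_lfunE -(peval1 Om) -ut pevalD add_lfunE [u * 'X]mulrC !pevalM pevalX !comp_lfunE.
  by rewrite peval_XsubC_exp mE linear0 addr0.
have Ep0 : E a p = 0.
  apply: (invariant_generated_eq0 rep nil_rho) => [y My|Y stY Yp].
    by rewrite comE Mp // linear0.
  rewrite OmE; apply: (Om_actv Y stY); apply: peval_stable => // y Yy.
  have sY : (actv rho fullv Y <= Y)%VS by apply/(actvP rep) => z v _; apply: stY.
  by apply: (subvP sY); apply: (Om_actv Y stY).
apply: nzE; apply/lfunP => v; rewrite zero_lfunE; apply/eqP; rewrite -memv_ker.
rewrite (genp (lker (E a))) ?memvf ?memv_ker ?Ep0 // => y w.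
by rewrite !memv_ker -comE => /eqP ->; rewrite linear0.
Qed.

(** Restriction to a least submodule [W] containing [p] reduces this to the cyclic case; the
    restricted action lives on [subvs_of W]. *)
Lemma supplement_invariant (V : vectType K) (rho : L -> 'End(V)) (p : V) : is_rep rho ->
  (forall u, u \in U -> lnilp (rho u)) -> (forall m, m \in M -> rho m p = 0) ->
  forall x, rho x p = 0.
Proof.
move=> rep nil_rho Mp x.
have [W [[stW Wp] minW]] := @min_dim_vspace _ V (fun W => rep_stable rho W /\ p \in W)
  fullv (conj (fun x y _ => memvf (rho x y)) (memvf p)).
pose rho' y : 'End(subvs_of W) := linfun (fun w : subvs_of W => vsproj W (rho y (vsval w))).
have rho'_lin y : linear (fun w : subvs_of W => vsproj W (rho y (vsval w))).
  by move=> a u v /=; rewrite !linearP.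
have rho'E y w : vsval (rho' y w) = rho y (vsval w).
  pose F : {linear subvs_of W -> subvs_of W} := HB.pack
    (fun w : subvs_of W => vsproj W (rho y (vsval w)))
    (GRing.isLinear.Build K (subvs_of W) (subvs_of W) *:%R _ (rho'_lin y)).
  rewrite /rho' (lfunE F) /= vsprojK //; apply: stW; exact: subvsP.
have rep' : is_rep rho'.
  split=> [a y z|y z v].
    apply/lfunP => v; apply/val_inj; rewrite add_lfunE scale_lfunE /= rho'E (repD rep) (repZ rep).
    by rewrite add_lfunE scale_lfunE !rho'E.
  by apply/val_inj; rewrite /= rho'E (rep_lie rep) !rho'E.
have p'E : vsval (vsproj W p) = p by apply: vsprojK.
have nil' u : u \in U -> lnilp (rho' u).
  move=> /nil_rho[k nk]; exists k => v; apply/val_inj; rewrite /= -(nk (vsval v)).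
  by elim: (k) => //= j <-; rewrite rho'E.
have Mp' m : m \in M -> rho' m (vsproj W p) = 0.
  by move=> Mm; apply/val_inj; rewrite /= rho'E p'E Mp.
have gen' Y : rep_stable rho' Y -> vsproj W p \in Y -> Y = fullv.
  move=> stY Yp; pose i := linfun (vsval : subvs_of W -> V).
  have iE w : i w = vsval w by rewrite lfunE.
  have [] : rep_stable rho (i @: Y)%VS /\ p \in (i @: Y)%VS.
    split; last by rewrite -p'E -iE memv_img.
    by move=> y _ /memv_imgP[w Yw ->]; rewrite iE -rho'E -iE memv_img // stY.
  move=> st1 p1; have leW := minW _ (conj st1 p1).
  apply/eqP; rewrite eqEdim subvf dimvf (leq_trans leW) // -(limg_ker_dim i Y).
  exact: leq_addl.
have := invariant_cyclic rep' nil' Mp' gen' x.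
by move/lfunP/(_ (vsproj W p))/(congr1 val); rewrite /= rho'E p'E zero_lfunE.
Qed.

End SupplementInvariants.

(** * Semisimple algebras in MU *)

Section SlTriple.
Variables (K : closedFieldType) (L : finLieType K).
Hypothesis char0 : [pchar K] =i pred0.

Lemma sl_triple_nilpotent (e h : L) : lie h e = 2%:R *: e -> ad_nilpotent e.
Proof.
move=> he; have id0 : is_ideal (0%VS : {vspace L}).
  by move=> x y; rewrite !memv0 => /eqP ->; rewrite lie0r.
have nil0 : is_nilpotent (LieIdeal id0) by exists 0%N.
apply: (ad_nilpotent_mod_nilpotent_ideal char0 nil0 (h := h)) => /=.
by rewrite he scaler_nat subrr mem0v.
Qed.

Lemma intr_neq0 (j : int) : j != 0 -> j%:~R != 0 :> K.
Proof.
move=> nzj; apply/eqP => j0; case/eqP: nzj.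
exact: (@mulrz_torsion_free K K^o char0 1 j j0 (oner_neq0 K)).
Qed.

(* A lowest weight vector of weight [2j > 0] would generate infinitely many nonzero vectors [e^k v]. *)
Lemma no_positive_lowest_weight (e h f v : L) (j : int) : lie h e = 2%:R *: e -> lie e f = h ->
  (0 < j)%R -> lie h v = (2 * j)%:~R *: v -> lie f v = 0 -> v = 0.
Proof.
move=> he ef j_gt0 hv fv; have [n en] := sl_triple_nilpotent he.
pose y k := iter k (lie e) v.
have hy k : lie h (y k) = (2 * j + 2 * k%:Z)%:~R *: y k.
  elim: k => [|k IHk]; first by rewrite mulr0 addr0.
  rewrite /y iterS -/(y k) lie_lier he lieZl IHk lieZr -scalerDl; congr (_ *: _).
  by rewrite -[2]/(2%:Z%:~R) -intrD; congr (_%:~R); lia.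
have fy k : lie f (y k.+1) = - ((k.+1%:Z * (2 * j + k%:Z))%:~R *: y k).
  have fe z : lie f (lie e z) = lie e (lie f z) - lie h z.
    by rewrite -ef lie_lie opprB addrC subrK.
  elim: k => [|k IHk].
    rewrite [y 1%N]/(lie e v) fe fv lie0r sub0r hv; congr (- (_ *: _)); congr (_%:~R); lia.
  rewrite [y k.+2]/(lie e (y k.+1)) fe IHk lieNr lieZr -/(y k.+1) hy -opprD -scalerDl -intrD.
  congr (- (_ *: _)); congr (_%:~R); lia.
apply/eqP; apply: contraT => nzv; have nzy k : y k != 0.
  elim: k => // k IHk; apply: contraTneq IHk => y0.
  have nz : (k.+1%:Z * (2 * j + k%:Z))%:~R != 0 :> K.
    by apply: intr_neq0; rewrite mulf_neq0 //; lia.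
  have := fy k; rewrite y0 lie0r => /esym/eqP.
  by rewrite oppr_eq0 scaler_eq0 (negPf nz) => /= ->.
by have := nzy n; rewrite /y en eqxx.
Qed.

Variables (e h f : L) (b : 'I_(dim L) -> L) (m : 'I_(dim L) -> int).
Hypothesis he : lie h e = 2%:R *: e.
Hypothesis hf : lie h f = - 2%:R *: f.
Hypothesis ef : lie e f = h.
Hypothesis b_basis : is_basis b.
Hypothesis hb : forall k, lie h (b k) = (2 * m k)%:~R *: b k.

(** Spectral projections of [ad h] preserve [A] and yield a vector of some weight [2 j]. From
    [j > 0] one descends by [f], from [j < 0] one climbs by [e]; steps of 2 cannot jump over 0, and
    [no_positive_lowest_weight] prevents the string from dying earlier. *)
Lemma sl_submodule_weight0 (A : {vspace L}) : A <> 0%VS ->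
  (forall y, y \in A -> lie e y \in A) -> (forall y, y \in A -> lie h y \in A) ->
  (forall y, y \in A -> lie f y \in A) -> exists a, [/\ a \in A, a != 0 & lie h a = 0].
Proof.
move=> nzA eA hA fA; have [c [c_lin sumc cb]] := b_basis.
pose wv (j : int) v := [/\ v \in A, v != 0 & lie h v = (2 * j)%:~R *: v].
have [j [v jv]] : exists j v, wv j v.
  have [X [E spE]] := spectral_projP (ad h); case: (spE) => uX sumE EE pE [[n nE] EX].
  have [x Ax nzx] : exists2 x, x \in A & x != 0.
    exists (vpick A); rewrite ?memv_pick ?vpick0 //; exact/eqP.
  have [a nzEx] : exists a, E a x != 0.
    apply: NNPP => noa; case/eqP: nzx; rewrite (sumE x) big1 // => a _.
    by apply/eqP; apply: contra_notT noa => ?; exists a.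
  have AEx : E a x \in A.
    by have [p ->] := pE a; apply: peval_stable Ax => y Ay; rewrite adE hA.
  have [k nzk] : exists k, c k (E a x) != 0.
    apply: NNPP => nok; case/eqP: nzEx; rewrite (sumc (E a x)) big1 // => k _.
    have [->|/eqP nz] := eqVneq (c k (E a x)) 0; first by rewrite scale0r.
    by case: nok; exists k; apply/eqP.
  have chk k' y : c k' (lie h y) = (2 * m k')%:~R * c k' y.
    rewrite {1}(sumc y) linear_sum (scalar_map_sum (c_lin k')) (bigD1 k') //= big1 ?addr0 => [|i neq].
      by rewrite linearZ /= hb !(scalar_mapZ (c_lin k')) cb eqxx mulr1 mulrC.
    by rewrite linearZ /= hb !(scalar_mapZ (c_lin k')) cb eq_sym (negPf neq) !mulr0.
  have ck k' : c k' (E a x) != 0 -> (2 * m k')%:~R = a.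
    move=> nz; apply/eqP; rewrite -subr_eq0; apply: contraT => nza.
    have iterc i y : c k' (iter i (ad h - a *: \1%VF) y) = ((2 * m k')%:~R - a) ^+ i * c k' y.
      elim: i => [|i IHi]; first by rewrite mul1r.
      rewrite iterS exprS -mulrA -IHi; move: (iter i _ y) => z.
      rewrite !(add_lfunE, opp_lfunE, scale_lfunE, id_lfunE) adE -scaleNr.
      by rewrite (scalar_mapD (c_lin k')) chk (scalar_mapZ (c_lin k')) -mulrDl.
    have := nE a x; rewrite lpowE => /(congr1 (c k')); rewrite iterc (scalar_map0 (c_lin k')).
    by move/eqP; rewrite mulf_eq0 expf_eq0 (negPf nza) andbF (negPf nz).
  exists (m k), (E a x); split=> //; rewrite (sumc (E a x)) linear_sum scaler_sumr.
  apply: eq_bigr => i _; rewrite linearZ /= hb.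
  case: (eqVneq (c i (E a x)) 0) => [->|nz]; first by rewrite !scale0r scaler0.
  by rewrite (ck i nz) (ck k nzk) !scalerA mulrC.
have [n] := ubnP `|j|%N; elim: n j v jv => // n IHn j v [Av nzv hv] ltj.
have [j0|[jp|jn]] : j = 0 \/ ((0 < j)%R \/ (j < 0)%R) by lia.
- by exists v; rewrite hv j0 mulr0 scale0r.
- case: (eqVneq (lie f v) 0) => [fv0|nzfv].
    by rewrite (no_positive_lowest_weight he ef jp hv fv0) eqxx in nzv.
  apply: (IHn (j - 1) (lie f v)); last by lia.
  split=> //; first exact: fA.
  rewrite lie_lier hf lieZl hv lieZr -scalerDl; congr (_ *: _).
  by rewrite -[- 2]/((- 2)%:~R) -intrD; congr (_%:~R); lia.
case: (eqVneq (lie e v) 0) => [ev0|nzev].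
  suff v0 : v = 0 by rewrite v0 eqxx in nzv.
  (* The triple [(f, - h, e)] exchanges highest and lowest weights. *)
  apply: (@no_positive_lowest_weight f (- h) e v (- j)) => //.
  - by rewrite lieNl hf scaleNr opprK.
  - by rewrite lieC ef.
  - by lia.
  by rewrite lieNl hv -scaleNr -intrN mulrN.
apply: (IHn (j + 1) (lie e v)); last by lia.
split=> //; first exact: eA.
rewrite lie_lier he lieZl hv lieZr -scalerDl; congr (_ *: _).
by rewrite -[2]/(2%:Z%:~R) -intrD; congr (_%:~R); lia.
Qed.

End SlTriple.

Section SlIsomorphism.
Variables (K : closedFieldType) (L : finLieType K).
Hypothesis char0 : [pchar K] =i pred0.
Variables (e h f : L).
Hypothesis he : lie h e = 2%:R *: e.
Hypothesis hf : lie h f = - 2%:R *: f.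
Hypothesis ef : lie e f = h.
Hypothesis nzh : h != 0.

Let nz2 : 2%:R != 0 :> K := natr_neq0 char0 (isT : (0 < 2)%N).

Lemma sl_triple_independent (a c d : K) : a *: e + c *: h + d *: f = 0 ->
  [/\ a = 0, c = 0 & d = 0].
Proof.
have nze : e != 0 by apply: contraNneq nzh => e0; rewrite -ef e0 lie0l.
have nzf : f != 0 by apply: contraNneq nzh => f0; rewrite -ef f0 lie0r.
have adh x y z : lie h (x *: e + y *: h + z *: f) = (2%:R * x) *: e - (2%:R * z) *: f.
  rewrite !lieDr !lieZr he hf liexx scaler0 addr0 !scalerA [x * _]mulrC mulrN scaleNr.
  by rewrite [z * _]mulrC.
move=> eq0; have := adh a c d; rewrite eq0 lie0r => eq1.
have := adh (2%:R * a) 0 (- (2%:R * d)).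
rewrite scale0r addr0 scaleNr -eq1 lie0r mulrN scaleNr opprK => eq2.
have a0 : a = 0.
  have : (2%:R * (2%:R * (2%:R * a))) *: e = 0.
    have -> : (2%:R * (2%:R * (2%:R * a))) *: e =
       ((2%:R * (2%:R * a)) *: e + (2%:R * (2%:R * d)) *: f) +
       2%:R *: ((2%:R * a) *: e - (2%:R * d) *: f).
      by rewrite scalerBr !scalerA addrACA subrr addr0 -scalerDl; congr (_ *: _); ring.
    by rewrite -eq1 -eq2 scaler0 addr0.
  by move/eqP; rewrite scaler_eq0 (negPf nze) orbF !mulf_eq0 (negPf nz2) => /eqP.
have d0 : d = 0.
  move: eq1; rewrite a0 mulr0 scale0r sub0r => /esym/eqP.
  by rewrite oppr_eq0 scaler_eq0 (negPf nzf) orbF mulf_eq0 (negPf nz2) => /eqP.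
split=> //; move: eq0; rewrite a0 d0 !scale0r add0r addr0 => /eqP.
by rewrite scaler_eq0 (negPf nzh) orbF => /eqP.
Qed.

Definition sl2_mx (a c d : K) : 'M[K]_2 :=
  \matrix_(i < 2, j < 2) (if i == 0 then (if j == 0 then c else a) else (if j == 0 then d else - c)).

Lemma sl2_mx_traceless a c d : sl2_mx a c d \in traceless (K := K) (n := 2).
Proof. by apply/eqP; rewrite /mxtrace !big_ord_recl big_ord0 !mxE /= addr0 subrr. Qed.

Lemma sl2_mxP (A : sl K 2) : sl_mx A = sl2_mx (A ord0 ord_max) (A ord0 ord0) (A ord_max ord0).
Proof.
have /eqP : sl_mx A \in traceless (K := K) (n := 2) by case: A.
rewrite /mxtrace !big_ord_recl big_ord0 addr0 => /eqP; rewrite addrC addr_eq0 => /eqP tr0.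
have e1 : lift ord0 ord0 = ord_max :> 'I_2 by apply/val_inj.
rewrite e1 in tr0.
apply/matrixP => i j; rewrite mxE.
case: i => -[|[|//]] lti; case: j => -[|[|//]] ltj /=; rewrite -?tr0; congr (sl_mx A _ _); exact/val_inj.
Qed.

Hypothesis span : forall x, exists a c d, x = a *: e + c *: h + d *: f.

Lemma sl_triple_isomorphic : lie_isomorphic L (sl K 2).
Proof.
pose X := [tuple e; h; f].
have freeX : free X.
  apply/freeP => k; rewrite !big_ord_recl big_ord0 addr0 addrA => /sl_triple_independent[k0 k1 k2].
  case=> -[|[|[|//]]] lti; [rewrite -[RHS]k0|rewrite -[RHS]k1|rewrite -[RHS]k2];
    by congr k; apply/val_inj.
pose i1 : 'I_3 := lift ord0 ord0; pose i2 : 'I_3 := lift ord0 (lift ord0 ord0).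
pose a := coord X ord0; pose c := coord X i1; pose d := coord X i2.
have coordE x : x = a x *: e + c x *: h + d x *: f.
  have : x \in <<X>>%VS.
    have [u [v [w ->]]] := span x.
    by rewrite !memvD // memvZ // memv_span // !inE eqxx ?orbT.
  by move/coord_span => {1}->; rewrite !big_ord_recl big_ord0 addr0 addrA.
have coord_uniq x u v w : x = u *: e + v *: h + w *: f -> [/\ a x = u, c x = v & d x = w].
  move=> xE; have [] := @sl_triple_independent (a x - u) (c x - v) (d x - w).
    rewrite !scalerBl [X in X + _ = _]addrACA -opprD addrACA -opprD -coordE -xE.
    exact: subrr.
  by move=> /eqP; rewrite subr_eq0 => /eqP -> /eqP; rewrite subr_eq0 => /eqP -> /eqP; rewrite subr_eq0 => /eqP.
pose phi x : sl K 2 := Sl (sl2_mx_traceless (a x) (c x) (d x)).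
have phi_lin : linear phi.
  have lin i t x y : coord X i (t *: x + y) = t * coord X i x + coord X i y by rewrite linearP.
  move=> t x y; apply/val_inj/matrixP => i j; rewrite !mxE /a /c /d !lin /=.
  by case: ifP => _; case: ifP => _ //; ring.
pose F : {linear L -> sl K 2} := HB.pack phi (GRing.isLinear.Build K L (sl K 2) *:%R phi phi_lin).
exists F; split.
  pose psi (A : sl K 2) := A ord0 ord_max *: e + A ord0 ord0 *: h + A ord_max ord0 *: f.
  exists psi => [x|A].
    by rewrite /psi /= !mxE /=; symmetry; apply: coordE.
  apply/val_inj; rewrite /= [RHS]sl2_mxP.
  by have [-> -> ->] := coord_uniq (psi A) _ _ _ erefl.
move=> x y; apply/val_inj.
have bracket : lie x y = (2%:R * (c x * a y - a x * c y)) *: e +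
    (a x * d y - d x * a y) *: h + (2%:R * (d x * c y - c x * d y)) *: f.
  rewrite {1}(coordE x) {1}(coordE y) !lieDl !lieDr !lieZl !lieZr !liexx.
  rewrite ef he hf [lie e h]lieC he [lie f e]lieC ef [lie f h]lieC hf.
  rewrite !scaleNr !scalerN !opprK !scaler0 !addr0 !add0r !scalerA.
  rewrite !mulrBr !scalerBl ![2%:R * _]mulrC [LHS]addrACA.
  rewrite -[X in X + _ = _]addrA -[X in _ + X = _]addrA [LHS]addrACA [LHS]addrA; congr (_ + _); last exact: addrC.
  by congr (_ + _); apply: addrC.
have [ax cx dx] := coord_uniq _ _ _ _ bracket.
rewrite /= ax cx dx; apply/matrixP => i j; rewrite !mxE !big_ord_recl !big_ord0 !mxE /=.
case: i => -[|[|//]] lti; case: j => -[|[|//]] ltj /=; ring.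
Qed.

End SlIsomorphism.

(** The cancellation, with brackets abstracted to letters, behind the fact that [y |-> [ad y, _]] is
    a representation on ['End(L)]. *)
Lemma jacobi_rearrange (V : zmodType) (A B C D F G : V) :
  A - B + (- C - - D) = A - F + (- G - - D) + (- B - - G + (- - F - - - C)).
Proof.
rewrite !opprK [RHS](AC ((2*2)*(2*2)) (((1*5)*(8*4))*((2*7)*(3*6)))) /=.
by rewrite !addNr !addr0.
Qed.

Section SemisimpleMU.
Variables (K : closedFieldType) (L : finLieType K).
Hypothesis char0 : [pchar K] =i pred0.
Hypothesis Lss : no_abelian_ideals L.
Hypothesis MUL : in_MU L.

Lemma semisimple_MU : {:L}%VS = 0%VS \/ lie_isomorphic L (sl K 2).
Proof.
have [e [h [f [b [m [b_basis [[he hf ef] [hb torC CP]]]]]]]] := principal_triple char0 Lss.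
case: (eqVneq {:L}%VS 0%VS) => [|nzL]; [by left | right].
have nzh : h != 0.
  (* If [h = 0] then [2 e = [h, e] = 0], and [CP] applied to [h = e = 0] makes every [x] vanish. *)
  apply: contraNneq nzL => h0; rewrite -subv0; apply/subvP => x _; rewrite memv0.
  apply/eqP/CP; first by rewrite h0 lie0l.
  have /eqP := he; rewrite h0 lie0l eq_sym scaler_eq0 (negPf (natr_neq0 char0 (isT : (0 < 2)%N))).
  by move=> /= /eqP ->; rewrite lie0l.
pose P := (<[e]> + <[h]> + <[f]>)%VS.
have algP : is_subalgebra P.
  move=> _ _ /memv_addP[_ /memv_addP[_ /vlineP[a1 ->] [_ /vlineP[c1 ->] ->]] [_ /vlineP[d1 ->] ->]] /memv_addP[_ /memv_addP[_ /vlineP[a2 ->] [_ /vlineP[c2 ->] ->]] [_ /vlineP[d2 ->] ->]].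
  have Pe : e \in P by rewrite (subvP (addvSl _ _)) // (subvP (addvSl _ _)) // memv_line.
  have Ph : h \in P by rewrite (subvP (addvSl _ _)) // (subvP (addvSr _ _)) // memv_line.
  have Pf : f \in P by rewrite (subvP (addvSr _ _)) // memv_line.
  rewrite !lieDl !lieDr !lieZl !lieZr !liexx.
  rewrite ef he hf [lie e h]lieC he [lie f e]lieC ef [lie f h]lieC hf.
  by rewrite !scaleNr !memvD // ?memvZ ?memvN ?memvZ ?memvN ?memvZ ?mem0v.
case: (eqVneq P fullv) => [Pf|nPf].
  apply: (sl_triple_isomorphic char0 he hf ef nzh) => x.
  have : x \in P by rewrite Pf memvf.
  move=> /memv_addP[_ /memv_addP[_ /vlineP[a1 ->] [_ /vlineP[c1 ->] ->]] [_ /vlineP[d1 ->] ->]].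
  by exists a1, c1, d1.
have [M [[algM nMf sPM] maxM]] := @max_dim_vspace _ _
  (fun W => [/\ is_subalgebra W, W != fullv & (P <= W)%VS]) P (And3 algP nPf (subvv P)).
have Me : e \in M by apply: (subvP sPM); rewrite /P (subvP (addvSl _ _)) // (subvP (addvSl _ _)) // memv_line.
have Mh : h \in M by apply: (subvP sPM); rewrite /P (subvP (addvSl _ _)) // (subvP (addvSr _ _)) // memv_line.
have Mf : f \in M by apply: (subvP sPM); rewrite /P (subvP (addvSr _ _)) // memv_line.
have [U [[algU MU] nilU]] : exists U, is_supplement U M /\ forall u, u \in U -> ad_nilpotent u.
  apply: MUL; split=> //; first exact/eqP.
  move=> W algW nWf sMW; apply/esym/eqP; rewrite eqEdim sMW maxM //; split=> //.
    exact/eqP.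
  exact: subv_trans sPM sMW.
(* A nonzero [A] would contain some [a != 0] centralizing [h]. For [x] in [M], [[a, [a, x]]] lies in
   [[A, A] = 0], so [[a, x] = 0] by [torC]; in particular [a] commutes with [e] and [h], and [CP]
   gives [a = 0]. *)
have noabM A : (A <= M)%VS -> (forall x y, x \in M -> y \in A -> lie x y \in A) ->
    (forall x y, x \in A -> y \in A -> lie x y = 0) -> A = 0%VS.
  move=> sAM idA abA; apply: NNPP => nzA.
  have [||| a [Aa nza ha]] := sl_submodule_weight0 char0 he hf ef b_basis hb nzA; try by move=> y; apply: idA.
  have aM x : x \in M -> lie a x = 0.
    move=> Mx; apply: torC => //; apply: abA => //.
    by rewrite lieC memvN idA.
  case/eqP: nza; apply: CP => //; by rewrite lieC aM // oppr0.
have [N memN] : exists N : {vspace L}, forall x, x \in N <-> forall y, y \in M -> killing x y = 0.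
  apply: vspace_of_pred => [y _|a u v u0 v0 y My]; first by rewrite killingC linear0.
  by rewrite killing_linear_l u0 ?v0 // mulr0 addr0.
have MN_N x y : x \in M -> y \in N -> lie x y \in N.
  move=> Mx /memN Ny; apply/memN => z Mz.
  by rewrite lieC -scaleN1r killingZl killing_inv Ny ?mulr0 // algM.
have MN0 : (M :&: N = 0)%VS.
  apply: (trace_null_ideal char0 (ad_rep L) algM noabM).
  - exact: capvSl.
  - by move=> x y Mx; rewrite !memv_cap => /andP[My Ny]; rewrite algM ?MN_N.
  - by move=> x _; apply: (ad_faithful Lss).
  by move=> x y; rewrite !memv_cap => /andP[_ /memN x0] /andP[My _]; apply: x0.
have MNf x : x \in (M + N)%VS.
  have [u Mu uP] : exists2 u, u \in M & forall v, v \in M -> killing (x - u) v = 0.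
    apply: killing_orth_decomp => u Mu u0; apply/eqP; rewrite -memv0 -MN0 memv_cap Mu /=.
    exact/memN.
  by rewrite -[x](subrK u) addrC memv_add //; apply/memN.
pose p := daddv_pi M N.
have pM u : u \in M -> p u = u by apply: daddv_pi_id.
have pN v : v \in N -> p v = 0.
  move=> Nv; have := daddv_pi_add MN0 (MNf v); rewrite -/p.
  rewrite [daddv_pi N M v]daddv_pi_id 1?capvC // => /eqP.
  by rewrite -subr_eq0 addrK => /eqP.
have p_mem x : p x \in M by apply: memv_pi.
(* [p] is an invariant of [M] in [End L]. *)
have comm_p x : lcomm (ad x) p = 0.
  pose rho y : 'End('End(L)) := linfun (lcomm (ad y)).
  have lin (y : L) : linear (lcomm (ad y)).
    move=> a g g'; apply/lfunP => v; rewrite !(lcommE, add_lfunE, scale_lfunE) linearD linearZ /=.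
    by rewrite opprD addrACA -scalerBr.
  have rhoE y g : rho y g = lcomm (ad y) g.
    pose F : {linear 'End(L) -> 'End(L)} := HB.pack (lcomm (ad y))
      (GRing.isLinear.Build K 'End(L) 'End(L) *:%R _ (lin y)).
    exact: (lfunE F).
  rewrite -rhoE; apply: (supplement_invariant char0 algU MU nilU Lss).
  - split=> [a y z|y z g]; apply/lfunP => v.
      rewrite add_lfunE scale_lfunE !rhoE; apply/lfunP => w.
      rewrite !(lcommE, add_lfunE, scale_lfunE) !adE !lieDl !lieZl.
      rewrite linearD linearZ /= opprD addrACA; congr (_ + _).
      by rewrite scalerBr.
    rewrite add_lfunE opp_lfunE !rhoE !lcommE !adE !lie_lie !linearB /=.
    exact: jacobi_rearrange.
  - move=> u /nilU/ad_nilpotentP/lcomm_nilp[k nk]; exists k => g; rewrite -(nk g).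
    by elim: (k) => //= j ->; rewrite rhoE.
  move=> y My; rewrite rhoE; apply/lfunP => v; rewrite lcommE zero_lfunE !adE.
  have [u Mu [w Nw ->]] := memv_addP (MNf v).
  rewrite !linearD /= (pM u Mu) (pN w Nw) (pM (lie y u)) ?algM // (pN (lie y w)) ?MN_N //.
  by rewrite lie0r subr0 addr0 subrr.
have commE x y : lie x (p y) = p (lie x y).
  have /lfunP/(_ y) := comm_p x; rewrite lcommE zero_lfunE !adE => /eqP.
  by rewrite subr_eq0 => /eqP.
have idM x y : y \in M -> lie x y \in M by move=> My; rewrite -(pM y My) commE p_mem.
case/eqP: nMf; apply/eqP; rewrite eqEsubv subvf; apply/subvP => x _.
have [u Mu [v Nv ->]] := memv_addP (MNf x).
suff -> : v = 0 by rewrite addr0.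
have Mv0 y : y \in M -> lie y v = 0.
  move=> My; rewrite -(pM (lie y v)); last by rewrite lieC memvN idM.
  by rewrite -commE pN // lie0r.
by apply: CP; apply: Mv0.
Qed.

End SemisimpleMU.

(** * Extensions of sl2 by a nilpotent ideal *)

Section SlExtension.
Variables (K : closedFieldType) (L : finLieType K).
Hypothesis char0 : [pchar K] =i pred0.
(* [a], [c] and [d] are the entries (0, 1), (0, 0) and (1, 0) of the image in sl2. *)
Variables (N : lieIdeal L) (a c d : L -> K) (e h f : L).
Hypothesis nilN : is_nilpotent N.
Hypothesis a_lin : scalar a.
Hypothesis c_lin : scalar c.
Hypothesis d_lin : scalar d.
Hypothesis memN : forall x, x \in ideal_space N <-> [/\ a x = 0, c x = 0 & d x = 0].
Hypothesis a_lie : forall x y, a (lie x y) = 2%:R * (c x * a y - a x * c y).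
Hypothesis c_lie : forall x y, c (lie x y) = a x * d y - d x * a y.
Hypothesis d_lie : forall x y, d (lie x y) = 2%:R * (d x * c y - c x * d y).
Hypothesis coord_e : [/\ a e = 1, c e = 0 & d e = 0].
Hypothesis coord_h : [/\ a h = 0, c h = 1 & d h = 0].
Hypothesis coord_f : [/\ a f = 0, c f = 0 & d f = 1].

Let aD u v : a (u + v) = a u + a v. Proof. exact: scalar_mapD. Qed.
Let cD u v : c (u + v) = c u + c v. Proof. exact: scalar_mapD. Qed.
Let dD u v : d (u + v) = d u + d v. Proof. exact: scalar_mapD. Qed.
Let aZ t u : a (t *: u) = t * a u. Proof. exact: scalar_mapZ. Qed.
Let cZ t u : c (t *: u) = t * c u. Proof. exact: scalar_mapZ. Qed.
Let dZ t u : d (t *: u) = t * d u. Proof. exact: scalar_mapZ. Qed.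
Let aN u : a (- u) = - a u. Proof. by rewrite -scaleN1r aZ mulN1r. Qed.
Let cN u : c (- u) = - c u. Proof. by rewrite -scaleN1r cZ mulN1r. Qed.
Let dN u : d (- u) = - d u. Proof. by rewrite -scaleN1r dZ mulN1r. Qed.
Let linE := (aD, cD, dD, aZ, cZ, dZ, aN, cN, dN).

Let nilp_e : ad_nilpotent e.
Proof.
apply: (ad_nilpotent_mod_nilpotent_ideal char0 nilN (h := h)).
case: coord_e coord_h => ae ce de [ah ch dh].
by apply/memN; rewrite mulr2n !linE a_lie c_lie d_lie ae ce de ah ch dh; split; ring.
Qed.

Let nilp_f : ad_nilpotent f.
Proof.
apply: (ad_nilpotent_mod_nilpotent_ideal char0 nilN (h := - h)).
case: coord_f coord_h => af cf df [ah ch dh].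
by apply/memN; rewrite mulr2n !linE a_lie c_lie d_lie !linE af cf df ah ch dh; split; ring.
Qed.

(* [e - h - f] and [h + 2 f] are the images of [e] and [h] under exp (ad f). *)
Let nilp_ehf : ad_nilpotent (e - h - f).
Proof.
apply: (ad_nilpotent_mod_nilpotent_ideal char0 nilN (h := h + 2%:R *: f)).
case: coord_e coord_f coord_h => ae ce de [af cf df] [ah ch dh].
apply/memN; rewrite mulr2n !linE a_lie c_lie d_lie !linE ae ce de af cf df ah ch dh.
by split; ring.
Qed.

Let dim_le : (\dim {:L} <= \dim (ideal_space N) + 3)%N.
Proof.
have -> : {:L}%VS = (ideal_space N + <<[:: e; h; f]>>)%VS.
  apply/eqP; rewrite eqEsubv subvf andbT; apply/subvP => x _.
  rewrite -[x](subrK (a x *: e + c x *: h + d x *: f)) memv_add //.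
    case: coord_e coord_f coord_h => ae ce de [af cf df] [ah ch dh].
    by apply/memN; rewrite !linE ae ce de af cf df ah ch dh; split; ring.
  by rewrite !memvD // memvZ // memv_span // !inE eqxx ?orbT.
apply: leq_trans (dimv_add_leqif _ _) _; rewrite leq_add2l.
exact: dim_span.
Qed.

Let line_supplement (M : {vspace L}) u : ad_nilpotent u -> (M + <[u]>)%VS = fullv ->
  exists U : {vspace L}, is_supplement U M /\ forall v, v \in U -> ad_nilpotent v.
Proof.
move=> [k nk] Mu; exists <[u]>%VS; split.
  split=> // _ _ /vlineP[s ->] /vlineP[t ->].
  by rewrite lieZl lieZr liexx !scaler0 mem0v.
move=> _ /vlineP[t ->]; exists k => x.
suff -> : iter k (lie (t *: u)) x = t ^+ k *: iter k (lie u) x by rewrite nk scaler0.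
elim: (k) => [|j IHj]; first by rewrite scale1r.
by rewrite !iterS IHj lieZl lieZr scalerA exprS.
Qed.

(** The kernel of [phi] is a proper subalgebra containing [M], hence equals [M] by maximality; any
    line outside this hyperplane is a complement. *)
Let kernel_supplement (M : {vspace L}) (phi : L -> K) u : is_maximal_subalgebra M ->
  scalar phi -> (forall x y, phi x = 0 -> phi y = 0 -> phi (lie x y) = 0) ->
  ad_nilpotent u -> phi u != 0 -> {in M, forall x, phi x = 0} ->
  exists U : {vspace L}, is_supplement U M /\ forall v, v \in U -> ad_nilpotent v.
Proof.
move=> [algM nMf maxM] phi_lin phi_lie nilu nzu phiM; apply: (line_supplement nilu).
have [W memW] := kernel_space phi_lin.
have defW : W = M.
  apply: maxM; last by apply/subvP => x Mx; rewrite memW phiM.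
    by move=> x y; rewrite !memW => /eqP x0 /eqP y0; rewrite phi_lie.
  by move=> Wf; move: nzu; rewrite -memW Wf memvf.
apply/eqP; rewrite eqEsubv subvf; apply/subvP => x _.
rewrite -[x](subrK ((phi x / phi u) *: u)) memv_add ?memvZ ?memv_line //.
rewrite -defW memW -scaleNr addrC phi_lin mulNr divfK ?addNr //.
Qed.

Lemma sl_extension_in_MU : in_MU L.
Proof.
move=> M maxM; case: (maxM) => algM nMf maxM'.
case: (boolP (ideal_space N <= M)%VS) => [sNM|nsNM]; last first.
  exists (ideal_space N); split; last by move=> u; apply: ad_nilpotent_ideal_mem.
  split; first by move=> x y _; apply: ideal_closed.
  apply/eqP; apply: contraT => nf; case/negP: nsNM; apply/addv_idPl.
  apply: maxM'; [|exact/eqP|exact: addvSl].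
  move=> _ _ /memv_addP[x Mx [n Nn ->]] /memv_addP[y My [n' Nn' ->]].
  rewrite lieDl !lieDr -addrA memv_add ?algM // !memvD //; try exact: ideal_closed.
  by rewrite lieC memvN; apply: ideal_closed.
(* The kernel of [phi t] is the stabilizer of the line through (1, t). *)
pose phi t x := d x - 2%:R * c x * t - a x * t ^+ 2.
have phi_lin t : scalar (phi t) by move=> s x y; rewrite /phi !linE; ring.
have phi_lie t x y : phi t x = 0 -> phi t y = 0 -> phi t (lie x y) = 0.
  move=> x0 y0; have -> : phi t (lie x y) =
     2%:R * (c y + a y * t) * phi t x - 2%:R * (c x + a x * t) * phi t y.
    by rewrite /phi a_lie c_lie d_lie; ring.
  by rewrite x0 y0 !mulr0 subrr.
have phi_f t : phi t f != 0.
  by case: coord_f => af cf df; rewrite /phi af cf df !(mulr0, mul0r) !subr0 oner_neq0.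
case: (classic (exists t, {in M, forall x, phi t x = 0})) => [[t phiM]|no_t].
  exact: (kernel_supplement maxM (phi_lin t) (phi_lie t) nilp_f (phi_f t) phiM).
(* The kernel of [a] is the stabilizer of the remaining line, the one through (0, 1). *)
case: (classic {in M, forall x, a x = 0}) => [aM|no_a].
  have ae : a e != 0 by case: coord_e => -> _ _; apply: oner_neq0.
  apply: (kernel_supplement maxM a_lin _ nilp_e ae aM) => x y x0 y0.
  by rewrite a_lie x0 y0 !(mulr0, mul0r) subrr mulr0.
have [x Mx nzx] : exists2 x, x \in M & a x <> 0.
  by apply: NNPP => nox; apply: no_a => x Mx; apply: NNPP => nz; apply: nox; exists x.
(* Since [a x] is nonzero, the image of [x] in sl2 has an eigenvector (1, t), with [t] a root of a
   quadratic equation. Some [y] in [M] does not stabilize that line. *)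
have [t phix] : exists t, phi t x = 0.
  have [t] := @solve_monicpoly K 2 (fun i => if i == 0%N then d x / a x else - (2%:R * c x / a x)) isT.
  rewrite !big_ord_recl big_ord0 /= expr0 expr1 => def_t; exists t.
  rewrite /phi def_t; field; exact/eqP.
have [y My nzy] : exists2 y, y \in M & phi t y <> 0.
  apply: NNPP => noy; apply: no_t; exists t => y My.
  by apply: NNPP => nz; apply: noy; exists y.
(* [e], [f] and [e - h - f] span L modulo [N], so [M], which contains [N], cannot contain all
   three. *)
have [u nilu nMu] : exists2 u, ad_nilpotent u & u \notin M.
  apply: NNPP => nou; have memM u : ad_nilpotent u -> u \in M.
    by move=> nilu; apply: contraT => nMu; case: nou; exists u.
  have Me := memM _ nilp_e; have Mf := memM _ nilp_f.
  have Mh : h \in M.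
    suff -> : h = e - f - (e - h - f) by apply: memvB (memM _ nilp_ehf); apply: memvB.
    by rewrite [e - h - f]addrAC opprD opprK addrA subrr add0r.
  case: nMf; apply/eqP; rewrite eqEsubv subvf; apply/subvP => z _.
  rewrite -[z](subrK (a z *: e + c z *: h + d z *: f)) memvD //; last by rewrite !memvD ?memvZ.
  apply: (subvP sNM); case: coord_e coord_f coord_h => ae ce de [af cf df] [ah ch dh].
  by apply/memN; rewrite !linE ae ce de af cf df ah ch dh; split; ring.
apply: (line_supplement nilu); apply/eqP; rewrite eqEdim subvf.
have dim_addline (W : {vspace L}) v : v \notin W -> \dim (W + <[v]>) = (\dim W).+1.
  move=> nWv; rewrite dimv_disjoint_sum ?dim_vline; last first.
    apply/eqP; rewrite -subv0; apply/subvP => w; rewrite memv_cap => /andP[Ww /vlineP[s def_w]].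
    case: (eqVneq s 0) => [s0|nzs]; first by rewrite def_w s0 scale0r mem0v.
    by case/negP: nWv; rewrite -[v](scalerK nzs) -def_w memvZ.
  have -> : v != 0 by apply: contraNneq nWv => ->; apply: mem0v.
  by rewrite addn1.
apply: leq_trans dim_le _; rewrite dim_addline //.
(* [x] is outside [N] by its coordinate [a x], and [phi t] vanishes on [N] and [x] but not on [y].
   So [M] has codimension at most 1, and the line of [u] fills it up. *)
have N1 : (\dim (ideal_space N + <[x]> + <[y]>)%VS = \dim (ideal_space N) + 2)%N.
  rewrite !dim_addline ?addn2 //; first by apply/negP => /memN [/nzx].
  apply/negP => /memv_addP[n Nn [_ /vlineP[s ->] def_y]]; apply: nzy.
  rewrite def_y addrC phi_lin phix mulr0 add0r.
  by have [an cn dn] := (memN n).1 Nn; rewrite /phi an cn dn; ring.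
by rewrite addn3 ltnS -addn2 -N1 dimvS // !subv_add sNM -!memvE Mx My.
Qed.

End SlExtension.

(** * Quotients *)

Section QuotientVector.
Variables (K : fieldType) (L : finLieType K) (N : lieIdeal L).
Local Notation Q := (lie_quotient N).

Lemma quot_eqP (x y : L) : reflect (\pi_Q x = \pi_Q y) (x - y \in ideal_space N).
Proof. by rewrite [_ \in _]Quotient.idealrBE; apply: eqP. Qed.

Lemma quot_linear : linear (\pi_Q : L -> Q).
Proof. by move=> a x y; rewrite [LHS]Quotient.pi_add -pi_scale. Qed.

HB.instance Definition _ := GRing.isLinear.Build K L Q *:%R (\pi_Q) quot_linear.

(** The quotient gets its finite dimension by identification with the complement [N^C]. *)
Let complement_part (x : L) := vsproj (ideal_space N)^C (x - projv (ideal_space N) x).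

Let complement_part_linear : linear complement_part.
Proof.
move=> a x y; rewrite /complement_part -[RHS]linearP; congr (vsproj _).
by rewrite linearP scalerBr opprD addrACA.
Qed.

Let complement_part_pi x : complement_part (repr (\pi_Q x)) = complement_part x.
Proof.
have Nx : repr (\pi_Q x) - x \in ideal_space N by apply/quot_eqP; rewrite reprK.
have -> : repr (\pi_Q x) = 1 *: (repr (\pi_Q x) - x) + x by rewrite scale1r subrK.
rewrite complement_part_linear scale1r.
by rewrite {1}/complement_part projv_id // subrr linear0 add0r.
Qed.

Lemma quot_vect_iso : Vector.axiom (\dim (ideal_space N)^C) Q.
Proof.
have [r r_lin r_bij] := subvs_vect_iso (ideal_space N)^C.
exists (fun q => r (complement_part (repr q))).
  move=> a; elim/quotW=> x; elim/quotW=> y; rewrite -r_lin; congr (r _).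
  by rewrite -linearP !complement_part_pi complement_part_linear.
apply: (bij_comp r_bij); exists (fun w => \pi_Q (vsval w)) => [|w].
  elim/quotW=> x; rewrite complement_part_pi vsprojK; last exact: memv_projC.
  by apply/quot_eqP; rewrite addrAC subrr add0r memvN memv_proj.
rewrite complement_part_pi /complement_part.
have -> : projv (ideal_space N) (vsval w) = 0.
  by apply/eqP; rewrite -memv_ker lker_proj subvsP.
by rewrite subr0 vsvalK.
Qed.

HB.instance Definition _ := Lmodule_hasFinDim.Build K Q quot_vect_iso.
Lemma pi_lieE x y : \pi_Q (lie x y) = lie (\pi_Q x) (\pi_Q y).
Proof. exact/esym/pi_lie. Qed.

Lemma quot_eq0 x : (\pi_Q x == 0) = (x \in ideal_space N).
Proof.
rewrite -[0](linear0 (\pi_Q : {linear L -> Q})) -[x in RHS]subr0.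
by apply/eqP/quot_eqP.
Qed.

End QuotientVector.

Section QuotientMU.
Variables (K : fieldType) (L : finLieType K) (N : lieIdeal L).
Local Notation Q := (lie_quotient N).

Let pi_lin : 'Hom(L, Q) := linfun (\pi_Q).
Let pi_linE x : pi_lin x = \pi_Q x. Proof. exact: lfunE. Qed.

Let mem_preim (W : {vspace Q}) x : (x \in (pi_lin @^-1: W)%VS) = (\pi_Q x \in W).
Proof. by rewrite -memv_preim pi_linE. Qed.

(** The preimage of a maximal subalgebra is maximal, because subalgebras above it contain [N] and
    are determined by their images; the image of a supplement is a supplement. *)
Lemma quotient_in_MU : in_MU L -> in_MU Q.
Proof.
move=> MUL M [algM nMf maxM].
have sNpre (W : {vspace Q}) : (ideal_space N <= pi_lin @^-1: W)%VS.
  by apply/subvP => x Nx; rewrite mem_preim (eqP (_ : \pi_Q x == 0)) ?mem0v // quot_eq0.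
have [U [[algU MU] nilU]] : exists U, is_supplement U (pi_lin @^-1: M)%VS /\
    forall u, u \in U -> ad_nilpotent u.
  apply: MUL; split=> [x y||W algW nWf sMW].
  - by rewrite !mem_preim pi_lieE; apply: algM.
  - move=> pMf; apply: nMf; apply/eqP; rewrite eqEsubv subvf; apply/subvP.
    by elim/quotW=> x _; rewrite -mem_preim pMf memvf.
  have imW x : (\pi_Q x \in (pi_lin @: W)%VS) = (x \in W).
    apply/idP/idP => [/memv_imgP[y Wy] | Wx]; last by rewrite -pi_linE memv_img.
    rewrite pi_linE => /quot_eqP Nxy; rewrite -[x](subrK y) memvD //.
    exact: (subvP (subv_trans (sNpre M) sMW)).
  have defM : (pi_lin @: W)%VS = M.
    apply: maxM.
    - elim/quotW=> x; elim/quotW=> y; rewrite -pi_lieE !imW; exact: algW.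
    - move=> Wf; apply: nWf; apply/eqP; rewrite eqEsubv subvf; apply/subvP => x _.
      by rewrite -imW Wf memvf.
    apply/subvP; elim/quotW=> x Mx; rewrite imW; apply: (subvP sMW).
    by rewrite mem_preim.
  by apply/vspaceP => x; rewrite mem_preim -defM imW.
exists (pi_lin @: U)%VS; split; first split.
- move=> _ _ /memv_imgP[x Ux ->] /memv_imgP[y Uy ->].
  by rewrite !pi_linE -pi_lieE -pi_linE memv_img // algU.
- apply/eqP; rewrite eqEsubv subvf; apply/subvP; elim/quotW=> x _.
  have : x \in (pi_lin @^-1: M + U)%VS by rewrite MU memvf.
  case/memv_addP=> m Mm [u Uu ->]; rewrite linearD /= memv_add -?mem_preim //.
  by rewrite mem_preim -pi_linE memv_img.
move=> _ /memv_imgP[u /nilU[n nu] ->]; exists n; elim/quotW=> x.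
suff -> : iter n (lie (pi_lin u)) (\pi_Q x) = \pi_Q (iter n (lie u) x).
  by rewrite nu linear0.
by elim: (n) => //= k ->; rewrite pi_linE pi_lieE.
Qed.

End QuotientMU.

Section QuotientSemisimple.
Variables (K : closedFieldType) (L : finLieType K) (N : lieIdeal L).
Hypothesis char0 : [pchar K] =i pred0.
Hypothesis nilradN : is_nilradical N.
Hypothesis MUL : in_MU L.
Local Notation Q := (lie_quotient N).

Lemma quotient_no_abelian_ideals : no_abelian_ideals Q.
Proof.
move=> A idA abA; apply/eqP; rewrite -subv0; apply/subvP; elim/quotW=> x Ax.
pose pi_lin : 'Hom(L, Q) := linfun (\pi_Q).
have mem_preim y : (y \in (pi_lin @^-1: A)%VS) = (\pi_Q y \in A).
  by rewrite -memv_preim lfunE.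
rewrite memv0 quot_eq0.
have [nilN maxN] := nilradN.
apply: (subvP (MU_ideal_abelian_mod_nilradical char0 nilN maxN MUL (A := (pi_lin @^-1: A)%VS) _ _)).
- by move=> y z; rewrite !mem_preim pi_lieE; apply: idA.
- by move=> y z; rewrite !mem_preim -quot_eq0 pi_lieE => Ay Az; apply/eqP/abA.
by rewrite mem_preim.
Qed.

End QuotientSemisimple.

Lemma nilpotent_in_MU (K : closedFieldType) (char0 : [pchar K] =i pred0)
  (L : finLieType K) : is_nilpotent (fullv : {vspace L}) -> in_MU L.
Proof.
move=> nilL M _; exists fullv; split; last first.
  have idL : is_ideal (fullv : {vspace L}) by move=> x y _; rewrite memvf.
  by move=> u uL; apply: (ad_nilpotent_ideal_mem (N := LieIdeal idL)).
by split=> [x y _ _|]; rewrite ?memvf // addvf.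
Qed.

Lemma sl2_quotient_in_MU (K : closedFieldType) (char0 : [pchar K] =i pred0)
  (L : finLieType K) (N : lieIdeal L) : is_nilpotent N ->
  lie_isomorphic (lie_quotient N) (sl K 2) -> in_MU L.
Proof.
move=> nilN [F [[G FK GK] F_lie]].
pose A x : sl K 2 := F (\pi_(lie_quotient N) x).
have A_lin t x y : sl_mx (A (t *: x + y)) = t *: sl_mx (A x) + sl_mx (A y).
  by rewrite /A !linearP.
have A_lie x y : sl_mx (A (lie x y)) = sl_mx (A x) *m sl_mx (A y) - sl_mx (A y) *m sl_mx (A x).
  by rewrite /A pi_lieE F_lie.
have A_onto a c d : exists x, sl_mx (A x) = sl2_mx a c d.
  exists (repr (G (Sl (sl2_mx_traceless a c d)))).
  by rewrite /A reprK GK.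
have [e Ae] := A_onto 1 0 0; have [h Ah] := A_onto 0 1 0; have [f Af] := A_onto 0 0 1.
pose a x := A x ord0 ord_max; pose c x := A x ord0 ord0; pose d x := A x ord_max ord0.
have A_coord x : sl_mx (A x) = sl2_mx (a x) (c x) (d x) by apply: sl2_mxP.
apply: (@sl_extension_in_MU K L char0 N a c d e h f nilN).
- by move=> t x y; rewrite /a A_lin !mxE.
- by move=> t x y; rewrite /c A_lin !mxE.
- by move=> t x y; rewrite /d A_lin !mxE.
- move=> x; rewrite -quot_eq0; split=> [/eqP Nx|[ax cx dx]].
    have A0 : A x = 0 by rewrite /A Nx linear0.
    by rewrite /a /c /d A0 !mxE.
  apply/eqP/(can_inj FK); rewrite linear0; apply/val_inj; rewrite /= -/(A x) A_coord ax cx dx.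
  by apply/matrixP => i j; rewrite !mxE oppr0 !if_same.
- by move=> x y; rewrite {1}/a A_lie !A_coord !mxE !big_ord_recl !big_ord0 !mxE /=; ring.
- by move=> x y; rewrite {1}/c A_lie !A_coord !mxE !big_ord_recl !big_ord0 !mxE /=; ring.
- by move=> x y; rewrite {1}/d A_lie !A_coord !mxE !big_ord_recl !big_ord0 !mxE /=; ring.
- by rewrite /a /c /d Ae !mxE.
- by rewrite /a /c /d Ah !mxE.
- by rewrite /a /c /d Af !mxE.
Qed.

Theorem theorem4p3 (K : closedFieldType) (char0 : [pchar K]%R =i pred0)
    (L : finLieType K) (N : lieIdeal L) (nilradN : is_nilradical N) :
  in_MU L <->
  is_nilpotent (fullv : {vspace L}) \/
  lie_isomorphic (lie_quotient N) (sl K 2).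
Proof.
have [nilN maxN] := nilradN; split=> [MUL|[|]]; last 2 first.
- exact: nilpotent_in_MU.
- exact: sl2_quotient_in_MU.
have [Q0|isoQ] := semisimple_MU char0 (quotient_no_abelian_ideals char0 nilradN MUL)
  (quotient_in_MU MUL); last by right.
(* A zero quotient means [L = N], the nilpotent alternative. *)
left; have <- : ideal_space N = fullv; last by [].
apply/eqP; rewrite eqEsubv subvf; apply/subvP => x _.
by rewrite -quot_eq0 -memv0 -Q0 memvf.
Qed.
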